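(* Let $\Bbbk$ be an algebraically closed field of characteristic zero, let $\lambda\in\Bbbk$ with $\lambda\neq0$, and let $\mathfrak U=\mathfrak U(\lambda)$ be the algebra presented in the context, with the elements $\Omega,\phi_\pm,\psi_\pm$ defined there. Then: (1) The prime spectrum of $\mathfrak U$ is $$\mathrm{Spec}(\mathfrak U)=\{\langle0\rangle\}\cup\{\langle\phi_+\rangle,\langle\phi_-\rangle,\langle\psi_+\rangle,\langle\psi_-\rangle\}\cup\{\langle\Omega-\alpha\rangle\mid\alpha\in\Bbbk\setminus\{\pm4\lambda\}\}\cup\{\langle x,g-1\rangle,\langle x,g+1\rangle\}$$ $$\cup\{\langle x,g-1,y-\gamma\rangle\mid\gamma\in\Bbbk\}\cup\{\langle x,g+1,y-\gamma\rangle\mid\gamma\in\Bbbk\}.$$ The proper inclusions among these primes are exactly those generated by transitivity from: $\langle0\rangle\subset\langle\phi_\pm\rangle$, $\langle0\rangle\subset\langle\psi_\pm\rangle$, $\langle 0\rangle\subset\langle\Omega-\alpha\rangle$ for $\alpha\in\Bbbk\setminus\{\pm4\lambda\}$; $\langle\phi_+\rangle,\langle\phi_-\rangle\subset\langle x,g-1\rangle$; $\langle\psi_+\rangle,\langle\psi_-\rangle\subset\langle x,g+1\rangle$; $\langle x,g-1\rangle\subset\langle x,g-1,y-\gamma\rangle$ and $\langle x,g+1\rangle\subset\langle x,g+1,y-\gamma\rangle$ for all $\gamma\in\Bbbk$. (2) The maximal spectrum of $\mathfrak U$ is $$\mathrm{Max}(\mathfrak U)=\{\langle\Omega-\alpha\rangle\mid\alpha\in\Bbbk\setminus\{\pm4\lambda\}\}\cup\{\langle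 x,g\pm1,y-\gamma\rangle\mid\gamma\in\Bbbk\}.$$ (3) The primitive spectrum of $\mathfrak U$ is $$\mathrm{Prim}(\mathfrak U)=\{\langle\phi_+\rangle,\langle\phi_-\rangle,\langle\psi_+\rangle,\langle\psi_-\rangle\}\cup\{\langle\Omega-\alpha\rangle\mid\alpha\in\Bbbk\setminus\{\pm4\lambda\}\}\cup\{\langle x,g-1,y-\gamma\rangle\mid\gamma\in\Bbbk\}\cup\{\langle x,g+1,y-\gamma\rangle\mid\gamma\in\Bbbk\}.$$ (4) Every prime ideal of $\mathfrak U$ is completely prime. (5) Every nonzero (two-sided) ideal of $\mathfrak U$ intersects the centre $Z(\mathfrak U)$ nontrivially.
   Context: $\mathfrak U(\lambda)$ is the associative unital $\Bbbk$-algebra generated by $g^{\pm1},x,y$ with relations $gg^{-1}=g^{-1}g=1$, $gxg^{-1}=x$, $gyg^{-1}=y+x$, $yx-xy=-\tfrac12x^2+\lambda(1-g^2)$. Fix a square root $\sqrt{2\lambda}\in\Bbbk$. Define $\Omega=x^2g^{-1}-2\lambda(g^{-1}+g)$ (a central element), $\phi_\pm=x\pm\sqrt{2\lambda}(g-1)$ and $\psi_\pm=x\pm\sqrt{2\lambda}(g+1)$ (normal elements, i.e. $a\mathfrak U=\mathfrak Ua$). Modules are left modules. $\langle\mathcal S\rangle$ denotes the two-sided ideal generated by $\mathcal S$. A proper ideal $P$ is prime if $\mathfrak a\mathfrak b\subseteq P$ implies $\mathfrak a\subseteq P$ or $\mathfrak b\subseteq P$ for all ideals $\mathfrak a,\mathfrak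 b$; completely prime if the quotient by $P$ is a domain; primitive if it is the annihilator of a simple module. $\mathrm{Spec}$, $\mathrm{Prim}$, $\mathrm{Max}$ denote the sets of prime, primitive and maximal two-sided ideals. *)

(* Defs.v *)
From HB Require Import structures.
From mathcomp Require Import all_boot all_order all_algebra.
From mathcomp Require Import boolp classical_sets.
From mathcomp Require Import monalg.
From Stdlib Require Import Relation_Operators.

Set Implicit Arguments.
Unset Strict Implicit.
Unset Printing Implicit Defensive.

Import GRing.Theory.

Local Open Scope classical_set_scope.
Local Open Scope ring_scope.
Local Open Scope quotient_scope.

Section Ideals.
Variable R : pzRingType.
Implicit Types (I J A B P M S : set R).

Definition twosided_ideal I :=
  [/\ I 0, (forall a b, I a -> I b -> I (a + b)),
      (forall r a, I a -> I (r * a)) & (forall r a, I a -> I (a * r))].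

Definition ideal_gen S : set R := smallest twosided_ideal S.

Definition ideal_mul A B : set R :=
  [set c | exists (n : nat) (a b : 'I_n -> R),
     (forall i, A (a i) /\ B (b i)) /\ c = \sum_(i < n) a i * b i].

Definition proper_twosided_ideal I := twosided_ideal I /\ I <> setT.

Definition prime_ideal P :=
  proper_twosided_ideal P /\
  forall A B, twosided_ideal A -> twosided_ideal B ->
    ideal_mul A B `<=` P -> A `<=` P \/ B `<=` P.

Definition maximal_ideal M :=
  proper_twosided_ideal M /\
  forall J, proper_twosided_ideal J -> M `<=` J -> J = M.

(* Classically, [{pred M}] ranges over all subsets of [M]. *)
Definition simple_module (M : lmodType R) :=
  (exists m : M, m != 0) /\
  forall N : {pred M}, submod_closed N -> N =i pred1 0 \/ N =i predT.

Definition annihilator (M : lmodType R) : set R :=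
  [set a | forall m : M, a *: m = 0].

Definition primitive_ideal P :=
  exists M : lmodType R, simple_module M /\ P = annihilator M.

Definition center : set R := [set z | forall a, GRing.comm z a].

Definition is_domain :=
  (1 : R) != 0 /\ forall a b : R, a * b = 0 -> a = 0 \/ b = 0.

Lemma ideal_gen_ideal S : twosided_ideal (ideal_gen S).
Proof.
split.
- by move=> I [[]].
- move=> a b Ia Ib I HI; have [[_ D _ _] _] := HI.
  by apply: D; [apply: Ia | apply: Ib].
- move=> r a Ia I HI; have [[_ _ L _] _] := HI.
  by apply: L; apply: Ia.
- move=> r a Ia I HI; have [[_ _ _ L] _] := HI.
  by apply: L; apply: Ia.
Qed.

End Ideals.

Section Quotient.
Variables (R : pzRingType) (S : set R).

Definition ideal_gen_pred : {pred R} := fun a => `[< ideal_gen S a >].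

Lemma ideal_gen_predP a : reflect (ideal_gen S a) (a \in ideal_gen_pred).
Proof. exact: asboolP. Qed.

Fact ideal_gen_zmod_closed : zmod_closed ideal_gen_pred.
Proof.
have [I0 ID IL _] := ideal_gen_ideal S.
split=> [|a b /ideal_gen_predP Ia /ideal_gen_predP Ib]; apply/ideal_gen_predP=> //.
by apply: ID => //; rewrite -mulN1r; apply: IL.
Qed.
HB.instance Definition _ :=
  GRing.isZmodClosed.Build R ideal_gen_pred ideal_gen_zmod_closed.

(* The ring R/<S>; when S is itself a two-sided ideal this is R/S. *)
Definition quotient : Type := Quotient.quot ideal_gen_pred.
HB.instance Definition _ := GRing.Zmodule.on quotient.
HB.instance Definition _ := EqQuotient.on quotient.

(* The operations are locked because the quotient representatives compute. *)
Fact quotient_key : unit. Proof. by []. Qed.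
Definition toquot : R -> quotient :=
  locked_with quotient_key (fun a => \pi_quotient a).
Canonical toquot_unlockable := [unlockable of toquot].

Lemma toquotK (q : quotient) : toquot (repr q) = q.
Proof. by rewrite unlock reprK. Qed.

Lemma toquot_eqP a b : reflect (toquot a = toquot b) (a - b \in ideal_gen_pred).
Proof. by rewrite Quotient.idealrBE unlock; apply: eqP. Qed.

Lemma toquotD a b : toquot (a + b) = toquot a + toquot b.
Proof. by rewrite unlock; exact: (Quotient.pi_add ideal_gen_pred a b). Qed.

Lemma toquot0 : toquot 0 = 0.
Proof. by apply: (addrI (toquot 0)); rewrite -toquotD !addr0. Qed.

Definition qone : quotient := toquot 1.
Definition qmul : quotient -> quotient -> quotient :=
  locked_with quotient_key (fun p q => toquot (repr p * repr q)).
Canonical qmul_unlockable := [unlockable of qmul].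

Lemma toquotM a b : toquot (a * b) = qmul (toquot a) (toquot b).
Proof.
have [_ _ IL IR] := ideal_gen_ideal S.
rewrite [qmul]unlock; apply/toquot_eqP; set a' := repr _; set b' := repr _.
have /ideal_gen_predP Ha : a - a' \in ideal_gen_pred.
  by apply/toquot_eqP; rewrite toquotK.
have /ideal_gen_predP Hb : b - b' \in ideal_gen_pred.
  by apply/toquot_eqP; rewrite toquotK.
have -> : a * b - a' * b' = (a - a') * b + a' * (b - b').
  by rewrite mulrBl mulrBr addrA subrK.
by apply: rpredD; apply/ideal_gen_predP; [apply: IR | apply: IL].
Qed.

Fact qmulA : associative qmul.
Proof.
move=> p q r; rewrite -[p]toquotK -[q]toquotK -[r]toquotK.
by rewrite -!toquotM mulrA.
Qed.
Fact qmul1q : left_id qone qmul.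
Proof. by move=> p; rewrite -[p]toquotK -toquotM mul1r. Qed.
Fact qmulq1 : right_id qone qmul.
Proof. by move=> p; rewrite -[p]toquotK -toquotM mulr1. Qed.
Fact qmulDl : left_distributive qmul +%R.
Proof.
move=> p q r; rewrite -[p]toquotK -[q]toquotK -[r]toquotK.
by rewrite -toquotD -!toquotM -toquotD mulrDl.
Qed.
Fact qmulDr : right_distributive qmul +%R.
Proof.
move=> p q r; rewrite -[p]toquotK -[q]toquotK -[r]toquotK.
by rewrite -toquotD -!toquotM -toquotD mulrDr.
Qed.
HB.instance Definition _ :=
  GRing.Zmodule_isPzRing.Build quotient qmulA qmul1q qmulq1 qmulDl qmulDr.

End Quotient.

Definition completely_prime_ideal (R : pzRingType) (P : set R) :=
  proper_twosided_ideal P /\ is_domain (quotient P).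

Definition Spec (R : pzRingType) : set (set R) := [set P | prime_ideal P].
Definition Max (R : pzRingType) : set (set R) := [set P | maximal_ideal P].
Definition Prim (R : pzRingType) : set (set R) := [set P | primitive_ideal P].

Arguments center R : clear implicits.
Arguments Spec R : clear implicits.
Arguments Max R : clear implicits.
Arguments Prim R : clear implicits.

Section ScalarAction.
Variables (k : comNzRingType) (A : lalgType k) (S : set A).

Definition qscale : k -> quotient S -> quotient S :=
  locked_with quotient_key (fun c q => toquot S (c *: repr q)).
Canonical qscale_unlockable := [unlockable of qscale].

Lemma toquotZ c a : toquot S (c *: a) = qscale c (toquot S a).
Proof.
have [_ _ IL _] := ideal_gen_ideal S.
rewrite [qscale]unlock; apply/toquot_eqP; set a' := repr _.
have /ideal_gen_predP Ha : a - a' \in ideal_gen_pred S.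
  by apply/toquot_eqP; rewrite toquotK.
by apply/ideal_gen_predP; rewrite -scalerBr -mulr_algl; apply: IL.
Qed.

Fact qscaleA a b q : qscale a (qscale b q) = qscale (a * b) q.
Proof. by rewrite -[q]toquotK -!toquotZ scalerA. Qed.
Fact qscale1 : left_id 1 qscale.
Proof. by move=> q; rewrite -[q]toquotK -toquotZ scale1r. Qed.
Fact qscaleDr : right_distributive qscale +%R.
Proof.
move=> c p q; rewrite -[q]toquotK -[p]toquotK.
by rewrite -toquotD -!toquotZ -toquotD scalerDr.
Qed.
Fact qscaleDl q : {morph qscale^~ q : a b / a + b}.
Proof. by move=> a b; rewrite -[q]toquotK -!toquotZ -toquotD scalerDl. Qed.
HB.instance Definition _ := GRing.Zmodule_isLmodule.Build k (quotient S)
  qscaleA qscale1 qscaleDr qscaleDl.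

Lemma qscalerAl (c : k) (p q : quotient S) : c *: (p * q) = (c *: p) * q.
Proof.
rewrite -[q]toquotK -[p]toquotK.
rewrite -[toquot S _ * _]/(qmul _ _) -[RHS]/(qmul (qscale _ _) _).
rewrite -[LHS]/(qscale _ _).
by rewrite -toquotM -!toquotZ -toquotM scalerAl.
Qed.

Lemma qscalerAr (c : k) (p q : quotient S) :
  (forall a b : A, c *: (a * b) = a * (c *: b)) ->
  c *: (p * q) = p * (c *: q).
Proof.
move=> AZ; rewrite -[q]toquotK -[p]toquotK.
rewrite -[toquot S _ * _]/(qmul _ _) -[RHS]/(qmul _ (qscale _ _)).
rewrite -[LHS]/(qscale _ _).
by rewrite -toquotM -!toquotZ -toquotM AZ.
Qed.
End ScalarAction.

Lemma malg_scalerAr (k : comNzRingType) (K : monomType) (c : k)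
  (a b : {malg k[K]}) : c *: (a * b) = a * (c *: b).
Proof.
have cC (f : {malg k[K]}) : c%:MP * f = f * c%:MP.
  rewrite !malgM_def fgmulUg fgmulgU; apply: eq_bigr => m _.
  by rewrite mul1m mulm1 mulrC.
by rewrite -[LHS]mul_malgC -[c *: b]mul_malgC mulrA cC -mulrA.
Qed.

Inductive generator := Gen_g | Gen_ginv | Gen_x | Gen_y.

Definition generator_code u : nat :=
  match u with Gen_g => 0 | Gen_ginv => 1 | Gen_x => 2 | Gen_y => 3 end.
Definition generator_decode (i : nat) : generator :=
  nth Gen_g [:: Gen_g; Gen_ginv; Gen_x; Gen_y] i.
Fact generator_codeK : cancel generator_code generator_decode.
Proof. by case. Qed.
HB.instance Definition _ := Countable.copy generator (can_type generator_codeK).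

Definition free_algebra (k : comNzRingType) : Type :=
  {malg k[{fmonom generator}]}.
HB.instance Definition _ (k : comNzRingType) :=
  GRing.Lalgebra.copy (free_algebra k) {malg k[{fmonom generator}]}.
HB.instance Definition _ (k : comNzRingType) :=
  GRing.Lalgebra_isAlgebra.Build k (free_algebra k)
    (@malg_scalerAr k {fmonom generator}).

Section Relators.
Variables (k : fieldType) (lam : k) (A : algType k) (g g' x y : A).

Inductive relators : A -> Prop :=
| rel_g_ginv : relators (g * g' - 1)
| rel_ginv_g : relators (g' * g - 1)
| rel_g_x : relators (g * x * g' - x)
| rel_g_y : relators (g * y * g' - (y + x))
| rel_y_x : relators
    (y * x - x * y - (- (2^-1 *: x ^+ 2) + lam *: (1 - g ^+ 2))).

Lemma relators_vanishP :
  (forall r, relators r -> r = 0) <->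
  [/\ g * g' = 1, g' * g = 1, g * x * g' = x, g * y * g' = y + x
    & y * x - x * y = - (2^-1 *: x ^+ 2) + lam *: (1 - g ^+ 2)].
Proof.
split=> [H|[r1 r2 r3 r4 r5] r]; first by split; apply/subr0_eq/H; constructor.
by case; apply/eqP; rewrite subr_eq0; apply/eqP.
Qed.
End Relators.

Lemma relators_map (k : fieldType) (lam : k) (A B : algType k)
    (f : {lrmorphism A -> B}) (g g' x y : A) :
  (forall s, relators lam (f g) (f g') (f x) (f y) s -> s = 0) <->
  (forall r, relators lam g g' x y r -> f r = 0).
Proof.
have fB a b : f (a - b) = f a - f b by exact: rmorphB.
have fD a b : f (a + b) = f a + f b by exact: rmorphD.
have fN a : f (- a) = - f a by exact: rmorphN.
have fM a b : f (a * b) = f a * f b by exact: rmorphM.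
have fX a n : f (a ^+ n) = f a ^+ n by exact: rmorphXn.
have fZ c a : f (c *: a) = c *: f a by exact: linearZ.
have f1 : f 1 = 1 by exact: rmorph1.
have fE := (fB, fD, fN, fX, fM, fZ, f1).
split=> [H r rr|H].
  by apply: H; case: rr => {r}; rewrite !fE;
    [exact: rel_g_ginv | exact: rel_ginv_g | exact: rel_g_x | exact: rel_g_y
    | exact: rel_y_x].
have H1 := H _ (rel_g_ginv lam g g' x y); have H2 := H _ (rel_ginv_g lam g g' x y).
have H3 := H _ (rel_g_x lam g g' x y); have H4 := H _ (rel_g_y lam g g' x y).
have H5 := H _ (rel_y_x lam g g' x y); move: H1 H2 H3 H4 H5; rewrite !fE.
by move=> r1 r2 r3 r4 r5; apply/relators_vanishP; split; apply: subr0_eq.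
Qed.

Section Algebra.
Variable k : fieldType.

Local Notation free_algebra := (free_algebra k).

Definition gen (u : generator) : free_algebra :=
  << fmu u >> : {malg k[{fmonom generator}]}.

Variable lam : k.

Definition frakU_relators : set free_algebra :=
  relators lam (gen Gen_g) (gen Gen_ginv) (gen Gen_x) (gen Gen_y).

Definition frakU : Type := quotient frakU_relators.
HB.instance Definition _ := GRing.PzRing.copy frakU (quotient frakU_relators).
HB.instance Definition _ := GRing.Lmodule.copy frakU (quotient frakU_relators).

(* The character g, g^-1 |-> 1; x, y |-> 0 shows that frakU is nontrivial. *)
Definition aug_word (m : {fmonom generator}) : k :=
  \prod_(u <- (m : seq _)) (u \in [:: Gen_g; Gen_ginv])%:R.
Fact aug_word_mmorphism : mmorphism aug_word.
Proof.
rewrite /aug_word; split=> [m1 m2|]; first by rewrite fmM big_cat.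
by rewrite fm1 big_nil.
Qed.
HB.instance Definition _ :=
  isMultiplicative.Build {fmonom generator} k aug_word aug_word_mmorphism.

Definition aug (f : free_algebra) : k^o := mmap idfun aug_word f.

Fact augB : zmod_morphism aug.
Proof. by move=> a b; exact: (rmorphB (mmap idfun aug_word)). Qed.
Fact augM : monoid_morphism aug.
Proof. by split=> [|a b]; [exact: (rmorph1 (mmap idfun aug_word)) |
  exact: (rmorphM (mmap idfun aug_word))]. Qed.
Fact augZ : scalable aug. Proof. by move=> c a; exact: mmapZ. Qed.
HB.instance Definition _ :=
  GRing.isZmodMorphism.Build free_algebra k^o aug augB.
HB.instance Definition _ :=
  GRing.isMonoidMorphism.Build free_algebra k^o aug augM.
HB.instance Definition _ :=
  GRing.isScalable.Build k free_algebra k^o _ aug augZ.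

Fact aug_relators r : frakU_relators r -> aug r = 0.
Proof.
have augg u : aug (gen u) = (u \in [:: Gen_g; Gen_ginv])%:R.
  by rewrite /aug /gen mmapU mul1r /aug_word fmU big_seq1.
move: r; apply: (relators_map lam aug _ _ _ _).1; rewrite /= !augg.
apply: (relators_vanishP _ _ _ _ _).2; split; rewrite ?(mulr0, mul0r, mulr1, addr0) //.
by rewrite expr1n !expr2 mulr0 !subrr !scaler0 oppr0 addr0.
Qed.

Fact frakU_nontrivial : (1 : frakU) != 0.
Proof.
apply/eqP => eq10.
have : toquot frakU_relators 1 = toquot frakU_relators 0.
  exact: etrans eq10 (esym (toquot0 _)).
move=> /toquot_eqP/ideal_gen_predP; rewrite subr0 => H.
have : aug 1 = 0.
  apply: (H [set f | aug f = 0]); split; last exact: aug_relators.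
  split=> [|a b a0 b0|r a a0|r a a0] /=.
  - exact: rmorph0.
  - by rewrite [LHS]rmorphD /= a0 b0 addr0.
  - by rewrite [LHS]rmorphM /= a0 mulr0.
  - by rewrite [LHS]rmorphM /= a0 mul0r.
by rewrite rmorph1 => /eqP; rewrite oner_eq0.
Qed.

HB.instance Definition _ :=
  GRing.PzSemiRing_isNonZero.Build frakU frakU_nontrivial.
HB.instance Definition _ := GRing.Lmodule_isLalgebra.Build k frakU
  (@qscalerAl k _ frakU_relators).
HB.instance Definition _ := GRing.Lalgebra_isAlgebra.Build k frakU
  (fun c p q => qscalerAr p q (@malg_scalerAr _ _ c)).

Definition frakU_pi (a : free_algebra) : frakU := toquot frakU_relators a.

Fact frakU_piB : zmod_morphism frakU_pi.
Proof.
have D a b : frakU_pi (a + b) = frakU_pi a + frakU_pi b by exact: toquotD.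
have N a : frakU_pi (- a) = - frakU_pi a.
  by apply: (addrI (frakU_pi a)); rewrite -D !subrr; exact: toquot0.
by move=> a b; rewrite D N.
Qed.
Fact frakU_piM : monoid_morphism frakU_pi.
Proof. by split=> [|a b]; [reflexivity | exact: toquotM]. Qed.
Fact frakU_piZ : scalable frakU_pi.
Proof. by move=> c a; exact: toquotZ. Qed.
HB.instance Definition _ :=
  GRing.isZmodMorphism.Build free_algebra frakU frakU_pi frakU_piB.
HB.instance Definition _ :=
  GRing.isMonoidMorphism.Build free_algebra frakU frakU_pi frakU_piM.
HB.instance Definition _ :=
  GRing.isScalable.Build k free_algebra frakU _ frakU_pi frakU_piZ.

Definition U_g : frakU := frakU_pi (gen Gen_g).
Definition U_ginv : frakU := frakU_pi (gen Gen_ginv).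
Definition U_x : frakU := frakU_pi (gen Gen_x).
Definition U_y : frakU := frakU_pi (gen Gen_y).

Lemma frakU_relations :
  [/\ U_g * U_ginv = 1, U_ginv * U_g = 1, U_g * U_x * U_ginv = U_x,
      U_g * U_y * U_ginv = U_y + U_x
    & U_y * U_x - U_x * U_y
      = - (2^-1 *: U_x ^+ 2) + lam *: (1 - U_g ^+ 2)].
Proof.
apply: (relators_vanishP _ _ _ _ _).1.
apply: (relators_map lam frakU_pi _ _ _ _).2 => r rr.
rewrite -[RHS](toquot0 frakU_relators); apply/toquot_eqP/ideal_gen_predP.
by rewrite subr0 => I [_]; apply.
Qed.

Definition Omega : frakU :=
  U_x ^+ 2 * U_ginv - (2 * lam) *: (U_ginv + U_g).

(* [s] is the chosen square root of [2 * lam]. *)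
Variable s : k.
Definition phi_plus : frakU := U_x + s *: (U_g - 1).
Definition phi_minus : frakU := U_x - s *: (U_g - 1).
Definition psi_plus : frakU := U_x + s *: (U_g + 1).
Definition psi_minus : frakU := U_x - s *: (U_g + 1).

(* The inclusions of the prime spectrum that generate all others by
   transitivity. *)
Inductive spec_edge : set frakU -> set frakU -> Prop :=
| edge_0_phip : spec_edge (ideal_gen [set 0]) (ideal_gen [set phi_plus])
| edge_0_phim : spec_edge (ideal_gen [set 0]) (ideal_gen [set phi_minus])
| edge_0_psip : spec_edge (ideal_gen [set 0]) (ideal_gen [set psi_plus])
| edge_0_psim : spec_edge (ideal_gen [set 0]) (ideal_gen [set psi_minus])
| edge_0_Omega alpha : alpha != 4 * lam -> alpha != - (4 * lam) ->
    spec_edge (ideal_gen [set 0]) (ideal_gen [set Omega - alpha%:A])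
| edge_phip : spec_edge (ideal_gen [set phi_plus])
                        (ideal_gen [set U_x; U_g - 1])
| edge_phim : spec_edge (ideal_gen [set phi_minus])
                        (ideal_gen [set U_x; U_g - 1])
| edge_psip : spec_edge (ideal_gen [set psi_plus])
                        (ideal_gen [set U_x; U_g + 1])
| edge_psim : spec_edge (ideal_gen [set psi_minus])
                        (ideal_gen [set U_x; U_g + 1])
| edge_gB1 gamma : spec_edge (ideal_gen [set U_x; U_g - 1])
                             (ideal_gen [set U_x; U_g - 1; U_y - gamma%:A])
| edge_gD1 gamma : spec_edge (ideal_gen [set U_x; U_g + 1])
                             (ideal_gen [set U_x; U_g + 1; U_y - gamma%:A]).

End Algebra.

Arguments U_g {k lam}.
Arguments U_ginv {k lam}.
Arguments U_x {k lam}.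
Arguments U_y {k lam}.

(* Main.v *)
Require Import Defs.
From HB Require Import structures.
From mathcomp Require Import all_boot all_order all_algebra.
From mathcomp Require Import boolp classical_sets.
From mathcomp Require Import monalg.
From mathcomp Require Import ring.
From Stdlib Require Import Relation_Operators.

Set Implicit Arguments.
Unset Strict Implicit.
Unset Printing Implicit Defensive.

Import GRing.Theory.

Local Open Scope classical_set_scope.
Local Open Scope ring_scope.
Local Open Scope quotient_scope.

(** The algebra is a differential operator ring.  Its elements [g^(+-1)] and
    [x] generate a commutative subalgebra [C], the operator [ [y, .] ]
    restricts to a derivation of [C], and every element is a left combination
    of powers of [y] over [C].  Everything is read off from this derivation
    and its eigenvectors.

    Write [2 lam = s^2].  For both signs of [s] the element
    [v_s = g^-1 ((x - s)^2 - s^2 g^2)] is an eigenvector of [ [y, .] ] with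
    eigenvalue [-s], while [Omega] has eigenvalue [0].  Moreover
    [v_s v_(-s) = (Omega - 4 lam) (Omega + 4 lam)], and [g^-1] and [x g^-1] are
    linear combinations of [Omega], [v_s] and [v_(-s)].  So [C] is obtained
    from [k[Omega, v_s, v_(-s)]] by inverting [g^-1], and up to powers of
    [g^-1] and [v_s] its elements are polynomials in [Omega] and [v_s], on
    which [ [y, .] ] is [-s] times the Euler operator [v_s d/dv_s]
    ([v_form], [theta_deriv_Ev]).

    Each curve [Omega = alpha] is a conic, rational with coordinate [v_s].
    This gives a representation in an Ore extension of the field [k(v_s)]
    ([conic_representation]), which is a domain; hence its kernel is completely
    prime.  Comparing with the normal form above, the kernel is
    [<Omega - alpha>] as long as [v_s v_(-s)] is invertible modulo that ideal,
    that is, for [alpha] different from [+-4 lam] ([rep_ker_Omega]).  At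
    [alpha = +-4 lam] the conic degenerates into two lines, cut out by two of
    the normal elements [phi_(+-)], [psi_(+-)], and the kernel is generated by
    one of these, the choice of the sign of [s] deciding which
    ([rep_ker_chi]).  As a nonzero element survives on all but finitely many
    conics, the algebra is a domain and the powers of [y] are independent over
    [C].

    Ideals come under control in two steps.  Commuting with [v_s] lowers the
    degree in [y], so an ideal larger than one of these kernels, or than [0],
    contains new elements of [C] ([descent]).  Then the Euler operator splits a
    polynomial into its monomials [r(Omega) v_s^n] ([euler_monomial]), and
    multiplying by [v_(-s)^n] yields a polynomial in the central element
    [Omega].  So nonzero ideals meet the centre, and a nonzero prime contains
    some [Omega - alpha].  On the conic only a power of [v_s] remains, which is
    a unit when [alpha] is not [+-4 lam]; these ideals are maximal.  Otherwise
    the prime contains one of [phi_(+-)], [psi_(+-)], and if it is larger than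
    the ideal of that element, it contains [v_s] too, hence [x] and
    [g -+ 1].  The quotient by the latter is [k[y]] ([prime_classification]).

    For the primitive ideals, maximal ideals are primitive and [k[y]] has no
    faithful simple module.  The ideals [<phi_(+-)>], [<psi_(+-)>] annihilate a
    simple module on which [v_s] has a nonzero eigenvalue ([chi_primitive]).
    The zero ideal needs most work: on a faithful simple module every
    [Omega - alpha] is invertible, and [faithful_simple_absurd] derives a
    contradiction by specializing at a generic [alpha], whether or not the
    module has torsion over [C]. *)

(** * Derivations and Ore extensions *)

Record derivation (R : comNzRingType) := Derivation {
  der :> R -> R;
  derD : {morph der : a b / a + b};
  derM : forall a b, der (a * b) = der a * b + a * der b }.

Section DerivationTheory.
Variables (R : comNzRingType) (d : derivation R).

Lemma der0 : d 0 = 0.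
Proof. by apply: (addrI (d 0)); rewrite -derD !addr0. Qed.

Lemma der1 : d 1 = 0.
Proof.
by have /eqP := derM d 1 1; rewrite !mulr1 mul1r -subr_eq0 opprD addrA subrr add0r oppr_eq0 => /eqP.
Qed.

Lemma derN a : d (- a) = - d a.
Proof. by apply: (addrI (d a)); rewrite -derD !subrr der0. Qed.

Lemma derB a b : d (a - b) = d a - d b.
Proof. by rewrite derD derN. Qed.

End DerivationTheory.

(** The Ore extension [F[Y; d]] has the polynomials as carrier, with the
    coefficients to the left of [Y].  Left multiplication by [Y] is the
    operator [q |-> d q + q Y]; it determines the product, and associativity
    follows from its commuting with right multiplications. *)
Section OreExtension.
Variables (F : idomainType) (d : derivation F).

Definition ore of derivation F : Type := {poly F}.
HB.instance Definition _ := GRing.Zmodule.on (ore d).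

Definition ore_Y (q : {poly F}) : {poly F} := map_poly d q + q * 'X.

Definition ore_mul (p q : (ore d)) : (ore d) :=
  \sum_(i < size (p : {poly F})) (p : {poly F})`_i *: iter i ore_Y q.

Lemma ore_Y_coef q i : (ore_Y q)`_i = d q`_i + (q * 'X)`_i.
Proof. by rewrite coefD coef_map_id0 ?der0. Qed.

Lemma ore_YD : {morph ore_Y : p q / p + q}.
Proof.
by move=> p q; apply/polyP=> i; rewrite coefD !ore_Y_coef mulrDl !coefD derD addrACA.
Qed.

Lemma ore_Y0 : ore_Y 0 = 0.
Proof. by apply: (addrI (ore_Y 0)); rewrite -ore_YD !addr0. Qed.

Lemma ore_Y_scale a q : ore_Y (a *: q) = d a *: q + a *: ore_Y q.
Proof.
apply/polyP=> i; rewrite ore_Y_coef !coefZ derM -scalerAl coefZ.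
by rewrite [RHS]coefD !coefZ ore_Y_coef mulrDr addrA.
Qed.

Lemma ore_Y_sum n (f : 'I_n -> {poly F}) :
  ore_Y (\sum_(i < n) f i) = \sum_(i < n) ore_Y (f i).
Proof. exact: (big_morph _ ore_YD ore_Y0). Qed.

Lemma ore_mulEw n (p q : (ore d)) : (size (p : {poly F}) <= n)%N ->
  ore_mul p q = \sum_(i < n) (p : {poly F})`_i *: iter i ore_Y q.
Proof.
move=> le; rewrite /ore_mul (big_ord_widen n (fun i => p`_i *: iter i ore_Y q) le).
rewrite big_mkcond; apply: eq_bigr => i _; case: ltnP => // hi.
by rewrite nth_default // scale0r.
Qed.

Lemma ore_mulDl : left_distributive ore_mul +%R.
Proof.
move=> p q r; pose n := maxn (size (p : {poly F})) (size (q : {poly F})).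
rewrite (@ore_mulEw n (p + q)) ?size_polyD //.
rewrite (@ore_mulEw n p) ?leq_maxl // (@ore_mulEw n q) ?leq_maxr //.
rewrite -[RHS](@big_split {poly F}) /=; apply: eq_bigr => i _; by rewrite -scalerDl -coefD.
Qed.

Lemma iter_ore_YD i : {morph iter i ore_Y : p q / p + q}.
Proof. by elim: i => // i IH p q /=; rewrite IH ore_YD. Qed.

Lemma ore_mulDr : right_distributive ore_mul +%R.
Proof.
move=> p q r; rewrite /ore_mul -[RHS](@big_split {poly F}) /=; apply: eq_bigr => i _.
by rewrite -scalerDr iter_ore_YD.
Qed.

Lemma ore_mul_scale a p q : ore_mul (a *: p) q = a *: ore_mul p q.
Proof.
rewrite (@ore_mulEw (size p) (a *: p)) ?size_scale_leq // /ore_mul scaler_sumr.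
by apply: eq_bigr => i _; rewrite coefZ scalerA.
Qed.

Lemma ore_mul_Y p q : ore_mul (ore_Y p) q = ore_Y (ore_mul p q).
Proof.
have szY : (size (ore_Y p) <= (size p).+1)%N.
  apply/leq_sizeP=> j hj; rewrite ore_Y_coef coefMX.
  rewrite nth_default ?der0 ?(ltnW hj) // add0r; case: j hj => //= j hj.
  by rewrite nth_default.
rewrite (ore_mulEw q szY) (ore_mulEw q (leqnSn (size p))) ore_Y_sum.
rewrite (eq_bigr (fun i : 'I_(size p).+1 => d p`_i *: iter i ore_Y q
  + (p * 'X)`_i *: iter i ore_Y q)); last by move=> i _; rewrite ore_Y_coef scalerDl.
rewrite [RHS](eq_bigr (fun i : 'I_(size p).+1 => d p`_i *: iter i ore_Y q
  + p`_i *: iter i.+1 ore_Y q)); last by move=> i _; rewrite ore_Y_scale.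
rewrite !big_split /=; congr (_ + _).
rewrite big_ord_recl big_ord_recr /= coefMX /= scale0r add0r nth_default //.
rewrite scale0r addr0; apply: eq_bigr => i _.
by rewrite coefMX.
Qed.

Lemma ore_mulA : associative ore_mul.
Proof.
move=> p q r; rewrite /ore_mul.
rewrite [RHS](_ : _ = ore_mul (\sum_(i < size p) p`_i *: iter i ore_Y q) r) //.
have mul0 : ore_mul 0 r = 0 by rewrite /ore_mul size_poly0 big_ord0.
rewrite (big_morph (fun u => ore_mul u r) (fun a b => ore_mulDl a b r) mul0).
apply: eq_bigr => i _; rewrite ore_mul_scale; congr (_ *: _).
by elim: (i : nat) => //= n IH; rewrite ore_mul_Y IH.
Qed.

Lemma ore_mulC c q : ore_mul c%:P q = c *: q.
Proof.
by rewrite (@ore_mulEw 1) ?size_polyC_leq1 // big_ord1 coefC.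
Qed.

Lemma ore_mul1l : left_id (1 : {poly F}) ore_mul.
Proof. by move=> q; rewrite -[1]/(1%:P) ore_mulC scale1r. Qed.

Lemma iter_ore_Y1 i : iter i ore_Y 1 = 'X^i.
Proof.
elim: i => [|i /= ->]; first by rewrite expr0.
rewrite /ore_Y -exprSr; apply/polyP=> j; rewrite coefD coef_map_id0 ?der0 //.
by rewrite [X in d X]coefXn; case: eqP => _; rewrite ?der1 ?der0 add0r.
Qed.

Lemma ore_mulr1 : right_id (1 : {poly F}) ore_mul.
Proof.
move=> p; rewrite /ore_mul -[RHS](coefK p) poly_def.
by apply: eq_bigr => i _; rewrite iter_ore_Y1.
Qed.

HB.instance Definition _ := GRing.Zmodule_isPzRing.Build (ore d)
  ore_mulA ore_mul1l ore_mulr1 ore_mulDl ore_mulDr.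

Lemma ore_neq01 : (1 : (ore d)) != 0.
Proof. exact: (oner_neq0 {poly F}). Qed.

HB.instance Definition _ := GRing.PzSemiRing_isNonZero.Build (ore d) ore_neq01.

Definition oreC (c : F) : (ore d) := c%:P.
Definition oreY : (ore d) := 'X : {poly F}.

Lemma oreC_zmod : zmod_morphism oreC.
Proof. by move=> a b; exact: polyCB. Qed.
Lemma oreC_monoid : monoid_morphism oreC.
Proof.
split=> // a b; rewrite -[RHS]/(ore_mul _ _) ore_mulC.
by apply/polyP=> i; rewrite coefZ !coefC; case: eqP; rewrite ?mulr0.
Qed.
HB.instance Definition _ := GRing.isZmodMorphism.Build F (ore d) oreC oreC_zmod.
HB.instance Definition _ := GRing.isMonoidMorphism.Build F (ore d) oreC oreC_monoid.

Lemma oreC_inj : injective oreC.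
Proof. exact: polyC_inj. Qed.

Lemma oreX i : oreY ^+ i = ('X^i : {poly F}).
Proof.
elim: i => [|i IH] //; rewrite exprS IH -[_ * _]/(ore_mul _ _) /oreY.
rewrite (@ore_mulEw 2) ?size_polyX // !big_ord_recl big_ord0 /= !coefX /=.
by rewrite scale0r scale1r add0r addr0 -[in LHS](iter_ore_Y1 i) -(iter_ore_Y1 i.+1).
Qed.

Lemma oreY_comm c : oreY * oreC c - oreC c * oreY = oreC (d c).
Proof.
rewrite -[oreY * _]/(ore_mul _ _) -[oreC c * _]/(ore_mul _ _) ore_mulC.
rewrite (@ore_mulEw 2) ?size_polyX // !big_ord_recl big_ord0 /= !coefX /=.
rewrite scale0r scale1r add0r addr0 /ore_Y /oreY /oreC.
have -> : map_poly d c%:P = (d c)%:P.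
  apply/polyP=> i; rewrite coef_map_id0 ?der0 // !coefC.
  by case: eqP => _; rewrite ?der0.
by rewrite -mul_polyC addrK.
Qed.

Lemma oreCM (c : F) (q : (ore d)) : oreC c * q = (c *: (q : {poly F}) : {poly F}).
Proof. exact: ore_mulC. Qed.

Lemma ore_sum_eq0 n (c : 'I_n -> F) :
  \sum_(i < n) oreC (c i) * oreY ^+ i = 0 -> forall i, c i = 0.
Proof.
move=> h i.
have h' : (\sum_(j < n) c j *: 'X^j : {poly F}) = 0.
  by rewrite -[RHS]h; apply: eq_bigr => j _; rewrite oreCM oreX.
have := congr1 (fun p : {poly F} => p`_i) h'; rewrite /= coef0 => <-.
rewrite coef_sum (bigD1 i) //= coefZ coefXn eqxx mulr1 big1 ?addr0 //.
move=> j ji; rewrite coefZ coefXn eq_sym.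
by case: eqP => [/val_inj e|]; rewrite ?mulr0 //; rewrite e eqxx in ji.
Qed.

Lemma iter_ore_Y_size i (q : {poly F}) j : (size q + i <= j)%N -> (iter i ore_Y q)`_j = 0.
Proof.
elim: i j => [|i IH] j; first by rewrite addn0 => h; rewrite nth_default.
case: j => [|j]; rewrite addnS // ltnS => h.
by rewrite ore_Y_coef coefMX /= !IH ?der0 ?addr0 // ltnW.
Qed.

Lemma iter_ore_Y_lead i (q : {poly F}) : q != 0 -> (iter i ore_Y q)`_((size q).-1 + i) = lead_coef q.
Proof.
move=> q0; elim: i => [|i IH]; first by rewrite addn0.
rewrite addnS ore_Y_coef coefMX /= IH iter_ore_Y_size ?der0 ?add0r //.
by rewrite -addSn prednK // lt0n size_poly_eq0.
Qed.

(** Derivation terms have lower degree, so leading coefficients multiply as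
    in an ordinary polynomial ring. *)
Lemma ore_domain (p q : (ore d)) : p * q = 0 -> p = 0 \/ q = 0.
Proof.
have [->|p0] := eqVneq p 0; first by left.
have [->|q0] := eqVneq q 0; first by right.
move=> h; have {}h : ore_mul p q = 0 :> {poly F} by exact: h.
pose n := (size (p : {poly F})).-1.
have szp : size (p : {poly F}) = n.+1 by rewrite prednK // lt0n size_poly_eq0.
have := congr1 (fun u : {poly F} => u`_((size (q : {poly F})).-1 + n)) h.
rewrite /= coef0 (@ore_mulEw n.+1) ?szp // coef_sum.
rewrite big_ord_recr /= coefZ iter_ore_Y_lead // big1 ?add0r; last first.
  move=> i _; rewrite coefZ iter_ore_Y_size ?mulr0 //.
  have sq : (0 < size (q : {poly F}))%N by rewrite lt0n size_poly_eq0.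
  by rewrite -[X in (X + _ <= _)%N](prednK sq) addSnnS leq_add2l.
move=> /eqP.
by rewrite mulf_eq0 -[p`_n]/(lead_coef (p : {poly F})) !lead_coef_eq0 (negPf p0) (negPf q0).
Qed.

End OreExtension.

Section FractionDerivation.
Variables (R : idomainType) (d : derivation R).
Local Notation "x %:F" := (FracField.tofrac x).

Lemma fractionP (x : {fraction R}) :
  x = (repr x).1%:F / (repr x).2%:F.
Proof.
apply/(canRL (mulfK _)); first by rewrite tofrac_eq0 denom_ratioP.
rewrite -{1}[x]reprK; set r := repr x.
change (FracField.mul (\pi_(FracField.type R) r) r.2%:F = r.1%:F).
rewrite !piE; apply/eqmodP; rewrite /= FracField.equivfE /FracField.mulf.
by rewrite !numden_Ratio ?mulf_neq0 ?oner_eq0 ?denom_ratioP // !mulr1 mulrC.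
Qed.

(** The quotient rule on a chosen representative; [frac_derE] shows that the
    choice does not matter. *)
Definition frac_der (x : {fraction R}) : {fraction R} :=
  let n := (repr x).1 in let m := (repr x).2 in
  (d n * m - n * d m)%:F / (m ^+ 2)%:F.

Lemma frac_derE (n m : R) : m != 0 ->
  frac_der (n%:F / m%:F) = (d n * m - n * d m)%:F / (m ^+ 2)%:F.
Proof.
move=> m0; rewrite /frac_der; set x := n%:F / m%:F; set n1 := (repr x).1; set m1 := (repr x).2.
have m10 : m1 != 0 by exact: denom_ratioP.
have e : n * m1 = n1 * m.
  have := fractionP x; rewrite {1}/x -/n1 -/m1 => /eqP.
  by rewrite eqr_div ?tofrac_eq0 // -!tofracM tofrac_eq => /eqP.
have e1 : d n * m1 + n * d m1 - (d n1 * m + n1 * d m) = 0.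
  by rewrite -!derM e subrr.
apply/eqP; rewrite eqr_div ?tofrac_eq0 ?expf_neq0 // -!tofracM tofrac_eq -subr_eq0.
have -> : (d n1 * m1 - n1 * d m1) * m ^+ 2 - (d n * m - n * d m) * m1 ^+ 2
  = - m * m1 * (d n * m1 + n * d m1 - (d n1 * m + n1 * d m))
    + (n * m1 - n1 * m) * (m * d m1 + m1 * d m) by ring.
by rewrite e1 e subrr mulr0 mul0r addr0.
Qed.

Lemma frac_derD : {morph frac_der : x y / x + y}.
Proof.
move=> x y; rewrite (fractionP x) (fractionP y).
set n := (repr x).1; set m := (repr x).2; set n1 := (repr y).1; set m1 := (repr y).2.
have m0 : m != 0 by exact: denom_ratioP.
have m10 : m1 != 0 by exact: denom_ratioP.
rewrite addf_div ?tofrac_eq0 // -!tofracM -tofracD !frac_derE ?mulf_neq0 //.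
rewrite addf_div ?tofrac_eq0 ?expf_neq0 // derD !derM -!tofracM -tofracD.
apply/eqP; rewrite eqr_div ?tofrac_eq0 ?expf_neq0 ?mulf_neq0 ?expf_neq0 //.
by rewrite -!tofracM tofrac_eq; apply/eqP; ring.
Qed.

Lemma frac_derM x y : frac_der (x * y) = frac_der x * y + x * frac_der y.
Proof.
rewrite (fractionP x) (fractionP y).
set n := (repr x).1; set m := (repr x).2; set n1 := (repr y).1; set m1 := (repr y).2.
have m0 : m != 0 by exact: denom_ratioP.
have m10 : m1 != 0 by exact: denom_ratioP.
rewrite mulf_div -!tofracM !frac_derE ?mulf_neq0 // !mulf_div -!tofracM.
rewrite addf_div ?tofrac_eq0 ?mulf_neq0 ?expf_neq0 // -!tofracM -tofracD !derM.
apply/eqP; rewrite eqr_div ?tofrac_eq0 ?expf_neq0 ?mulf_neq0 ?expf_neq0 //.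
by rewrite -!tofracM tofrac_eq; apply/eqP; ring.
Qed.

Definition frac_derivation := Derivation frac_derD frac_derM.

Lemma frac_der_tofrac n : frac_derivation n%:F = (d n)%:F.
Proof.
have := frac_derE n (oner_neq0 R).
by rewrite expr1n tofrac1 !divr1 der1 mulr0 subr0 mulr1.
Qed.

End FractionDerivation.

Section FieldDerivation.
Variables (F : fieldType) (d : derivation F).

Lemma derV a : a != 0 -> d (a^-1) = - d a / a ^+ 2.
Proof.
move=> a0; have := derM d a a^-1; rewrite mulfV // der1 => e.
apply: (mulfI a0); apply/eqP; rewrite -subr_eq0.
have -> : a * d a^-1 - a * (- d a / a ^+ 2) = d a / a + a * d a^-1 by field.
by rewrite -e.
Qed.

End FieldDerivation.

(** * The universal property *)

Section UniversalProperty.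
Variables (k : fieldType) (lam : k) (S : nzRingType) (f : {rmorphism k -> S}).
Variables (G G' X Y : S).
Hypothesis f_central : forall c a, GRing.comm (f c) a.

Definition lift_gen (u : generator) : S :=
  match u with Gen_g => G | Gen_ginv => G' | Gen_x => X | Gen_y => Y end.

Definition lift_word (m : {fmonom generator}) : S :=
  \prod_(u <- (m : seq _)) lift_gen u.

Fact lift_word_mmorphism : mmorphism lift_word.
Proof.
rewrite /lift_word; split=> [m1 m2|]; first by rewrite fmM big_cat.
by rewrite fm1 big_nil.
Qed.
HB.instance Definition _ :=
  isMultiplicative.Build {fmonom generator} S lift_word lift_word_mmorphism.

Definition lift_free (a : free_algebra k) : S := mmap f lift_word a.

Lemma lift_free_monoid : monoid_morphism lift_free.
Proof.
have [M1 M2] := @commr_mmap_is_multiplicative {fmonom generator} k S f lift_word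
  (fun g m m' => f_central _ _).
by split.
Qed.

HB.instance Definition _ := GRing.isZmodMorphism.Build (free_algebra k) S lift_free
  (@mmap_is_additive _ _ _ f lift_word).
HB.instance Definition _ := GRing.isMonoidMorphism.Build (free_algebra k) S lift_free
  lift_free_monoid.

Lemma lift_free_gen u : lift_free (gen k u) = lift_gen u.
Proof.
rewrite /lift_free /gen mmapU -[X in X * _]/(f 1) rmorph1 mul1r.
by rewrite /lift_word fmU big_seq1.
Qed.

Lemma lift_freeZ c a : lift_free (c *: a) = f c * lift_free a.
Proof. exact: mmapZ. Qed.

Hypotheses (GG' : G * G' = 1) (G'G : G' * G = 1) (GX : G * X * G' = X)
  (GY : G * Y * G' = Y + X)
  (YX : Y * X - X * Y = - (f 2^-1 * X ^+ 2) + f lam * (1 - G ^+ 2)).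

Lemma lift_free_relators a : frakU_relators lam a -> lift_free a = 0.
Proof.
have fB b c : lift_free (b - c) = lift_free b - lift_free c by exact: rmorphB.
have fD b c : lift_free (b + c) = lift_free b + lift_free c by exact: rmorphD.
have fN b : lift_free (- b) = - lift_free b by exact: rmorphN.
have fM b c : lift_free (b * c) = lift_free b * lift_free c by exact: rmorphM.
have f1 : lift_free 1 = 1 by exact: rmorph1.
suff gen_vars b b' c d : lift_free b = G -> lift_free b' = G' -> lift_free c = X ->
    lift_free d = Y -> relators lam b b' c d a -> lift_free a = 0.
  by apply: gen_vars; exact: lift_free_gen.
move=> hG hG' hX hY; case.
- by rewrite fB fM f1 hG hG' GG' subrr.
- by rewrite fB fM f1 hG hG' G'G subrr.
- by rewrite fB fM fM hG hG' hX GX subrr.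
- by rewrite fB fM fM fD hG hG' hX hY GY subrr.
- have f2 u : lift_free (u ^+ 2) = lift_free u ^+ 2 by exact: rmorphXn.
  have e1 : lift_free (d * c - c * d) = Y * X - X * Y.
    rewrite -hX -hY -(fM d c) -(fM c d); exact: fB.
  have e2 : lift_free (- (2^-1 *: c ^+ 2)) = - (f 2^-1 * X ^+ 2).
    by rewrite fN lift_freeZ f2 hX.
  have e3 : lift_free (lam *: (1 - b ^+ 2)) = f lam * (1 - G ^+ 2).
    by rewrite lift_freeZ fB f1 f2 hG.
  apply: (etrans (fB _ _)); rewrite e1; apply/eqP; rewrite subr_eq0 YX.
  apply/eqP/esym; apply: (etrans (fD _ _)); congr (_ + _).
  + exact: e2.
  + exact: e3.
Qed.

Definition lift_frakU (u : frakU lam) : S :=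
  lift_free (repr (u : quotient (frakU_relators lam))).

Lemma lift_frakU_pi a : lift_frakU (frakU_pi lam a) = lift_free a.
Proof.
have /toquot_eqP/ideal_gen_predP : toquot (frakU_relators lam) a =
   toquot (frakU_relators lam) (repr (frakU_pi lam a : quotient (frakU_relators lam))).
  by rewrite toquotK.
move=> /(_ [set b | lift_free b = 0]) /= h.
symmetry; apply/eqP; rewrite -subr_eq0 -rmorphB; apply/eqP/h; split; last first.
  exact: lift_free_relators.
split=> /= [|b c b0 c0|b c c0|b c c0].
- exact: rmorph0.
- by rewrite rmorphD /= b0 c0 addr0.
- by rewrite rmorphM /= c0 mulr0.
- by rewrite rmorphM /= c0 mul0r.
Qed.

Lemma frakU_piP (u : frakU lam) : exists a, u = frakU_pi lam a.
Proof. by exists (repr (u : quotient (frakU_relators lam))); rewrite -[LHS]toquotK. Qed.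

Lemma lift_frakU_zmod : zmod_morphism lift_frakU.
Proof.
move=> u v; have [a ->] := frakU_piP u; have [b ->] := frakU_piP v.
by rewrite -rmorphB /= !lift_frakU_pi rmorphB.
Qed.
Lemma lift_frakU_monoid : monoid_morphism lift_frakU.
Proof.
split=> [|u v]; first by rewrite -(rmorph1 (frakU_pi lam)) /= lift_frakU_pi rmorph1.
have [a ->] := frakU_piP u; have [b ->] := frakU_piP v.
by rewrite -rmorphM /= !lift_frakU_pi rmorphM.
Qed.
HB.instance Definition _ := GRing.isZmodMorphism.Build (frakU lam) S lift_frakU
  lift_frakU_zmod.
HB.instance Definition _ := GRing.isMonoidMorphism.Build (frakU lam) S lift_frakU
  lift_frakU_monoid.

Lemma frakU_universal : exists r : {rmorphism frakU lam -> S},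
  [/\ r U_g = G, r U_ginv = G', r U_x = X, r U_y = Y & forall c, r c%:A = f c].
Proof.
exists lift_frakU; split; first exact: etrans (lift_frakU_pi _) (lift_free_gen _).
- exact: etrans (lift_frakU_pi _) (lift_free_gen _).
- exact: etrans (lift_frakU_pi _) (lift_free_gen _).
- exact: etrans (lift_frakU_pi _) (lift_free_gen _).
move=> c; rewrite /=.
have -> : c%:A = frakU_pi lam c%:A by rewrite linearZ /= rmorph1.
by rewrite lift_frakU_pi lift_freeZ rmorph1 mulr1.
Qed.

End UniversalProperty.

Section Induction.
Variables (k : fieldType) (lam : k).

(** Monomials span the free algebra, so a property stable under sums and
    products need only be checked on scalars and generators. *)
Lemma frakU_ind (Q : frakU lam -> Prop) :
  (forall c, Q c%:A) -> (forall a b, Q a -> Q b -> Q (a + b)) ->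
  (forall a b, Q a -> Q b -> Q (a * b)) -> Q U_g -> Q U_ginv -> Q U_x -> Q U_y ->
  forall u, Q u.
Proof.
move=> Qc QD QM Qg Qg' Qx Qy u; have [a ->] := frakU_piP u.
have Q0 : Q 0 by rewrite -(scale0r 1).
have piM b c : frakU_pi lam (b * c) = frakU_pi lam b * frakU_pi lam c by exact: rmorphM.
have piZ c b : frakU_pi lam (c *: b) = c *: frakU_pi lam b by exact: linearZ.
have pi_sum (s : seq {fmonom generator}) (F : {fmonom generator} -> free_algebra k) :
  frakU_pi lam (\sum_(m <- s) F m) = \sum_(m <- s) frakU_pi lam (F m) by exact: rmorph_sum.
rewrite [a]monalgE pi_sum; apply: (big_ind Q); [exact: Q0 | exact: QD | move=> m _].
set c := mcoeff _ _; have -> : << c *g m >> = c *: (<< m >> : free_algebra k).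
  by rewrite -[RHS]mul_malgC malgM_def fgmulUU mulr1 mul1m.
rewrite piZ -mulr_algl; apply: (QM); first exact: Qc.
case: m {c} => /= s; elim: s => [|i s IH].
  by rewrite -fmoneE -[<< _ >>]/(1 : free_algebra k) rmorph1 -(scale1r 1).
have -> : << FMonom (i :: s) >> = gen k i * (<< FMonom s >> : free_algebra k).
  rewrite /gen malgM_def fgmulUU mulr1; congr (<< _ >>).
  by apply: val_inj; rewrite /= fmM fmU.
rewrite (piM (gen k i)); apply: QM IH.
by case: i; [exact: Qg | exact: Qg' | exact: Qx | exact: Qy].
Qed.
End Induction.

(** * Ideals and primeness *)

Section IdealTheory.
Variable R : nzRingType.
Implicit Types (I J P : set R).

Lemma idealN I a : twosided_ideal I -> I a -> I (- a).
Proof. by case=> _ _ IL _ Ia; rewrite -mulN1r; apply: IL. Qed.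

Lemma idealB I a b : twosided_ideal I -> I a -> I b -> I (a - b).
Proof. by move=> hI Ia Ib; have [_ ID _ _] := hI; apply: ID => //; apply: idealN. Qed.

Lemma ideal_subl I a b : twosided_ideal I -> I (a - b) -> I b -> I a.
Proof. by move=> [_ ID _ _] h Ib; rewrite -(subrK b a); apply: ID. Qed.

Lemma ideal_subr I a b : twosided_ideal I -> I (a - b) -> I a -> I b.
Proof.
by move=> hI h Ia; apply: (ideal_subl hI _ Ia); rewrite -opprB; apply: idealN.
Qed.

Lemma ideal_sum I (T : finType) (f : T -> R) : twosided_ideal I ->
  (forall i, I (f i)) -> I (\sum_i f i).
Proof. by move=> [I0 ID _ _] h; apply: (big_ind I). Qed.

Lemma ideal1 I a : twosided_ideal I -> I 1 -> I a.
Proof. by move=> [_ _ IL _] I1; rewrite -(mulr1 a); apply: IL. Qed.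

Lemma proper_ideal1 I : proper_twosided_ideal I -> ~ I 1.
Proof.
by move=> [hI nI] I1; apply: nI; apply/seteqP; split=> // a _; apply: ideal1.
Qed.

Lemma proper_ideal_of I : twosided_ideal I -> ~ I 1 -> proper_twosided_ideal I.
Proof. by move=> hI nI; split=> // e; apply: nI; rewrite e. Qed.

Lemma ideal_gen_min (S I : set R) : twosided_ideal I -> S `<=` I -> ideal_gen S `<=` I.
Proof. by move=> hI SI a; apply. Qed.

Lemma mem_ideal_gen (S : set R) a : S a -> ideal_gen S a.
Proof. by move=> Sa I [_]; apply. Qed.

Lemma ideal_gen_id I : twosided_ideal I -> ideal_gen I = I.
Proof.
move=> hI; apply/seteqP; split; first exact: ideal_gen_min.
by move=> a; apply: mem_ideal_gen.
Qed.

Lemma zero_ideal : twosided_ideal [set 0 : R].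
Proof.
split=> //= [a b -> ->|r a ->|r a ->]; by rewrite ?addr0 ?mulr0 ?mul0r.
Qed.

Definition elementwise_cprime P :=
  [/\ twosided_ideal P, ~ P 1 & forall a b, P (a * b) -> P a \/ P b].

Lemma cprime_completely_prime P : elementwise_cprime P -> completely_prime_ideal P.
Proof.
move=> [hP P1 PM]; split; first exact: proper_ideal_of.
have eq0 a : toquot P a = 0 <-> P a.
  rewrite -(toquot0 P); split.
    by move/toquot_eqP/ideal_gen_predP; rewrite subr0 ideal_gen_id.
  by move=> Pa; apply/toquot_eqP/ideal_gen_predP; rewrite subr0 ideal_gen_id.
split; first by apply/eqP => /eq0.
move=> a b; rewrite -[a]toquotK -[b]toquotK -[_ * _]/(qmul _ _) -toquotM.
by move=> /eq0 /PM [] /eq0; [left | right].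
Qed.

Lemma cprime_prime P : elementwise_cprime P -> prime_ideal P.
Proof.
move=> [hP P1 PM]; split; first exact: proper_ideal_of.
move=> A B hA hB AB; apply: contrapT => /not_orP[] /existsNP [a /not_implyP [Aa nPa]].
move=> /existsNP [b /not_implyP [Bb nPb]].
suff /PM [] : P (a * b) by [].
by apply: AB; exists 1%N, (fun=> a), (fun=> b); rewrite big_ord1.
Qed.

Lemma ker_ideal (S : nzRingType) (f : {rmorphism R -> S}) :
  twosided_ideal [set a | f a = 0].
Proof.
split=> /= [|a b|r a|r a]; first exact: rmorph0.
- by rewrite rmorphD => -> ->; rewrite addr0.
- by rewrite rmorphM => ->; rewrite mulr0.
- by rewrite rmorphM => ->; rewrite mul0r.
Qed.

Lemma ker_cprime (S : nzRingType) (f : {rmorphism R -> S}) :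
  (forall a b : S, a * b = 0 -> a = 0 \/ b = 0) ->
  elementwise_cprime [set a | f a = 0].
Proof.
move=> dS; split; first exact: ker_ideal.
  by rewrite /= rmorph1; apply/eqP; rewrite oner_eq0.
by move=> a b /=; rewrite rmorphM; apply: dS.
Qed.

(** The elementwise form of primeness: the products [a u b] generate the
    product of the ideals of [a] and [b]. *)
Lemma prime_elementwise P a b : prime_ideal P ->
  (forall u, P (a * u * b)) -> P a \/ P b.
Proof.
move=> [[hP _] PM] h; have [P0 PD PL PR] := hP.
have hA := ideal_gen_ideal [set a]; have hB := ideal_gen_ideal [set b].
have [|A|B] := PM _ _ hA hB; last 2 first.
- by left; apply: A; apply: mem_ideal_gen.
- by right; apply: B; apply: mem_ideal_gen.
have h1 a' : ideal_gen [set a] a' -> forall u, P (a' * u * b).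
  apply: (@ideal_gen_min _ [set a' | forall u, P (a' * u * b)]); last by move=> ? ->.
  split=> /= [u|x y hx hy u|r x hx u|r x hx u]; first by rewrite !mul0r.
  - by rewrite !mulrDl; apply: PD.
  - by rewrite -!mulrA; apply: PL; rewrite mulrA.
  - by rewrite -(mulrA x).
have h2 a' b' : ideal_gen [set a] a' -> ideal_gen [set b] b' -> P (a' * b').
  move=> Aa Bb; have := @ideal_gen_min [set b] [set x | forall u, P (a' * u * x)].
  move=> /(_ _ _ _ Bb 1); rewrite mulr1; apply; last by move=> _ -> u; apply: h1.
  split=> /= [u|x y hx hy u|r x hx u|r x hx u]; first by rewrite !mulr0.
  - by rewrite !mulrDr; apply: PD.
  - by rewrite mulrA -(mulrA a').
  - by rewrite mulrA; apply: PR.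
move=> c [n [f [f' [hf ->]]]].
by apply: ideal_sum => // i; have [? ?] := hf i; apply: h2.
Qed.

Definition normal_element (a : R) := forall u, exists u', a * u = u' * a.

Lemma prime_normal P a b : prime_ideal P -> normal_element a ->
  P (a * b) -> P a \/ P b.
Proof.
move=> pP na Pab; apply: (prime_elementwise pP) => u.
have [[[_ _ PL _] _] _] := pP.
by have [u' ->] := na u; rewrite -mulrA; apply: PL.
Qed.

Lemma prime_normalX P a n : prime_ideal P -> normal_element a ->
  P (a ^+ n) -> P a.
Proof.
move=> pP na; elim: n => [|n IH].
  by move=> /proper_ideal1; case: pP.
by rewrite exprS => /(prime_normal pP na) [].
Qed.

Lemma maximal_prime P : maximal_ideal P -> prime_ideal P.
Proof.
move=> [pP maxP]; split=> // A B hA hB AB.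
have [hP nP] := pP; have [P0 PD PL PR] := hP.
(* By maximality [I + P] is the whole ring. *)
have key I : twosided_ideal I -> ~ I `<=` P -> exists2 a, I a & P (1 - a).
  move=> hI nI; have [I0 ID IL IR] := hI.
  pose J : set R := [set c | exists2 a, I a & P (c - a)].
  have hJ : twosided_ideal J.
    split=> [|c c' [a Ia ha] [a' Ia' ha']|r c [a Ia ha]|r c [a Ia ha]].
    - by exists 0 => //; rewrite subr0.
    - by exists (a + a'); [exact: ID | rewrite opprD addrACA; apply: PD].
    - by exists (r * a); [exact: IL | rewrite -mulrBr; apply: PL].
    - by exists (a * r); [exact: IR | rewrite -mulrBl; apply: PR].
  have PJ : P `<=` J by move=> c Pc; exists 0 => //; rewrite subr0.
  apply: contrapT => n1; apply: nI; rewrite -(maxP J) //; last exact: proper_ideal_of.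
  by move=> a Ia; exists a => //; rewrite subrr.
apply: contrapT => /not_orP[nA nB].
have [a Aa ha] := key _ hA nA; have [b Bb hb] := key _ hB nB.
apply: (proper_ideal1 pP); apply: (ideal_subl hP (b := a * b)); last first.
  by apply: AB; exists 1%N, (fun=> a), (fun=> b); rewrite big_ord1.
have -> : 1 - a * b = (1 - a) + a * (1 - b) by rewrite mulrBr mulr1 addrA subrK.
by apply: PD => //; apply: PL.
Qed.

Lemma annihilator_ideal (M : lmodType R) : twosided_ideal (@annihilator R M).
Proof.
split=> [m|a b ha hb m|r a ha m|r a ha m] /=; first exact: scale0r.
- by rewrite scalerDl ha hb addr0.
- by rewrite -scalerA ha scaler0.
- by rewrite -scalerA ha.
Qed.

(** For a left ideal [I], [I m] is a submodule, hence everything as soon as it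
    is nonzero. *)
Lemma simple_module_cyclic (M : lmodType R) (I : set R) (m : M) (b : R) :
  simple_module M -> I 0 -> (forall a b, I a -> I b -> I (a + b)) ->
  (forall r a, I a -> I (r * a)) -> I b -> b *: m != 0 ->
  forall m', exists2 a, I a & m' = a *: m.
Proof.
move=> [_ sM] I0 ID IL Ib bm.
pose N : {pred M} := fun m' => `[< exists2 a, I a & m' = a *: m >].
have NE m' : reflect (exists2 a, I a & m' = a *: m) (m' \in N) by exact: asboolP.
have hN : submod_closed N.
  split; first by apply/NE; exists 0; rewrite ?scale0r.
  move=> r m1 m2 /NE [a Ia ->] /NE [a' Ia' ->]; apply/NE.
  by exists (r * a + a'); [apply: ID => //; exact: IL | rewrite scalerDl scalerA].
have [N0|NT] := sM _ hN; last by move=> m'; apply/NE; rewrite NT.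
have /NE : exists2 a, I a & b *: m = a *: m by exists b.
by rewrite N0 inE (negPf bm).
Qed.

Lemma simple_module_gen (M : lmodType R) (m : M) : simple_module M -> m != 0 ->
  forall m', exists a, m' = a *: m.
Proof.
move=> sM m0 m'; have [|a _ ->] := @simple_module_cyclic M setT m 1 sM Logic.I
  (fun _ _ _ _ => Logic.I) (fun _ _ _ => Logic.I) Logic.I _ m'; last by exists a.
by rewrite scale1r.
Qed.

Lemma primitive_prime P : primitive_ideal P -> prime_ideal P.
Proof.
move=> [M [sM ->]]; have [[m0 m0N] _] := sM.
split.
  apply: proper_ideal_of; first exact: annihilator_ideal.
  by move=> /(_ m0); rewrite scale1r; apply/eqP.
move=> A B hA hB AB; apply: contrapT => /not_orP[/existsNP [a nA] /existsNP [b nB]].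
have [Aa /existsNP [m am]] := (not_implyP _ _).1 nA.
have [Bb /existsNP [m' bm]] := (not_implyP _ _).1 nB.
have [B0 BD BL _] := hB.
have [b' Bb' e] := simple_module_cyclic sM B0 BD BL Bb (introN eqP bm) m.
apply: am; rewrite e scalerA; apply: AB.
by exists 1%N, (fun=> a), (fun=> b'); rewrite big_ord1.
Qed.

(** ** Simple modules from maximal left ideals *)

Record left_ideal := LeftIdeal {
  lset :> set R;
  lset0 : lset 0;
  lsetD : forall a b, lset a -> lset b -> lset (a + b);
  lsetM : forall r a, lset a -> lset (r * a) }.

Definition lpred (L : left_ideal) : {pred R} := fun a => `[< lset L a >].

Lemma lpredP L a : reflect (lset L a) (a \in lpred L).
Proof. exact: asboolP. Qed.

Fact lpred_zmod_closed L : zmod_closed (lpred L).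
Proof.
split=> [|a b /lpredP La /lpredP Lb]; apply/lpredP; first exact: lset0.
by apply: lsetD => //; rewrite -mulN1r; apply: lsetM.
Qed.
HB.instance Definition _ L :=
  GRing.isZmodClosed.Build R (lpred L) (lpred_zmod_closed L).

End IdealTheory.

Section LeftQuotient.
Variables (R : nzRingType) (L : left_ideal R).

Definition lquot : Type := Quotient.quot (lpred L).
HB.instance Definition _ := GRing.Zmodule.on lquot.
HB.instance Definition _ := EqQuotient.on lquot.

Fact lquot_key : unit. Proof. by []. Qed.
Definition lpi : R -> lquot := locked_with lquot_key (fun a => \pi_lquot a).
Canonical lpi_unlockable := [unlockable of lpi].

Lemma lpiK (q : lquot) : lpi (repr q) = q.
Proof. by rewrite unlock reprK. Qed.

Lemma lpi_eqP a b : reflect (lpi a = lpi b) (a - b \in lpred L).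
Proof. by rewrite Quotient.idealrBE unlock; apply: eqP. Qed.

Lemma lpiD a b : lpi (a + b) = lpi a + lpi b.
Proof. by rewrite unlock; exact: (Quotient.pi_add (lpred L) a b). Qed.

Lemma lpi0 : lpi 0 = 0.
Proof. by apply: (addrI (lpi 0)); rewrite -lpiD !addr0. Qed.

Lemma lpi_eq0 a : lpi a = 0 <-> lset L a.
Proof.
rewrite -lpi0; split; first by move/lpi_eqP/lpredP; rewrite subr0.
by move=> La; apply/lpi_eqP/lpredP; rewrite subr0.
Qed.

Definition lscale (r : R) : lquot -> lquot :=
  locked_with lquot_key (fun q => lpi (r * repr q)).
Canonical lscale_unlockable r := [unlockable of lscale r].

Lemma lscale_pi r a : lscale r (lpi a) = lpi (r * a).
Proof.
rewrite [lscale r]unlock; apply/lpi_eqP/lpredP; rewrite -mulrBr; apply: lsetM.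
by apply/lpredP/lpi_eqP; rewrite lpiK.
Qed.

Fact lscaleA a b q : lscale a (lscale b q) = lscale (a * b) q.
Proof. by rewrite -[q]lpiK !lscale_pi mulrA. Qed.
Fact lscale1 : left_id 1 lscale.
Proof. by move=> q; rewrite -[q]lpiK lscale_pi mul1r. Qed.
Fact lscaleDr : right_distributive lscale +%R.
Proof. by move=> c p q; rewrite -[q]lpiK -[p]lpiK -lpiD !lscale_pi mulrDr lpiD. Qed.
Fact lscaleDl q : {morph lscale^~ q : a b / a + b}.
Proof. by move=> a b; rewrite -[q]lpiK !lscale_pi mulrDl lpiD. Qed.
HB.instance Definition _ := GRing.Zmodule_isLmodule.Build R lquot
  lscaleA lscale1 lscaleDr lscaleDl.

Lemma scale_lpi r a : r *: lpi a = lpi (r * a).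
Proof. exact: lscale_pi. Qed.

Lemma lquot_simple : ~ lset L 1 ->
  (forall L' : left_ideal R, L `<=` L' -> ~ lset L' 1 -> L' `<=` L) ->
  simple_module (lquot : lmodType R).
Proof.
move=> L1 maxL; split; first by exists (lpi 1); apply/eqP => /lpi_eq0.
move=> N [N0 ND]; pose S : set R := [set a | lpi a \in N].
have S0 : S 0 by rewrite /S /= lpi0.
have SD a b : S a -> S b -> S (a + b).
  by rewrite /S /= => Sa Sb; rewrite lpiD -[lpi a]scale1r; apply: ND.
have SM r a : S a -> S (r * a).
  by rewrite /S /= => Sa; rewrite -scale_lpi -[_ *: _]addr0; apply: ND.
have LS : L `<=` LeftIdeal S0 SD SM.
  by move=> a La; rewrite /= /S /=; have /lpi_eq0 -> := La.
have [S1|S1] := pselect (S 1); [right|left] => q; rewrite -[q]lpiK.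
  by rewrite inE -(mulr1 (repr q)); apply: (SM).
rewrite [RHS]inE; apply/idP/eqP => [Sq|->//].
by apply/lpi_eq0; apply: (maxL _ LS S1).
Qed.

End LeftQuotient.

(** By Zorn's lemma a proper left ideal lies in a maximal one. *)
Lemma exists_simple_quotient (R : nzRingType) (L0 : left_ideal R) : ~ lset L0 1 ->
  exists M : lmodType R, simple_module M /\
    exists2 m : M, m != 0 & (forall a, lset L0 a -> a *: m = 0) /\
      (forall m', exists u, m' = u *: m).
Proof.
move=> L01.
pose isl (S : set R) := [/\ S 0, forall a b, S a -> S b -> S (a + b)
  & forall r a, S a -> S (r * a)].
(* Unions of chains are formed over ideals joined with L0, so that the empty
   chain needs no separate treatment. *)
pose Z : set (set R) := [set S | isl (S `|` lset L0) /\ ~ (S `|` lset L0) 1].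
have [|S [[hS S1] maxS]] := @Zorn_bigcup R Z.
  move=> F FZ Ftot; split; last first.
    by case=> // -[X FX X1]; have [_] := FZ X FX; apply; left.
  split; first by right; exact: lset0.
    move=> a b [[X FX Xa]|La] [[X' FX' Xb]|Lb]; last by right; apply: lsetD.
    - have [XX|XX] := Ftot X X' FX FX'.
        have [[_ D _] _] := FZ _ FX'; have [?|?] := D a b (or_introl (XX _ Xa)) (or_introl Xb).
          by left; exists X'.
        by right.
      have [[_ D _] _] := FZ _ FX; have [?|?] := D a b (or_introl Xa) (or_introl (XX _ Xb)).
        by left; exists X.
      by right.
    - have [[_ D _] _] := FZ _ FX; have [?|?] := D a b (or_introl Xa) (or_intror Lb).
        by left; exists X.
      by right.
    - have [[_ D _] _] := FZ _ FX'; have [?|?] := D a b (or_intror La) (or_introl Xb).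
        by left; exists X'.
      by right.
  move=> r a [[X FX Xa]|La]; last by right; apply: lsetM.
  have [[_ _ H] _] := FZ _ FX; have [?|?] := H r a (or_introl Xa).
    by left; exists X.
  by right.
have [h0 hD hM] := hS.
pose L := LeftIdeal h0 hD hM.
have sL : simple_module (lquot L : lmodType R).
  apply: lquot_simple => // L' LL' L'1 a L'a; apply: contrapT => nLa.
  have e : lset L' `|` L0 = L' by apply/seteqP; split=> [b [//|Lb]|b]; [apply: LL'; right | left].
  apply: (maxS L'); last first.
    change (isl (lset L' `|` lset L0) /\ ~ (lset L' `|` lset L0) 1); rewrite e; split=> //.
    by split; [exact: lset0 | exact: lsetD | exact: lsetM].
  split; last by move=> h; apply: nLa; left; apply: h.
  by move=> b Sb; apply: LL'; left.
exists (lquot L); split=> //; exists (lpi L 1); first by apply/eqP => /lpi_eq0.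
split=> [a La|m']; first by rewrite scale_lpi mulr1; apply/lpi_eq0; right.
by exists (repr m'); rewrite scale_lpi mulr1 lpiK.
Qed.

(** A simple quotient of the ring modulo [P] is killed by the two-sided ideal
    [P], and by no larger one. *)
Lemma maximal_primitive (R : nzRingType) (P : set R) :
  maximal_ideal P -> primitive_ideal P.
Proof.
move=> [pP maxP]; have [[P0 PD PL PR] _] := pP.
have [M [sM [m m0 [Pm Mm]]]] := @exists_simple_quotient R (LeftIdeal P0 PD PL) (proper_ideal1 pP).
exists M; split=> //; symmetry; apply: maxP.
  apply: proper_ideal_of; first exact: annihilator_ideal.
  by move=> /(_ m); rewrite scale1r; apply/eqP.
by move=> a Pa m'; have [u ->] := Mm m'; rewrite scalerA; apply: Pm; apply: PR.
Qed.

(** * The commutative part and left normal forms *)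

Lemma comm_horner_morph (aR R : nzRingType) (f : {rmorphism aR -> R}) (u : R)
    (cfu : commr_rmorph f u) (w : R) :
  GRing.comm w u -> (forall a, GRing.comm w (f a)) ->
  forall p, GRing.comm w (horner_morph cfu p).
Proof.
move=> wu wf; elim/poly_ind => [|p c IH]; first by rewrite rmorph0; exact: commr0.
rewrite rmorphD rmorphM /= horner_morphX horner_morphC.
by apply: commrD => //; apply: commrM.
Qed.

Lemma poly_split (R : nzRingType) (p : {poly R}) : exists q c, p = q * 'X + c%:P.
Proof.
elim/poly_ind: p => [|p c _]; last by exists p, c.
by exists 0, 0; rewrite mul0r add0r.
Qed.

Section CommutativePart.
Variables (k : fieldType) (lam : k).
Local Notation U := (frakU lam).
Local Notation g := (U_g : U).
Local Notation g' := (U_ginv : U).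
Local Notation x := (U_x : U).
Local Notation y := (U_y : U).
Local Notation T := {poly k}.
Local Notation C := {poly {poly {poly k}}}.

Lemma Ugg' : g * g' = 1. Proof. by have [] := frakU_relations lam. Qed.
Lemma Ug'g : g' * g = 1. Proof. by have [] := frakU_relations lam. Qed.
Lemma Ugx : g * x = x * g.
Proof.
by have [_ _ h _ _] := frakU_relations lam; rewrite -[in RHS]h -mulrA Ug'g mulr1.
Qed.
Lemma Ug'x : g' * x = x * g'.
Proof.
have e : g * (x * g') = x by rewrite mulrA Ugx -mulrA Ugg' mulr1.
by rewrite -[in LHS]e mulrA Ug'g mul1r.
Qed.
Lemma Ugy : g * y = (y + x) * g.
Proof.
by have [_ _ _ h _] := frakU_relations lam; rewrite -h -mulrA Ug'g mulr1.
Qed.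

Lemma scalar_comm (c : k) (u : U) : GRing.comm u c%:A.
Proof. by rewrite /GRing.comm mulr_algl mulr_algr. Qed.

(** [C] consists of the polynomials in [g^-1], [g] and [x], in this order from
    the inside out, without the relation between [g] and [g^-1].  Identities
    between elements of the algebra that commute with each other become
    polynomial identities modulo [Cg * Cg' - 1], by [theta_eq]. *)
Definition theta1 : {rmorphism T -> U} := horner_alg g'.
Lemma theta1_comm : commr_rmorph theta1 g.
Proof.
apply: comm_horner_morph; first by rewrite /GRing.comm Ugg' Ug'g.
by move=> c; apply: scalar_comm.
Qed.
Definition theta2 : {rmorphism {poly T} -> U} := horner_morph theta1_comm.
Lemma theta2_comm : commr_rmorph theta2 x.
Proof.
apply: comm_horner_morph => [|p]; first by rewrite /GRing.comm Ugx.
apply: comm_horner_morph; first by rewrite /GRing.comm Ug'x.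
by move=> c; apply: scalar_comm.
Qed.
Definition theta : {rmorphism C -> U} :=
  locked (horner_morph theta2_comm : {rmorphism C -> U}).

Definition cst : {rmorphism k -> C} :=
  locked ((polyC \o polyC) \o polyC : {rmorphism k -> C}).
Lemma cstE c : cst c = c%:P%:P%:P.
Proof. by rewrite /cst -lock. Qed.
Definition Cg' : C := 'X%:P%:P.
Definition Cg : C := 'X%:P.
Definition Cx : C := 'X.

Lemma theta_cst c : theta (cst c) = c%:A.
Proof. by rewrite cstE /theta -lock /= horner_morphC /= horner_morphC /= horner_algC. Qed.
Lemma theta_g' : theta Cg' = g'.
Proof. by rewrite /theta -lock /= horner_morphC /= horner_morphC /= horner_algX. Qed.
Lemma theta_g : theta Cg = g.
Proof. by rewrite /theta -lock /= horner_morphC /= horner_morphX. Qed.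
Lemma theta_x : theta Cx = x.
Proof. by rewrite /theta -lock /= horner_morphX. Qed.

Lemma C_ind (Q : C -> Prop) : (forall c, Q (cst c)) -> Q Cg' -> Q Cg -> Q Cx ->
  (forall p q, Q p -> Q q -> Q (p + q)) -> (forall p q, Q p -> Q q -> Q (p * q)) ->
  forall p, Q p.
Proof.
move=> Qc Qg' Qg Qx QD QM.
have Q0 : Q 0 by rewrite -(rmorph0 cst).
have Q1 (p : T) : Q p%:P%:P.
  elim/poly_ind: p => [|p c IH]; first by rewrite !polyC0.
  by rewrite !polyCD !polyCM; apply: (QD); [apply: (QM) | rewrite -cstE; exact: Qc].
have Q2 (p : {poly T}) : Q p%:P.
  elim/poly_ind: p => [|p c IH]; first by rewrite !polyC0.
  by rewrite !polyCD !polyCM; apply: (QD); [apply: (QM) | exact: (Q1 c)].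
elim/poly_ind => [//|p c IH].
by apply: (QD); [apply: (QM) | exact: (Q2 c)].
Qed.

Lemma theta_eq p q r : p - q = r * (Cg * Cg' - 1) -> theta p = theta q.
Proof.
move=> e; have h : theta (Cg * Cg' - 1) = 0.
  suff gen_vars a b : theta a = g -> theta b = g' -> theta (a * b - 1) = 0.
    by apply: gen_vars; [exact: theta_g | exact: theta_g'].
  by move=> ha hb; rewrite rmorphB rmorphM rmorph1 /= ha hb Ugg' subrr.
by apply/eqP; rewrite -subr_eq0 -(rmorphB theta) e (rmorphM theta) h mulr0.
Qed.

Lemma theta_comm p q : theta p * theta q = theta q * theta p.
Proof. by rewrite -!rmorphM mulrC. Qed.

Definition ad_y (u : U) : U := y * u - u * y.

Lemma ad_yD u w : ad_y (u + w) = ad_y u + ad_y w.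
Proof. by rewrite /ad_y mulrDr mulrDl opprD addrACA. Qed.
Lemma ad_yM u w : ad_y (u * w) = ad_y u * w + u * ad_y w.
Proof. by rewrite /ad_y mulrBl mulrBr !mulrA addrA subrK. Qed.
Lemma ad_y_scalar c : ad_y c%:A = 0.
Proof. by rewrite /ad_y scalar_comm subrr. Qed.
Lemma ad_y_g : ad_y g = - (x * g).
Proof. by rewrite /ad_y Ugy mulrDl opprD addrA subrr add0r. Qed.
Lemma ad_y_g' : ad_y g' = x * g'.
Proof.
have : ad_y (g * g') = 0 by rewrite Ugg' -(scale1r 1) ad_y_scalar.
rewrite ad_yM ad_y_g => /eqP; rewrite mulNr -mulrA Ugg' mulr1 addrC subr_eq0 => /eqP e.
by rewrite -Ug'x -e mulrA Ug'g mul1r.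
Qed.
Lemma ad_y_x : ad_y x = - (2^-1 *: x ^+ 2) + lam *: (1 - g ^+ 2).
Proof. by have [] := frakU_relations lam. Qed.

(** A relation rather than a function on [C]: derivatives are found by
    following the way in which an element is written, and may be changed by
    multiples of [Cg * Cg' - 1]. *)
Definition theta_deriv p q := ad_y (theta p) = theta q.

Lemma theta_derivD p p' q q' : theta_deriv p p' -> theta_deriv q q' ->
  theta_deriv (p + q) (p' + q').
Proof. by rewrite /theta_deriv !rmorphD ad_yD => -> ->. Qed.
Lemma theta_derivM p p' q q' : theta_deriv p p' -> theta_deriv q q' ->
  theta_deriv (p * q) (p' * q + p * q').
Proof. by rewrite /theta_deriv rmorphM ad_yM rmorphD !rmorphM => -> ->. Qed.
Lemma theta_deriv_cst c : theta_deriv (cst c) 0.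
Proof. by rewrite /theta_deriv theta_cst ad_y_scalar rmorph0. Qed.
Lemma theta_derivN p p' : theta_deriv p p' -> theta_deriv (- p) (- p').
Proof.
move=> h; have := theta_derivM (theta_deriv_cst (-1)) h.
by rewrite rmorphN1 !mulN1r mul0r add0r.
Qed.
Lemma theta_deriv_g : theta_deriv Cg (- (Cx * Cg)).
Proof. by rewrite /theta_deriv theta_g ad_y_g rmorphN rmorphM /= theta_g theta_x. Qed.
Lemma theta_deriv_g' : theta_deriv Cg' (Cx * Cg').
Proof. by rewrite /theta_deriv theta_g' ad_y_g' rmorphM /= theta_g' theta_x. Qed.
Lemma theta_deriv_x : theta_deriv Cx
  (- (cst 2^-1 * Cx ^+ 2) + cst lam * (1 - Cg ^+ 2)).
Proof.
rewrite /theta_deriv theta_x ad_y_x rmorphD rmorphN !rmorphM rmorphB !rmorphXn /=.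
by rewrite !theta_cst theta_x theta_g rmorph1 !mulr_algl.
Qed.

Lemma theta_deriv_ex p : exists q, theta_deriv p q.
Proof.
elim/C_ind: p => [c||||p q [p' hp] [q' hq]|p q [p' hp] [q' hq]].
- by exists 0; apply: theta_deriv_cst.
- by eexists; apply: theta_deriv_g'.
- by eexists; apply: theta_deriv_g.
- by eexists; apply: theta_deriv_x.
- by eexists; apply: theta_derivD; eassumption.
- by eexists; apply: theta_derivM; eassumption.
Qed.

(** An element [a] of [C] commutes with [C], and
    [y a = a y + q a] with [q] in [C] gives [a y = (y - q) a]. *)
Lemma normal_theta p q : theta_deriv p (q * p) -> normal_element (theta p).
Proof.
move=> h; apply: frakU_ind => [c|a b [a' ha] [b' hb]|a b [a' ha] [b' hb]||||].
- by exists c%:A; rewrite scalar_comm.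
- by exists (a' + b'); rewrite mulrDr ha hb mulrDl.
- by exists (a' * b'); rewrite mulrA ha -mulrA hb mulrA.
- by exists g; rewrite -theta_g theta_comm.
- by exists g'; rewrite -theta_g' theta_comm.
- by exists x; rewrite -theta_x theta_comm.
- exists (y - theta q); rewrite mulrBl -rmorphM -h /ad_y opprB addrC.
  by rewrite subrK.
Qed.

(** The variable of [P] stands for [y], written to the right of the
    coefficients.  The map is additive and linear over [C], but it is not
    multiplicative; [y_Theta] and [ThetaMX] are the rules that remain. *)
Definition Theta (P : {poly C}) : U := \sum_(i < size P) theta P`_i * y ^+ i.

Lemma ThetaEw n (P : {poly C}) : (size P <= n)%N ->
  Theta P = \sum_(i < n) theta P`_i * y ^+ i.
Proof.
move=> le; rewrite /Theta (big_ord_widen n (fun i => theta P`_i * y ^+ i) le).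
rewrite big_mkcond; apply: eq_bigr => i _; case: ltnP => // hi.
by rewrite nth_default // rmorph0 mul0r.
Qed.

Lemma ThetaD P Q : Theta (P + Q) = Theta P + Theta Q.
Proof.
pose n := maxn (size P) (size Q).
rewrite (@ThetaEw n (P + Q)) ?size_polyD // (@ThetaEw n P) ?leq_maxl //.
rewrite (@ThetaEw n Q) ?leq_maxr // -big_split; apply: eq_bigr => i _.
by rewrite coefD rmorphD mulrDl.
Qed.

Lemma Theta_scale a P : Theta (a *: P) = theta a * Theta P.
Proof.
rewrite (@ThetaEw (size P) (a *: P)) ?size_scale_leq // /Theta mulr_sumr.
by apply: eq_bigr => i _; rewrite coefZ rmorphM mulrA.
Qed.

Lemma ThetaB P Q : Theta (P - Q) = Theta P - Theta Q.
Proof. by rewrite ThetaD -scaleN1r Theta_scale rmorphN1 mulN1r. Qed.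

Lemma ThetaC a : Theta a%:P = theta a.
Proof.
by rewrite (@ThetaEw 1) ?size_polyC_leq1 // big_ord1 coefC /= expr0 mulr1.
Qed.

Lemma ThetaMX P : Theta (P * 'X) = Theta P * y.
Proof.
rewrite (@ThetaEw (size P).+1) ?size_polyMX_leq //; last first.
  by have [->|P0] := eqVneq P 0; rewrite ?mul0r ?size_poly0 // size_mulX.
rewrite big_ord_recl coefMX /= rmorph0 mul0r add0r /Theta mulr_suml.
by apply: eq_bigr => i _; rewrite coefMX /= -mulrA exprSr.
Qed.

Lemma y_Theta P : exists2 Q, y * Theta P = Theta (P * 'X + Q) & (size Q <= size P)%N.
Proof.
have [f hf] := choice theta_deriv_ex.
exists (\poly_(i < size P) f P`_i); last exact: size_poly.
rewrite ThetaD ThetaMX (ThetaEw (size_poly _ _)) /Theta mulr_sumr mulr_suml -big_split.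
apply: eq_bigr => i _ /=; rewrite coef_poly ltn_ord -hf /ad_y mulrBl !mulrA.
by rewrite -[theta _ * _ * y]mulrA -exprSr exprS !mulrA addrC subrK.
Qed.

Lemma Theta_surj u : exists P, u = Theta P.
Proof.
suff : forall w, (exists P, w = Theta P) -> exists P, u * w = Theta P.
  by move=> /(_ 1) []; [exists 1%:P; rewrite ThetaC rmorph1 | move=> P; rewrite mulr1; exists P].
elim/frakU_ind: u => [c|a b ha hb|a b ha hb||||] w [P ->].
- by exists (cst c *: P); rewrite Theta_scale theta_cst.
- have [Pa ea] := ha _ (ex_intro _ P erefl); have [Pb eb] := hb _ (ex_intro _ P erefl).
  by exists (Pa + Pb); rewrite mulrDl ea eb ThetaD.
- by rewrite -mulrA; apply: ha; apply: hb; exists P.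
- by exists (Cg *: P); rewrite Theta_scale theta_g.
- by exists (Cg' *: P); rewrite Theta_scale theta_g'.
- by exists (Cx *: P); rewrite Theta_scale theta_x.
- by have [Q -> _] := y_Theta P; eexists.
Qed.

End CommutativePart.

(** * Weight vectors for the action of y *)

Section Weights.
Variables (k : fieldType) (lam : k).
Hypothesis two_neq0 : (2 : k) != 0.
Local Notation C := {poly {poly {poly k}}}.
Local Notation theta := (theta lam).
Local Notation Cg := (Cg k).
Local Notation Cg' := (Cg' k).
Local Notation Cx := (Cx k).
Local Notation theta_deriv := (theta_deriv lam).

(** [v3 s] and [v3 (- s)] are the eigenvectors of [ [y, .] ] with eigenvalues
    [- s] and [s].  The elements [chi3 (+-s) (+-1)] are [phi_(+-)] and
    [psi_(+-)]; they divide their own derivatives. *)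
Definition Om3 : C := Cx ^+ 2 * Cg' - cst k (2 * lam) * (Cg' + Cg).
Definition v3 (s : k) : C := Cg' * ((Cx - cst k s) ^+ 2 - cst k s ^+ 2 * Cg ^+ 2).
Definition chi3 (s e : k) : C := Cx - cst k s * (cst k e * Cg - 1).

Lemma cst_half : 2 * cst k 2^-1 = 1.
Proof. by rewrite -(rmorph_nat (cst k)) -rmorphM mulfV // rmorph1. Qed.

Lemma theta_Om : theta Om3 = Omega lam.
Proof.
by rewrite /Omega -[(2 * lam) *: _]mulr_algl -theta_x -theta_g -theta_g' -theta_cst
  -rmorphXn -rmorphM -rmorphD -rmorphM -rmorphB.
Qed.

Section SquareRoot.
Variable s : k.
Hypothesis s2 : s ^+ 2 = 2 * lam.

Let S := cst k s.

Lemma cst_sqrt : cst k (2 * lam) = cst k s ^+ 2.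
Proof. by rewrite -rmorphXn s2. Qed.

Lemma cst_lam : cst k lam = cst k 2^-1 * cst k s ^+ 2.
Proof. by rewrite -cst_sqrt -rmorphM mulrA mulVf // mul1r. Qed.

Lemma theta_deriv_x' : theta_deriv Cx (- cst k 2^-1 * (Cx ^+ 2 - S ^+ 2 * (1 - Cg ^+ 2))).
Proof.
have := theta_deriv_x lam; rewrite cst_lam -/S.
by congr theta_deriv; ring.
Qed.

Lemma theta_deriv_eq p q r t : theta_deriv p q ->
  q - r = t * (Cg * Cg' - 1) -> theta_deriv p r.
Proof. by rewrite /theta_deriv => ->; apply: theta_eq. Qed.

Lemma theta_deriv_Om : theta_deriv Om3 0.
Proof.
have hx := theta_deriv_x'; have hg := theta_deriv_g lam; have hg' := theta_deriv_g' lam.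
have h1 := theta_derivM (theta_derivM hx hx) hg'.
have h2 := theta_derivN (theta_derivM (theta_deriv_cst lam (2 * lam)) (theta_derivD hg' hg)).
apply: (theta_deriv_eq (t := - (Cx * S ^+ 2 * Cg)) (theta_derivD h1 h2)).
rewrite cst_sqrt -/S.
have -> : forall h : C, (- h * (Cx ^+ 2 - S ^+ 2 * (1 - Cg ^+ 2)) * Cx +
   Cx * (- h * (Cx ^+ 2 - S ^+ 2 * (1 - Cg ^+ 2)))) =
   - (2 * h) * Cx * (Cx ^+ 2 - S ^+ 2 * (1 - Cg ^+ 2)) by move=> h; ring.
by rewrite cst_half; ring.
Qed.

Lemma Omega_central u : GRing.comm (Omega lam) u.
Proof.
rewrite -theta_Om; move: u; apply: frakU_ind => [c|a b|a b||||].
- exact: scalar_comm.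
- exact: commrD.
- exact: commrM.
- by rewrite -theta_g; apply: theta_comm.
- by rewrite -theta_g'; apply: theta_comm.
- by rewrite -theta_x; apply: theta_comm.
- by apply: esym; apply/eqP; rewrite -subr_eq0 -[_ - _]/(ad_y _) theta_deriv_Om rmorph0.
Qed.

Lemma theta_deriv_v : theta_deriv (v3 s) (- S * v3 s).
Proof.
have hx := theta_deriv_x'; have hg := theta_deriv_g lam; have hg' := theta_deriv_g' lam.
have hxS := theta_derivD hx (theta_derivN (theta_deriv_cst lam s)).
have hS := theta_deriv_cst lam s.
have h := theta_derivM hg' (theta_derivD (theta_derivM hxS hxS)
  (theta_derivN (theta_derivM (theta_derivM hS hS) (theta_derivM hg hg)))).
apply: (theta_deriv_eq (t := 0) h); rewrite /v3 -/S mul0r.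
have -> : forall h : C, (- h * (Cx ^+ 2 - S ^+ 2 * (1 - Cg ^+ 2)) - 0) * (Cx - S) +
   (Cx - S) * (- h * (Cx ^+ 2 - S ^+ 2 * (1 - Cg ^+ 2)) - 0) =
   - (2 * h) * (Cx - S) * (Cx ^+ 2 - S ^+ 2 * (1 - Cg ^+ 2)) by move=> h'; ring.
by rewrite cst_half; ring.
Qed.

Lemma theta_deriv_chi e : e ^+ 2 = 1 ->
  theta_deriv (chi3 s e) (- (cst k 2^-1 * chi3 (- s) (- e)) * chi3 s e).
Proof.
move=> e2; have hx := theta_deriv_x'; have hg := theta_deriv_g lam.
have hS := theta_deriv_cst lam s; have he := theta_deriv_cst lam e.
have h1 := theta_deriv_cst lam 1; rewrite rmorph1 in h1.
have h := theta_derivD hx (theta_derivN (theta_derivM hS (theta_derivD (theta_derivM he hg) (theta_derivN h1)))).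
apply: (theta_deriv_eq (t := 0) h); rewrite /chi3 -/S !rmorphN -/S mul0r.
have e2' : cst k e ^+ 2 = 1 by rewrite -rmorphXn e2 rmorph1.
have half := cst_half.
apply/eqP; set E := cst k e in e2' *; set H := cst k 2^-1 in half *.
set L := (X in X == _).
have -> : L = H * S ^+ 2 * Cg ^+ 2 * (E ^+ 2 - 1) + (1 - 2 * H) * (S * E * Cx * Cg).
  by rewrite /L; ring.
by rewrite e2' half !subrr mulr0 !mul0r addr0.
Qed.

Lemma theta_v_mul : theta (v3 s * v3 (- s)) = theta (Om3 ^+ 2 - cst k (2 * s ^+ 2) ^+ 2).
Proof.
apply: (@theta_eq k lam _ _ (- 2 * S ^+ 2 * Cx ^+ 2 * (Cg * Cg') - 2 * S ^+ 4 * (Cg * Cg' + 2)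
  + S ^+ 4 * Cg ^+ 2 * (Cg * Cg' + 1))).
by rewrite /v3 /Om3 cst_sqrt rmorphN rmorphM rmorph_nat rmorphXn -/S; ring.
Qed.

Lemma theta_v_sum : theta (v3 s + v3 (- s)) = theta (2 * Om3 + cst k (4 * s ^+ 2) * Cg').
Proof.
apply: (@theta_eq k lam _ _ (- 2 * S ^+ 2 * Cg)).
by rewrite /v3 /Om3 cst_sqrt rmorphN rmorphM rmorph_nat rmorphXn -/S; ring.
Qed.

Lemma theta_v_diff : theta (v3 (- s) - v3 s) = theta (cst k (4 * s) * Cx * Cg').
Proof.
apply: (congr1 (fun p => theta p)); rewrite /v3 rmorphN rmorphM rmorph_nat; ring.
Qed.

Lemma theta_Om_chi e : e ^+ 2 = 1 ->
  theta (Om3 + cst k (2 * s ^+ 2 * e)) = theta (Cg' * (chi3 s e * chi3 (- s) e)).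
Proof.
move=> e2; have e2' : cst k e ^+ 2 = 1 by rewrite -rmorphXn e2 rmorph1.
set E := cst k e in e2' *.
apply: (@theta_eq k lam _ _ (S ^+ 2 * (Cg - 2 * E))).
rewrite /chi3 /Om3 cst_sqrt rmorphN !rmorphM rmorph_nat -/S -/E.
apply/eqP; rewrite -subr_eq0; set L := (X in X == _).
have -> : L = S ^+ 2 * Cg' * Cg ^+ 2 * (E ^+ 2 - 1) by rewrite /L; ring.
by rewrite e2' subrr mulr0.
Qed.

Lemma theta_v_chi e : e ^+ 2 = 1 ->
  theta (v3 (- s)) = theta (Cg' * (chi3 s e * chi3 s (- e))).
Proof.
move=> e2; have e2' : cst k e ^+ 2 = 1 by rewrite -rmorphXn e2 rmorph1.
apply: (congr1 (fun p => theta p)); rewrite /v3 /chi3 !rmorphN; set E := cst k e in e2' *.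
transitivity (Cg' * ((Cx + S) ^+ 2 - S ^+ 2 * E ^+ 2 * Cg ^+ 2)); first by rewrite e2' /S; ring.
by rewrite -/S; ring.
Qed.

End SquareRoot.
End Weights.

(** * Normal forms in Omega and a weight vector *)

Section WeightForm.
Variables (k : fieldType) (lam : k).
Hypotheses (two_neq0 : (2 : k) != 0) (lam_neq0 : lam != 0).
Local Notation T := {poly k}.
Local Notation C := {poly {poly {poly k}}}.
Local Notation theta := (theta lam).
Local Notation Cg := (Cg k).
Local Notation Cg' := (Cg' k).
Local Notation Cx := (Cx k).
Local Notation theta_deriv := (theta_deriv lam).
Local Notation Om3 := (Om3 lam).

Lemma cst_comm : commr_rmorph (cst k) Om3. Proof. by move=> a; apply: mulrC. Qed.

(** [E0] evaluates a polynomial at [Omega], and [Ev s] evaluates a polynomial in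
    two variables, the inner one at [Omega] and the outer one at [v_s]. *)
Definition E0 : {rmorphism T -> C} := locked (horner_morph cst_comm : {rmorphism T -> C}).
Lemma E0C c : E0 c%:P = cst k c.
Proof. by rewrite /E0 -lock /= horner_morphC. Qed.
Lemma E0X : E0 'X = Om3.
Proof. by rewrite /E0 -lock /= horner_morphX. Qed.

Lemma E0_comm s : commr_rmorph E0 (v3 s). Proof. by move=> a; apply: mulrC. Qed.
Definition Ev s : {rmorphism {poly T} -> C} :=
  locked (horner_morph (@E0_comm s) : {rmorphism {poly T} -> C}).
Lemma EvC s c : Ev s c%:P = E0 c.
Proof. by rewrite /Ev -lock /= horner_morphC. Qed.
Lemma EvX s : Ev s 'X = v3 s.
Proof. by rewrite /Ev -lock /= horner_morphX. Qed.

Section SquareRoot.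
Variable s : k.
Hypothesis s2 : s ^+ 2 = 2 * lam.

Lemma s_neq0 : s != 0.
Proof. by rewrite -sqrf_eq0 s2 mulf_neq0. Qed.

Lemma theta_deriv_E0 r : theta_deriv (E0 r) 0.
Proof.
elim/poly_ind: r => [|r c IH].
  by rewrite !rmorph0 -(rmorph0 (cst k)); have := theta_deriv_cst lam 0; rewrite rmorph0.
rewrite rmorphD rmorphM /= E0X E0C.
have := theta_derivD (theta_derivM IH (theta_deriv_Om two_neq0 s2)) (theta_deriv_cst lam c).
by rewrite mul0r mulr0 !addr0.
Qed.

(** The derivation acts on polynomials in [Omega] and [v_s] as [- s] times the
    Euler operator in [v_s], because [Omega] is a constant. *)
Lemma theta_deriv_Ev p : theta_deriv (Ev s p) (- cst k s * Ev s ('X * p^`())).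
Proof.
elim/poly_ind: p => [|p c IH].
  by rewrite deriv0 mulr0 !rmorph0 mulr0; have := theta_deriv_E0 0; rewrite rmorph0.
rewrite rmorphD rmorphM /= EvX EvC.
have := theta_derivD (theta_derivM IH (theta_deriv_v two_neq0 s2)) (theta_deriv_E0 c).
congr theta_deriv; rewrite derivD derivM derivX derivC !addr0 mulr1.
by rewrite mulrDr !rmorphD !rmorphM /= EvX; ring.
Qed.

Definition vprod : T := locked ('X ^+ 2 - ((2 * s ^+ 2) ^+ 2)%:P).

Lemma E0_vprod : E0 vprod = Om3 ^+ 2 - cst k (2 * s ^+ 2) ^+ 2.
Proof. by rewrite /vprod -lock rmorphB rmorphXn /= E0X E0C rmorphXn. Qed.

Lemma theta_v_mulE : theta (v3 s * v3 (- s)) = theta (E0 vprod).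
Proof. by rewrite (theta_v_mul s2) E0_vprod. Qed.

(** As [v_s v_(-s)] is a polynomial in [Omega], mixed products can be removed
    from the polynomials in [Omega], [v_s] and [v_(-s)].  The terms without
    [v_s] or [v_(-s)] are put into [p1]. *)
Definition graded_form a := exists p1 p2,
  theta a = theta (Ev s p1 + v3 (- s) * Ev (- s) p2).

Lemma graded_form_eq a b : theta a = theta b -> graded_form b -> graded_form a.
Proof. by move=> e [p1 [p2 h]]; exists p1, p2; rewrite e. Qed.

Lemma graded_formD a b : graded_form a -> graded_form b -> graded_form (a + b).
Proof.
move=> [p1 [p2 h]] [q1 [q2 h']]; exists (p1 + q1), (p2 + q2).
rewrite [LHS]rmorphD h h' -rmorphD; apply: (congr1 (fun p => theta p));
by rewrite !rmorphD /=; ring.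
Qed.

Lemma graded_formE0 r a : graded_form a -> graded_form (E0 r * a).
Proof.
move=> [p1 [p2 h]]; exists (r%:P * p1), (r%:P * p2).
rewrite [LHS]rmorphM h -rmorphM; apply: (congr1 (fun p => theta p));
by rewrite !rmorphM /= !EvC; ring.
Qed.

Lemma graded_formC c a : graded_form a -> graded_form (cst k c * a).
Proof. by rewrite -E0C; apply: graded_formE0. Qed.

Lemma graded_form_v a : graded_form a -> graded_form (v3 s * a).
Proof.
move=> [p1 [p2 h]]; have [q [c e]] := poly_split p2.
exists ('X * p1 + vprod%:P * c%:P), (vprod%:P * q).
have e1 : theta (v3 s * v3 (- s) * Ev (- s) p2) = theta (E0 vprod * Ev (- s) p2).
  by rewrite rmorphM theta_v_mulE -rmorphM.
rewrite [LHS]rmorphM h -rmorphM mulrDr mulrA rmorphD e1 -rmorphD.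
apply: (congr1 (fun p => theta p)); rewrite e !rmorphD !rmorphM /= !EvC !EvX.
by ring.
Qed.

Lemma graded_form_v' a : graded_form a -> graded_form (v3 (- s) * a).
Proof.
move=> [p1 [p2 h]]; have [q [c e]] := poly_split p1.
exists (vprod%:P * q), (c%:P + 'X * p2).
have e1 : theta (v3 s * v3 (- s) * Ev s q) = theta (E0 vprod * Ev s q).
  by rewrite rmorphM theta_v_mulE -rmorphM.
rewrite [LHS]rmorphM h -rmorphM e.
have -> : v3 (- s) * (Ev s (q * 'X + c%:P) + v3 (- s) * Ev (- s) p2) =
    v3 s * v3 (- s) * Ev s q + v3 (- s) * (E0 c + v3 (- s) * Ev (- s) p2).
  by rewrite rmorphD rmorphM /= EvX EvC; ring.
rewrite rmorphD e1 -rmorphD; apply: (congr1 (fun p => theta p));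
by rewrite rmorphD !rmorphM /= !EvC EvX; ring.
Qed.

(** [4 s^2 g^-1 = v_s + v_(-s) - 2 Omega]. *)
Lemma graded_form_g' a : graded_form a -> graded_form (Cg' * a).
Proof.
move=> ha; have h4 : 4 * s ^+ 2 != 0.
  by rewrite mulf_neq0 ?expf_neq0 ?s_neq0 // (natrM _ 2 2) mulf_neq0.
apply: (@graded_form_eq _ (cst k (4 * s ^+ 2)^-1 * (v3 s * a + v3 (- s) * a +
   E0 (- 2 * 'X) * a))); last first.
  apply: graded_formC; apply: graded_formD; last exact: graded_formE0.
  by apply: graded_formD; [apply: graded_form_v | apply: graded_form_v'].
have inv : cst k (4 * s ^+ 2)^-1 * cst k (4 * s ^+ 2) = 1 by rewrite -rmorphM mulVf ?rmorph1.
have := theta_v_sum s2; rewrite [E0 _]rmorphM rmorphN rmorph_nat /= E0X.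
move: (cst k (4 * s ^+ 2)) (cst k _) inv => Q Q' QQ' e.
have -> : Cg' * a = Q' * (2 * Om3 + Q * Cg' - 2 * Om3) * a.
  by rewrite -[LHS]mul1r -QQ'; ring.
rewrite rmorphM [X in X * _]rmorphM rmorphB -e -rmorphB -rmorphM -rmorphM.
apply: (congr1 (fun p => theta p)); ring.
Qed.

(** [4 s x g^-1 = v_(-s) - v_s]. *)
Lemma graded_form_xg' a : graded_form a -> graded_form (Cx * Cg' * a).
Proof.
move=> ha; have h4 : 4 * s != 0.
  by rewrite mulf_neq0 ?s_neq0 // (natrM _ 2 2) mulf_neq0.
apply: (@graded_form_eq _ (cst k (4 * s)^-1 * (v3 (- s) * a + cst k (-1) * (v3 s * a)))); last first.
  apply: graded_formC; apply: graded_formD; first exact: graded_form_v'.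
  by apply: graded_formC; apply: graded_form_v.
have inv : cst k (4 * s)^-1 * cst k (4 * s) = 1 by rewrite -rmorphM mulVf ?rmorph1.
have := theta_v_diff lam s; rewrite rmorphN1.
move: (cst k (4 * s)) (cst k _) inv => Q Q' QQ' e.
have -> : Cx * Cg' * a = Q' * (Q * Cx * Cg') * a.
  by rewrite -[LHS]mul1r -QQ'; ring.
rewrite rmorphM [X in X * _]rmorphM -e -rmorphM -rmorphM.
apply: (congr1 (fun p => theta p)); ring.
Qed.

Lemma theta_gg'X M a : theta (Cg' ^+ M.+1 * Cg * a) = theta (Cg' ^+ M * a).
Proof.
by apply: (@theta_eq k lam _ _ (Cg' ^+ M * a)); rewrite exprS; ring.
Qed.

Lemma graded_form_g'X M N a : (M <= N)%N ->
  graded_form (Cg' ^+ M * a) -> graded_form (Cg' ^+ N * a).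
Proof.
move=> MN; rewrite -(subnK MN) addnC exprD; elim: (N - M)%N => [|n IH] h.
  by rewrite expr0 mulr1.
have := graded_form_g' (IH h); congr graded_form.
by rewrite exprS; ring.
Qed.

(** Multiplying by [g^-1] turns [x] into [x g^-1] and cancels [g], so enough
    factors [g^-1] bring any element of [C] into the subalgebra generated by
    [Omega], [v_s] and [v_(-s)]. *)
Lemma localized_graded_form c : exists M, graded_form (Cg' ^+ M * c).
Proof.
suff : forall a : C, (exists M, graded_form (Cg' ^+ M * a)) ->
    exists M, graded_form (Cg' ^+ M * (c * a)).
  move=> /(_ (1 : C)) [|M]; last by rewrite mulr1; exists M.
  exists 0%N, 1, 0; rewrite (mulr1 (Cg' ^+ 0)) expr0 (rmorph0 (Ev (- s))) (rmorph1 (Ev s)).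
  by rewrite (mulr0 (v3 (- s))) addr0.
elim/C_ind: c => [c||||c d hc hd|c d hc hd] a [M h].
- exists M; have := graded_formC c h; congr graded_form; ring.
- by exists M; have := graded_form_g' h; congr graded_form; ring.
- by exists M.+1; rewrite mulrA; apply: graded_form_eq h; apply: theta_gg'X.
- by exists M.+1; have := graded_form_xg' h; congr graded_form; rewrite exprS; ring.
- have [M1 h1] := hc _ (ex_intro _ M h); have [M2 h2] := hd _ (ex_intro _ M h).
  exists (maxn M1 M2); rewrite mulrDl mulrDr; apply: graded_formD.
    exact: graded_form_g'X (leq_maxl _ _) h1.
  exact: graded_form_g'X (leq_maxr _ _) h2.
- by have [N hN] := hc _ (hd _ (ex_intro _ M h)); exists N; rewrite -(mulrA c).
Qed.

Lemma vprod_neq0 : vprod != 0.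
Proof.
by rewrite /vprod -lock -size_poly_eq0 size_XnsubC.
Qed.

(** Multiplying by a power of [v_s] removes [v_(-s)]; nothing is lost, because
    the coefficients are only shifted and multiplied by powers of [vprod]. *)
Lemma v_clear p1 p2 : exists N p,
  theta (v3 s ^+ N * (Ev s p1 + v3 (- s) * Ev (- s) p2)) = theta (Ev s p) /\
  (p = 0 -> p1 = 0 /\ p2 = 0).
Proof.
have [n] := ubnP (size p2); elim: n p1 p2 => // n IH p1 p2.
rewrite ltnS leq_eqVlt => /orP[/eqP szp|]; last exact: IH.
have [p20|p20] := eqVneq p2 0.
  exists 0%N, p1; rewrite p20 rmorph0 mulr0 addr0 expr0 mul1r.
  by split=> // p10; split.
have [q [c e]] := poly_split p2.
have [|N [p [h hp]]] := IH ('X * p1 + (vprod * c)%:P) (vprod *: q).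
  apply: leq_ltn_trans (size_scale_leq _ _) _.
  rewrite -szp; have [q0|q0] := eqVneq q 0.
    by rewrite q0 size_poly0 lt0n size_poly_eq0.
  by rewrite e size_MXaddC (negPf q0).
exists N.+1, p; split; last first.
  move=> /hp [h1 h2].
  have c0 : c = 0.
    have := congr1 (fun u : {poly T} => u`_0) h1.
    rewrite coefD mulrC coefMX coefC /= add0r coef0 => /eqP.
    by rewrite mulf_eq0 (negPf vprod_neq0) => /eqP.
  have q0 : q = 0 by apply/eqP; move/eqP: h2; rewrite -mul_polyC mulf_eq0 polyC_eq0 (negPf vprod_neq0).
  split; last by rewrite e q0 c0 mul0r add0r.
  apply/eqP; move/eqP: h1; rewrite c0 mulr0 addr0 mulf_eq0 polyX_eq0.
  by case: eqP.
rewrite -h exprSr -mulrA [LHS]rmorphM [RHS]rmorphM; congr (_ * _).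
have -> : v3 s * (Ev s p1 + v3 (- s) * Ev (- s) p2) =
  v3 s * Ev s p1 + v3 s * v3 (- s) * (v3 (- s) * Ev (- s) q + E0 c).
  by rewrite e rmorphD rmorphM /= EvX EvC; ring.
rewrite [LHS]rmorphD [X in _ + X]rmorphM theta_v_mulE -rmorphM -rmorphD; apply: (congr1 (fun p => theta p));
by rewrite -mul_polyC polyCM rmorphD !rmorphM /= EvX !EvC; ring.
Qed.

(** The implication makes the normal form faithful: [p] can vanish only if
    [c] does, since [g^-1] is a unit. *)
Lemma v_form c : exists M N p,
  theta (Cg' ^+ M * v3 s ^+ N * c) = theta (Ev s p) /\ (p = 0 -> theta c = 0).
Proof.
have [M [p1 [p2 h]]] := localized_graded_form c.
have [N [p [e hp]]] := v_clear p1 p2.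
exists M, N, p; split; last first.
  move=> /hp [p10 p20]; have : theta (Cg ^+ M * (Cg' ^+ M * c)) = 0.
    by rewrite rmorphM h p10 p20 (rmorph0 (Ev _)) (rmorph0 (Ev _)) mulr0 addr0 rmorph0 mulr0.
  rewrite mulrA -exprMn rmorphM rmorphXn rmorphM /= theta_g theta_g' Ugg' expr1n.
  by rewrite mul1r.
have -> : Cg' ^+ M * v3 s ^+ N * c = v3 s ^+ N * (Cg' ^+ M * c) by ring.
by rewrite rmorphM h -rmorphM e.
Qed.

(** The numerator of [4 s^2 g^-1] as a rational function of [Omega] and
    [v_s]. *)
Definition ginv_poly : {poly T} :=
  locked (('X - 'X%:P) ^+ 2 - (((2 * s ^+ 2) ^+ 2)%:P)%:P).

Lemma Ev_ginv_poly : Ev s ginv_poly = (v3 s - Om3) ^+ 2 - cst k (2 * s ^+ 2) ^+ 2.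
Proof.
by rewrite /ginv_poly -lock rmorphB rmorphXn rmorphB /= EvX !EvC E0X E0C rmorphXn.
Qed.

Lemma theta_ginv_poly : theta (Ev s ginv_poly) = theta (cst k (4 * s ^+ 2) * Cg' * v3 s).
Proof.
have := theta_v_sum s2; move: (cst k (4 * s ^+ 2)) => Q e0.
have -> : Q * Cg' * v3 s = (2 * Om3 + Q * Cg') * v3 s - 2 * Om3 * v3 s by ring.
rewrite [RHS]rmorphB [X in _ = X - _]rmorphM -e0 -rmorphM -rmorphB.
have -> : (v3 s + v3 (- s)) * v3 s - 2 * Om3 * v3 s =
  v3 s ^+ 2 - 2 * Om3 * v3 s + v3 s * v3 (- s) by ring.
rewrite [RHS]rmorphD theta_v_mulE -rmorphD E0_vprod Ev_ginv_poly.
apply: (congr1 (fun p => theta p)); ring.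
Qed.

End SquareRoot.
End WeightForm.

(** * Rational parametrization of the conics *)

(** On the curve [Omega = a] the equations [v_s v_(-s) = a^2 - 4 S^4],
    [4 S^2 g^-1 = v_s + v_(-s) - 2 a] and [4 S x g^-1 = v_(-s) - v_s] express
    [g] and [x] rationally in [V = v_s].  The derivation of the function field
    with [d V = - S V] then takes the required values on [g] and [x]. *)
Section CurveParametrization.
Variables (F : fieldType) (d : derivation F) (S a V : F).
Hypotheses (dS : d S = 0) (da : d a = 0) (dV : d V = - (S * V)).
Hypotheses (two_neq0 : (2 : F) != 0) (S_neq0 : S != 0) (V_neq0 : V != 0).

Definition curve_den := (V - a) ^+ 2 - 4 * S ^+ 4.
Hypothesis den_neq0 : curve_den != 0.

Definition curve_g := 4 * S ^+ 2 * V / curve_den.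
Definition curve_x := S * (a ^+ 2 - 4 * S ^+ 4 - V ^+ 2) / curve_den.

Lemma four_neq0 : (4 : F) != 0.
Proof. by rewrite (natrM _ 2 2) mulf_neq0. Qed.

Lemma curve_g_neq0 : curve_g != 0.
Proof. by rewrite /curve_g !mulf_neq0 ?invr_eq0 ?expf_neq0 ?four_neq0. Qed.

Lemma der_nat n : d n%:R = 0.
Proof. by elim: n => [|n IH]; rewrite ?der0 // -natr1 derD IH der1 addr0. Qed.

Lemma der_exp u n : d (u ^+ n.+1) = n.+1%:R * u ^+ n * d u.
Proof.
elim: n => [|n IH]; first by rewrite !expr1 expr0 !mul1r.
by rewrite exprS derM IH -[n.+2%:R]natr1 !exprS; ring.
Qed.

Lemma der_den : d curve_den = - (2 * S * V * (V - a)).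
Proof.
rewrite /curve_den derB (derM _ 4) der_nat !der_exp dS derB da dV; ring.
Qed.

Lemma der_curve_g : d curve_g = - (curve_x * curve_g).
Proof.
rewrite /curve_g derM derV // der_den derM (derM _ 4) der_nat !der_exp dS dV /curve_x.
have := den_neq0; rewrite /curve_den => h; field.
by rewrite /= h.
Qed.

Lemma der_curve_x : d curve_x =
  - (2^-1 * curve_x ^+ 2) + S ^+ 2 / 2 * (1 - curve_g ^+ 2).
Proof.
rewrite /curve_x derM derV // der_den derM !derB (derM _ 4) der_nat !der_exp dS da dV /curve_g.
have := den_neq0; rewrite /curve_den => h; field.
by rewrite /= h two_neq0.
Qed.

Lemma curve_Omega : curve_x ^+ 2 * curve_g^-1 - S ^+ 2 * (curve_g^-1 + curve_g) = a.
Proof.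
rewrite /curve_x /curve_g; have := den_neq0; rewrite /curve_den => h; field.
by rewrite /= h V_neq0 S_neq0 four_neq0.
Qed.

Lemma curve_v : curve_g^-1 * ((curve_x - S) ^+ 2 - S ^+ 2 * curve_g ^+ 2) = V.
Proof.
rewrite /curve_x /curve_g; have := den_neq0; rewrite /curve_den => h; field.
by rewrite /= h V_neq0 S_neq0 four_neq0.
Qed.

End CurveParametrization.

(** * Representations over the function field of a conic *)

Section Representation.
Variables (k : fieldType) (lam : k).
Hypotheses (two_neq0 : (2 : k) != 0) (lam_neq0 : lam != 0).
Local Notation U := (frakU lam).
Local Notation T := {poly k}.
Local Notation theta := (theta lam).

Variable s : k.
Hypothesis s2 : s ^+ 2 = 2 * lam.

(* [F] stands for [k(v_s)]; all that matters is that it contains the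
   polynomials and that its derivation extends [- s] times the Euler operator. *)
Variables (F : fieldType) (iota : {rmorphism T -> F}) (dF : derivation F).
Hypotheses (iota_inj : injective iota) (dF_iota_C : forall c, dF (iota c%:P) = 0).
Hypothesis dF_iota_X : dF (iota 'X) = - (iota s%:P * iota 'X).

Definition cF : {rmorphism k -> F} := locked (iota \o polyC : {rmorphism k -> F}).
Lemma cFE c : cF c = iota c%:P.
Proof. by rewrite /cF -lock. Qed.
Definition V : F := iota 'X.

Lemma iota_eq0 p : (iota p == 0) = (p == 0).
Proof. by rewrite -(rmorph0 iota) (inj_eq iota_inj). Qed.
Lemma dF_cF c : dF (cF c) = 0.
Proof. by rewrite cFE. Qed.
Lemma dF_V : dF V = - (cF s * V).
Proof. by rewrite cFE. Qed.
Lemma V_neq0 : V != 0.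
Proof. by rewrite iota_eq0 polyX_eq0. Qed.
Lemma cF_eq0 c : (cF c == 0) = (c == 0).
Proof. by rewrite fmorph_eq0. Qed.

Lemma cF_two_neq0 : (2 : F) != 0.
Proof. by rewrite -(rmorph_nat cF) cF_eq0. Qed.

Lemma cF_den_neq0 alpha : curve_den (cF s) (cF alpha) V != 0.
Proof.
rewrite /curve_den -(rmorph_nat cF 4) -rmorphXn -rmorphM !cFE -rmorphB -rmorphXn -rmorphB iota_eq0.
have -> : ('X - alpha%:P) ^+ 2 - (4 * s ^+ 4)%:P =
  ('X - (alpha + 2 * s ^+ 2)%:P) * ('X - (alpha - 2 * s ^+ 2)%:P).
  by rewrite !polyCD polyCN !polyCM; ring.
by rewrite mulf_neq0 ?polyXsubC_eq0.
Qed.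

Lemma oreC_central (c : k) (q : ore dF) : GRing.comm (oreC dF (cF c)) q.
Proof.
have Yc i : iter i (ore_Y dF) (cF c)%:P = cF c *: 'X^i.
  elim: i => [|i /= ->]; first by rewrite expr0 alg_polyC.
  by rewrite ore_Y_scale dF_cF scale0r add0r -(iter_ore_Y1 dF) -(iter_ore_Y1 dF i.+1).
rewrite /GRing.comm oreCM -[RHS]/(ore_mul _ _) /ore_mul /oreC.
rewrite [in LHS](_ : (q : {poly F}) = \sum_(i < size (q : {poly F})) (q : {poly F})`_i *: 'X^i).
  rewrite scaler_sumr; apply: eq_bigr => i _.
  by rewrite Yc !scalerA mulrC.
by rewrite -poly_def coefK.
Qed.

(** The representation attached to the conic [Omega = alpha]: the commutative
    part acts through the function field of the conic, and [y] becomes the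
    Ore variable. *)
Definition is_rep (alpha : k) (r : {rmorphism U -> ore dF}) :=
  [/\ r U_g = oreC dF (curve_g (cF s) (cF alpha) V),
      r U_ginv = oreC dF (curve_g (cF s) (cF alpha) V)^-1,
      r U_x = oreC dF (curve_x (cF s) (cF alpha) V), r U_y = oreY dF
    & forall c, r c%:A = oreC dF (cF c)].

Lemma oreC_conj_oreY (a b : F) : dF a = - (b * a) -> a != 0 ->
  oreC dF a * oreY dF * oreC dF a^-1 = oreY dF + oreC dF b.
Proof.
move=> da a0; have h : oreC dF a * oreC dF a^-1 = 1 by rewrite -rmorphM mulfV // rmorph1.
have e := oreY_comm dF a; rewrite da rmorphN rmorphM in e.
have -> : oreC dF a * oreY dF = oreY dF * oreC dF a + oreC dF b * oreC dF a.
  by rewrite -[oreC dF b * _]opprK -e opprB addrC subrK.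
by rewrite mulrDl -(mulrA (oreY dF)) -(mulrA (oreC dF b)) h !mulr1.
Qed.

Lemma oreC_relation (h l a b : F) :
  oreC dF (- (h * b ^+ 2) + l * (1 - a ^+ 2)) =
  - (oreC dF h * oreC dF b ^+ 2) + oreC dF l * (1 - oreC dF a ^+ 2).
Proof.
by rewrite rmorphD rmorphN (rmorphM _ h) (rmorphM _ l) rmorphB !rmorphXn rmorph1.
Qed.

Lemma rep_exists alpha : exists r, is_rep alpha r.
Proof.
set ga := curve_g (cF s) (cF alpha) V; set xi := curve_x (cF s) (cF alpha) V.
have sF0 : cF s != 0 by rewrite cF_eq0 (s_neq0 two_neq0 lam_neq0).
have ga0 : ga != 0 := curve_g_neq0 cF_two_neq0 sF0 V_neq0 (cF_den_neq0 alpha).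
have dga : dF ga = - (xi * ga) :=
  der_curve_g (dF_cF s) (dF_cF alpha) dF_V (cF_den_neq0 alpha).
have dxi := der_curve_x (dF_cF s) (dF_cF alpha) dF_V cF_two_neq0 (cF_den_neq0 alpha).
pose f : {rmorphism k -> ore dF} := (oreC dF \o cF : {rmorphism k -> ore dF}).
have fE c : f c = oreC dF (cF c) by [].
have oM a b : oreC dF (a * b) = oreC dF a * oreC dF b := rmorphM (oreC dF) a b.
have oC a b : oreC dF a * oreC dF b = oreC dF b * oreC dF a by rewrite -oM mulrC oM.
have gg1 : oreC dF ga * oreC dF ga^-1 = 1 by rewrite -rmorphM mulfV // rmorph1.
have [| | | | |r hr] := @frakU_universal k lam (ore dF) f (oreC dF ga) (oreC dF ga^-1)
  (oreC dF xi) (oreY dF) (fun c q => oreC_central c q); last by exists r.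
- exact: gg1.
- by rewrite -rmorphM mulVf // rmorph1.
- by rewrite -mulrA (oC xi) mulrA gg1 mul1r.
- exact: oreC_conj_oreY.
- rewrite oreY_comm dxi oreC_relation !fE fmorphV rmorph_nat.
  by rewrite -(rmorphXn cF) s2 rmorphM rmorph_nat mulrAC mulfV ?mul1r ?cF_two_neq0.
Qed.

Section RepresentationTheory.
Variables (alpha : k) (r : {rmorphism U -> ore dF}).
Hypothesis hr : is_rep alpha r.

Lemma rep_theta_const c : exists f, r (theta c) = oreC dF f.
Proof.
have [hg hg' hx hy hc] := hr.
elim/C_ind: c => [c||||p q [f hf] [f' hf']|p q [f hf] [f' hf']].
- by rewrite theta_cst hc; eexists.
- by rewrite theta_g' hg'; eexists.
- by rewrite theta_g hg; eexists.
- by rewrite theta_x hx; eexists.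
- by exists (f + f'); rewrite [LHS](rmorphD (r \o theta)) /= hf hf' -rmorphD.
- by exists (f * f'); rewrite [LHS](rmorphM (r \o theta)) /= hf hf' -rmorphM.
Qed.

Lemma rep_Theta P : r (Theta lam P) = 0 -> forall i, r (theta P`_i) = 0.
Proof.
have [hg hg' hx hy hc] := hr.
move=> h i; have [hi|hi] := ltnP i (size P); last first.
  by rewrite nth_default // !rmorph0.
have [f hf] := choice (fun j => rep_theta_const P`_j).
have e : \sum_(j < size P) oreC dF (f j) * oreY dF ^+ j = 0.
  rewrite -[RHS]h /Theta [RHS]rmorph_sum; apply: eq_bigr => j _.
  by rewrite [RHS]rmorphM rmorphXn /= hy hf.
by rewrite hf (ore_sum_eq0 e (Ordinal hi)) rmorph0.
Qed.

Lemma rep_Omega : r (Omega lam) = oreC dF (cF alpha).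
Proof.
have [hg hg' hx hy hc] := hr.
have sF0 : cF s != 0 by rewrite cF_eq0 (s_neq0 two_neq0 lam_neq0).
rewrite /Omega -[(2 * lam) *: _]mulr_algl rmorphB (rmorphM r (U_x ^+ 2)).
rewrite (rmorphM r (2 * lam)%:A) rmorphXn rmorphD /= hg hg' hx hc.
rewrite -rmorphXn -rmorphM -rmorphD -rmorphM -rmorphB; congr (oreC dF _).
rewrite -[RHS](curve_Omega cF_two_neq0 sF0 V_neq0 (cF_den_neq0 alpha)).
by rewrite -[in RHS]rmorphXn s2.
Qed.

Lemma rep_v : r (theta (v3 s)) = oreC dF V.
Proof.
have [hg hg' hx hy hc] := hr.
have sF0 : cF s != 0 by rewrite cF_eq0 (s_neq0 two_neq0 lam_neq0).
have e : theta (v3 s) = U_ginv * ((U_x - s%:A) ^+ 2 - (s%:A) ^+ 2 * U_g ^+ 2).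
  by rewrite -theta_g' -theta_x -theta_g -theta_cst -rmorphB -!(rmorphXn theta)
    -rmorphM -rmorphB -rmorphM.
rewrite e (rmorphM r U_ginv) rmorphB (rmorphM r (_ ^+ 2)) !rmorphXn rmorphB /= hg hg' hx hc.
rewrite -(rmorphB (oreC dF)) -!(rmorphXn (oreC dF)) -(rmorphM (oreC dF)) -rmorphB -rmorphM.
congr (oreC dF _).
exact: (curve_v cF_two_neq0 sF0 V_neq0 (cF_den_neq0 alpha)).
Qed.

(** Restriction of a polynomial in [Omega] and [v_s] to the conic
    [Omega = alpha] *)
Definition spec (p : {poly T}) : T := map_poly (horner_eval alpha) p.

Lemma rep_E0 p : r (theta (E0 lam p)) = oreC dF (cF p.[alpha]).
Proof.
have [hg hg' hx hy hc] := hr.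
elim/poly_ind: p => [|p c IH]; first by rewrite horner0 !rmorph0.
rewrite hornerMXaddC [LHS](rmorphD ((r \o theta) \o E0 lam)).
rewrite [X in X + _](rmorphM ((r \o theta) \o E0 lam)) /= E0X E0C theta_Om theta_cst.
rewrite IH rep_Omega hc.
by rewrite (rmorphD cF) (rmorphM cF) (rmorphD (oreC dF)) (rmorphM (oreC dF)).
Qed.

Lemma rep_Ev p : r (theta (Ev lam s p)) = oreC dF (iota (spec p)).
Proof.
elim/poly_ind: p => [|p c IH]; first by rewrite /spec !rmorph0.
rewrite /spec (rmorphD (map_poly _)) (rmorphM (map_poly _)) /= map_polyX map_polyC /=.
rewrite -/(spec p) [LHS](rmorphD ((r \o theta) \o Ev lam s)).
rewrite [X in X + _](rmorphM ((r \o theta) \o Ev lam s)) /= EvX EvC rep_v rep_E0 IH.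
rewrite (rmorphD iota) (rmorphM iota) (rmorphD (oreC dF)) (rmorphM (oreC dF)).
by rewrite cFE.
Qed.

(** A left inverse of an element of the function field is unique, so it has
    degree 0 in [y] and is the image of the constant coefficient. *)
Lemma rep_right_inverse P c : r (Theta lam P * theta c) = 1 ->
  r (theta (P`_0 * c)) = 1.
Proof.
have [hg hg' hx hy hc] := hr.
have [h hh] := rep_theta_const c.
rewrite rmorphM hh => e.
have h0 : h != 0.
  apply/eqP => h0; move: e; rewrite h0 rmorph0 mulr0 => /eqP.
  by rewrite eq_sym oner_eq0.
have {}e : r (Theta lam P) = oreC dF h^-1.
  by rewrite -[LHS]mulr1 -(rmorph1 (oreC dF)) -(mulfV h0) rmorphM mulrA e mul1r.
have [f hf] := choice (fun j => rep_theta_const P`_j).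
suff f0 : f 0%N = h^-1 by rewrite rmorphM rmorphM hh hf f0 -rmorphM mulVf ?rmorph1.
pose n := (size P).-1.
have sz : (size P <= n.+1)%N by rewrite /n; case: (size P).
have : \sum_(j < n.+1) oreC dF (f j - (if j == ord0 then h^-1 else 0)) * oreY dF ^+ j = 0.
  rewrite (eq_bigr (fun j : 'I_n.+1 => oreC dF (f j) * oreY dF ^+ j -
     oreC dF (if j == ord0 then h^-1 else 0) * oreY dF ^+ j)); last first.
    by move=> j _; rewrite rmorphB mulrBl.
  rewrite sumrB [X in _ - X]big_ord_recl [X in _ - (_ + X)]big1 => [|j _]; last first.
    by rewrite eq_sym (negPf (neq_lift ord0 j)) rmorph0 mul0r.
  rewrite eqxx expr0 mulr1 addr0 -e (ThetaEw lam sz) rmorph_sum.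
  apply/eqP; rewrite subr_eq0; apply/eqP; apply: eq_bigr => j _.
  by rewrite [RHS]rmorphM rmorphXn /= hy hf.
by move=> /ore_sum_eq0 /(_ ord0) /= /eqP; rewrite subr_eq0 => /eqP.
Qed.

End RepresentationTheory.

End Representation.

Section RepresentationExists.
Variables (k : fieldType) (lam : k).
Hypotheses (two_neq0 : (2 : k) != 0) (lam_neq0 : lam != 0).
Variable s : k.
Hypothesis s2 : s ^+ 2 = 2 * lam.

Definition euler (p : {poly k}) : {poly k} := - (s%:P * ('X * p^`())).
Lemma eulerD : {morph euler : p q / p + q}.
Proof. by move=> p q; rewrite /euler derivD; ring. Qed.
Lemma eulerM p q : euler (p * q) = euler p * q + p * euler q.
Proof. by rewrite /euler derivM; ring. Qed.
Definition euler_derivation : derivation {poly k} := Derivation eulerD eulerM.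

Lemma conic_representation alpha : exists (S : nzRingType) (r : {rmorphism frakU lam -> S}),
  [/\ forall a b : S, a * b = 0 -> a = 0 \/ b = 0,
      r (Omega lam - alpha%:A) = 0,
      forall p, r (theta lam (Ev lam s p)) = 0 <-> spec alpha p = 0,
      forall P, r (Theta lam P) = 0 -> forall i, r (theta lam P`_i) = 0
    & forall P c, r (Theta lam P * theta lam c) = 1 -> r (theta lam (P`_0 * c)) = 1].
Proof.
have inj : injective (@FracField.tofrac {poly k}).
  by move=> p q /eqP; rewrite tofrac_eq => /eqP.
have dC c : frac_derivation euler_derivation (FracField.tofrac c%:P) = 0.
  by rewrite frac_der_tofrac /= /euler derivC !mulr0 oppr0 tofrac0.
have dX : frac_derivation euler_derivation (FracField.tofrac 'X) =
    - (FracField.tofrac s%:P * FracField.tofrac 'X).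
  by rewrite frac_der_tofrac /= /euler derivX mulr1 tofracN tofracM.
have [r hr] := rep_exists two_neq0 lam_neq0 s2 inj dC dX alpha.
exists (ore (frac_derivation euler_derivation)), r; split.
- exact: ore_domain.
- rewrite rmorphB (rep_Omega two_neq0 lam_neq0 s2 inj hr).
  by have [_ _ _ _ ->] := hr; rewrite subrr.
- move=> p; rewrite (rep_Ev two_neq0 lam_neq0 s2 inj hr).
  rewrite -(rmorph0 (oreC _)); split=> [/oreC_inj/eqP|->]; last by rewrite rmorph0.
  by rewrite tofrac_eq0 => /eqP.
- exact: (rep_Theta hr).
- exact: (rep_right_inverse hr).
Qed.

End RepresentationExists.

(** * Ideals on a conic *)

(** A space stable under the Euler operator [D] contains the homogeneous
    components of its elements: [D p - n p] loses the leading term when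
    [n] is the degree, and it vanishes only if [p] is a monomial. *)
Lemma euler_monomial (R : idomainType) (J : {poly R} -> Prop) :
  (forall n, n.+1%:R != 0 :> R) ->
  (forall p q, J p -> J q -> J (p - q)) -> (forall p, J p -> J ('X * p^`())) ->
  forall p, J p -> p != 0 -> exists r n, r != 0 /\ J (r *: 'X^n).
Proof.
move=> charR JB JE p; have [m] := ubnP (size p); elim: m p => // m IH p szp Jp p0.
have J0 : J 0 by rewrite -(subrr p); apply: (JB).
have Jn n : J (p *+ n).
  elim: n => [|n Jn]; first by rewrite mulr0n.
  by rewrite mulrS -[p *+ n]opprK; apply: (JB) => //; rewrite -[- _]sub0r; apply: (JB).
pose n := (size p).-1; have sn : size p = n.+1 by rewrite prednK // lt0n size_poly_eq0.
pose q := 'X * p^`() - p *+ n.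
have qE i : q`_i = p`_i *+ i - p`_i *+ n.
  by rewrite coefB coefMn coefXM coef_deriv; case: i => [|i] //=; rewrite mulr0n.
have Jq : J q by apply: (JB) => //; apply: (JE).
have [q0|q0] := eqVneq q 0; last first.
  apply: (IH q) => //; apply: leq_trans (_ : size p <= _)%N; last by [].
  rewrite sn ltnS; apply/leq_sizeP => j nj; rewrite qE.
  move: nj; rewrite leq_eqVlt => /orP[/eqP->|nj]; first by rewrite subrr.
  by rewrite nth_default ?sn // !mul0rn subrr.
exists (lead_coef p), n; split; first by rewrite lead_coef_eq0.
suff -> : lead_coef p *: 'X^n = p by [].
apply/polyP => i; rewrite coefZ coefXn; have [->|ni] := eqVneq i n.
  by rewrite mulr1.
rewrite mulr0; have := qE i; rewrite q0 coef0 => /esym/eqP.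
have [lt|gt|e] := ltngtP i n; last by rewrite e eqxx in ni.
  rewrite -(subnK (ltnW lt)) mulrnDr opprD addrA addrAC subrr add0r oppr_eq0.
  rewrite -mulr_natr mulf_eq0; case/orP => [/eqP-> //|].
  by move: lt; rewrite -subn_gt0; case: (n - i)%N => // j _; rewrite (negPf (charR j)).
by move=> _; rewrite nth_default // sn.
Qed.

Section Ideals.
Variables (k : closedFieldType) (lam : k).
Hypotheses (char0 : forall n, n.+1%:R != 0 :> k) (lam_neq0 : lam != 0).
Local Notation U := (frakU lam).
Local Notation T := {poly k}.
Local Notation C := {poly {poly {poly k}}}.
Local Notation theta := (theta lam).
Local Notation Cg := (Cg k).
Local Notation Cg' := (Cg' k).
Local Notation E0 := (E0 lam).
Local Notation Ev := (Ev lam).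
Local Notation Theta := (Theta lam).

Lemma two_neq0 : (2 : k) != 0. Proof. exact: (char0 1). Qed.
Lemma char0_poly n : n.+1%:R != 0 :> {poly k}.
Proof. by rewrite -(rmorph_nat (@polyC k)) polyC_eq0. Qed.

Section SquareRoot.
Variable s : k.
Hypothesis s2 : s ^+ 2 = 2 * lam.
Local Notation v := (theta (v3 s)).
Local Notation v' := (theta (v3 (- s))).
Local Notation vprod := (vprod s).

Let s0 : s != 0 := s_neq0 two_neq0 lam_neq0 s2.

Lemma ideal_scalar (I : set U) c u : twosided_ideal I -> c != 0 -> I (c%:A * u) -> I u.
Proof.
move=> [_ _ IL _] c0 h; have := IL c^-1%:A _ h.
by rewrite !mulr_algl scalerA mulVf // scale1r.
Qed.

Lemma ideal_ginv (I : set U) M c : twosided_ideal I ->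
  I (theta (Cg' ^+ M * c)) -> I (theta c).
Proof.
move=> [_ _ IL _] h; have := IL (theta (Cg ^+ M)) _ h.
rewrite -rmorphM mulrA -exprMn rmorphM rmorphXn rmorphM /= theta_g theta_g' Ugg'.
by rewrite expr1n mul1r.
Qed.

Lemma ideal_weight (I : set U) p : twosided_ideal I ->
  I (theta (Ev s p)) -> I (theta (Ev s ('X * p^`()))).
Proof.
move=> hI Ip; have : I (ad_y (theta (Ev s p))).
  by have [_ _ IL IR] := hI; apply: idealB => //; [apply: (IL) | apply: (IR)].
rewrite (theta_deriv_Ev two_neq0 s2) -rmorphN rmorphM theta_cst.
by apply: ideal_scalar; rewrite ?oppr_eq0.
Qed.

(** Multiply by [v_(-s)^n]. *)
Lemma ideal_monomial (I : set U) r n : twosided_ideal I ->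
  I (theta (Ev s (r *: 'X^n))) -> I (theta (E0 (r * vprod ^+ n))).
Proof.
move=> [_ _ IL _] h; have := IL (theta (v3 (- s) ^+ n)) _ h.
have -> : Ev s (r *: 'X^n) = E0 r * v3 s ^+ n.
  by rewrite -mul_polyC rmorphM rmorphXn /= EvX EvC.
rewrite -rmorphM mulrCA -exprMn (rmorphM theta) (rmorphXn theta) [v3 (- s) * _]mulrC.
by rewrite (theta_v_mulE s2) -(rmorphXn theta) -(rmorphM theta) -(rmorphXn E0) -(rmorphM E0).
Qed.

Section AtAlpha.
Variables (alpha : k) (I : set U).
Hypotheses (hI : twosided_ideal I) (I_Omega : I (Omega lam - alpha%:A)).

Lemma ideal_E0_spec r : I (theta (E0 r) - (r.[alpha])%:A).
Proof.
have [I0 ID IL IR] := hI.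
elim/poly_ind: r => [|r c IH].
  by rewrite horner0 !rmorph0 scale0r subrr.
rewrite hornerMXaddC (rmorphD E0) (rmorphM E0) /= E0X E0C (rmorphD theta) (rmorphM theta).
rewrite theta_Om theta_cst.
rewrite [(_ + c)%:A]scalerDl opprD addrACA subrr addr0.
rewrite [_%:A](_ : _ = (r.[alpha])%:A * alpha%:A); last by rewrite mulr_algl scalerA.
have -> : forall a b c d : U, a * b - c * d = (a - c) * b + c * (b - d).
  by move=> a b c0 d; rewrite mulrBl mulrBr addrA subrK.
by apply: (ID); [apply: (IR) | apply: (IL)].
Qed.

Lemma ideal_Ev_spec p : I (theta (Ev s p) - theta (Ev s (map_poly polyC (spec alpha p)))).
Proof.
have [I0 ID IL IR] := hI.
elim/poly_ind: p => [|p c IH]; first by rewrite /spec !rmorph0 subrr.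
rewrite /spec (rmorphD (map_poly (horner_eval alpha))) (rmorphM (map_poly (horner_eval alpha))) /=.
rewrite map_polyX map_polyC /= -/(spec alpha p).
rewrite (rmorphD (map_poly _)) (rmorphM (map_poly _)) /= map_polyX map_polyC /=.
rewrite !(rmorphD (Ev s)) !(rmorphM (Ev s)) /= !EvX !EvC E0C !(rmorphD theta) opprD addrACA.
apply: (ID); first by rewrite !(rmorphM theta) -mulrBl; apply: (IR).
by rewrite theta_cst; apply: ideal_E0_spec.
Qed.

Lemma ideal_spec0 p : spec alpha p = 0 -> I (theta (Ev s p)).
Proof. by have := ideal_Ev_spec p => /[swap] ->; rewrite !rmorph0 subr0. Qed.

(** [v_s] is a unit modulo [Omega - alpha] when [v_s v_(-s)] has a nonzero
    value there. *)
Lemma ideal_vX n c : vprod.[alpha] != 0 -> I (theta (v3 s ^+ n * c)) -> I (theta c).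
Proof.
move=> va h; have [I0 ID IL IR] := hI.
have := IL (theta (v3 (- s) ^+ n)) _ h.
rewrite -rmorphM mulrA -exprMn (rmorphM theta) (rmorphXn theta) [v3 (- s) * _]mulrC.
rewrite (theta_v_mulE s2) -(rmorphXn theta) -(rmorphXn E0) => h'.
have h2 := IR (theta c) _ (ideal_E0_spec (vprod ^+ n)); rewrite mulrBl in h2.
have := ideal_subr hI h2 h'; apply: ideal_scalar => //.
by rewrite horner_exp expf_neq0.
Qed.

End AtAlpha.

Lemma vprodE alpha : vprod.[alpha] = (alpha - 4 * lam) * (alpha + 4 * lam).
Proof.
by rewrite /vprod -lock hornerD hornerN hornerC hornerXn s2; ring.
Qed.

(** What the sequel uses of a representation on a conic; the function field is
    forgotten. *)
Record conic_rep (alpha : k) (S : nzRingType) (r : {rmorphism U -> S}) : Prop := ConicRep {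
  cr_domain : forall a b : S, a * b = 0 -> a = 0 \/ b = 0;
  cr_Omega : r (Omega lam - alpha%:A) = 0;
  cr_Ev : forall p, r (theta (Ev s p)) = 0 <-> spec alpha p = 0;
  cr_Theta : forall P, r (Theta P) = 0 -> forall i, r (theta P`_i) = 0;
  cr_inv : forall P c, r (Theta P * theta c) = 1 -> r (theta (P`_0 * c)) = 1 }.

Lemma conic_rep_exists alpha : exists (S : nzRingType) (r : {rmorphism U -> S}), conic_rep alpha r.
Proof.
have [S [r [h1 h2 h3 h4 h5]]] := conic_representation two_neq0 lam_neq0 s2 alpha.
by exists S, r; split.
Qed.

Section Kernel.
Variables (alpha : k) (S : nzRingType) (r : {rmorphism U -> S}).
Hypothesis hr : conic_rep alpha r.

Lemma rep_cprime : elementwise_cprime [set u | r u = 0].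
Proof. exact/ker_cprime/(cr_domain hr). Qed.

Lemma rep_v_neq0 : r v != 0.
Proof.
apply/eqP; rewrite -(EvX lam) => /(cr_Ev hr) /eqP.
by rewrite /spec map_polyX polyX_eq0.
Qed.

(** The powers of the Ore variable are independent, so the kernel is generated
    by its intersection with [C]. *)
Lemma rep_Theta_ker (I : set U) : twosided_ideal I ->
  (forall c, r (theta c) = 0 -> I (theta c)) -> forall u, r u = 0 -> I u.
Proof.
move=> hI h u; have [P ->] := Theta_surj u => /(cr_Theta hr) hP.
apply: (@ideal_sum _ _ 'I_(size P)) => // i.
by have [_ _ _ IR] := hI; apply: (IR); apply: h; apply: hP.
Qed.

(** An element of [C] becomes a polynomial in [Omega] and [v_s] after
    multiplication by [g^-1] and [v_s], both units modulo [Omega - alpha].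
    If it lies in the kernel, that polynomial vanishes at [Omega = alpha]. *)
Lemma rep_ker_Omega : alpha != 4 * lam -> alpha != - (4 * lam) ->
  [set u | r u = 0] = ideal_gen [set Omega lam - alpha%:A].
Proof.
move=> a1 a2; have hI := ideal_gen_ideal [set Omega lam - alpha%:A].
have IO : ideal_gen [set Omega lam - alpha%:A] (Omega lam - alpha%:A) by exact: mem_ideal_gen.
apply/seteqP; split; last first.
  apply: ideal_gen_min; first exact: ker_ideal.
  by move=> _ ->; exact: (cr_Omega hr).
apply: rep_Theta_ker => // c hc.
have [M [N [p [e _]]]] := v_form two_neq0 lam_neq0 s2 c.
apply: (ideal_ginv (M := M) hI).
apply: (ideal_vX hI IO (n := N)).
  by rewrite vprodE mulf_neq0 // ?subr_eq0 // addr_eq0.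
rewrite mulrCA mulrA e; apply: (ideal_spec0 hI IO).
by apply/(cr_Ev hr); rewrite -e rmorphM rmorphM hc mulr0.
Qed.

End Kernel.

(** At [Omega = - 4 lam e] the product [v_s v_(-s)] vanishes.  The
    representation keeps [v_s] nonzero and so kills the factor [chi3 s e] of
    [Omega + 4 lam e], because the other factor divides [v_s].  Conversely
    [chi3 s e] divides [v_(-s)] and [Omega + 4 lam e], and modulo these two,
    elements of [C] are, up to powers of [g^-1], polynomials in [v_s]. *)
Lemma rep_ker_chi e (S : nzRingType) (r : {rmorphism U -> S}) : e ^+ 2 = 1 ->
  conic_rep (- (4 * lam * e)) r ->
  [set u | r u = 0] = ideal_gen [set theta (chi3 s e)].
Proof.
move=> e2 hr; set alpha := - _ in hr; set chi := theta (chi3 s e).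
have hI := ideal_gen_ideal [set chi].
have Ichi : ideal_gen [set chi] chi by exact: mem_ideal_gen.
have [I0 ID IL IR] := hI.
have OE : Omega lam - alpha%:A = U_ginv * (chi * theta (chi3 (- s) e)).
  rewrite -theta_g' -!rmorphM -(theta_Om_chi s2 e2) rmorphD theta_Om theta_cst.
  by congr (_ + _); rewrite /alpha scaleNr opprK s2; congr (_ *: _); ring.
have vE := theta_v_chi lam s e2.
have IO : ideal_gen [set chi] (Omega lam - alpha%:A) by rewrite OE; apply: (IL); apply: (IR).
have Iv' : ideal_gen [set chi] v' by rewrite vE !rmorphM; apply: (IL); apply: (IR).
have rchi : r chi = 0.
  have := cr_Omega hr; rewrite OE rmorphM => /(cr_domain hr) [].
    move/(congr1 (fun t => r U_g * t)); rewrite -rmorphM Ugg' rmorph1 mulr0 => /eqP.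
    by rewrite oner_eq0.
  rewrite rmorphM => /(cr_domain hr) [//|h].
  have := rep_v_neq0 hr; have := theta_v_chi lam (- s) e2; rewrite opprK => ->.
  by rewrite !rmorphM h mul0r mulr0 eqxx.
apply/seteqP; split; last first.
  by apply: ideal_gen_min; [exact: ker_ideal | move=> _ ->].
apply: (rep_Theta_ker hr) => // c hc.
have [M [p1 [p2 h]]] := localized_graded_form two_neq0 lam_neq0 s2 c.
apply: (ideal_ginv (M := M) hI).
rewrite h rmorphD; apply: (ID); last by rewrite rmorphM; apply: (IR).
apply: (ideal_spec0 hI IO); apply/(cr_Ev hr).
have : r (theta (Cg' ^+ M * c)) = 0 by rewrite rmorphM rmorphM hc mulr0.
rewrite h rmorphD rmorphD => <-; rewrite rmorphM rmorphM.
suff -> : r v' = 0 by rewrite mul0r addr0.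
by rewrite vE !rmorphM rchi mul0r mulr0.
Qed.

(** The polynomial [R] is the leading coefficient in [v_s] of the normal form
    of some coefficient of [u]. *)
Lemma generic_nonzero (u : U) : u != 0 -> exists2 R : T, R != 0 &
  forall alpha (S : nzRingType) (r : {rmorphism U -> S}), conic_rep alpha r ->
    R.[alpha] != 0 -> r u != 0.
Proof.
have [P ->] := Theta_surj u => P0.
have [i ti] : exists i, theta P`_i != 0.
  apply: contrapT => /forallNP h; move/eqP: P0; apply.
  by apply: big1 => i _; have /negP/negPn/eqP -> := h (i : nat); rewrite mul0r.
have [M [N [p [e hp]]]] := v_form two_neq0 lam_neq0 s2 P`_i.
have p0 : p != 0 by apply/eqP => /hp h; rewrite h eqxx in ti.
exists (lead_coef p); first by rewrite lead_coef_eq0.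
move=> alpha S r hr pa; apply/eqP => /(cr_Theta hr) /(_ i) h.
have : r (theta (Ev s p)) = 0 by rewrite -e rmorphM rmorphM h mulr0.
move/(cr_Ev hr)/(congr1 (fun q : T => q`_(size p).-1)); rewrite coef0 coef_map /=.
by move/eqP; rewrite /horner_eval (negPf pa).
Qed.

Lemma generic_point (R : T) : R != 0 -> exists alpha, R.[alpha] != 0.
Proof. by move=> /closed_nonrootP [a]; exists a. Qed.

Lemma frakU_domain (a b : U) : a * b = 0 -> a = 0 \/ b = 0.
Proof.
move=> ab; have [->|a0] := eqVneq a 0; first by left.
have [->|b0] := eqVneq b 0; first by right.
have [Ra Ra0 ha] := generic_nonzero a0; have [Rb Rb0 hb] := generic_nonzero b0.
have [alpha] := generic_point (mulf_neq0 Ra0 Rb0).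
rewrite hornerM mulf_eq0 => /norP [h1 h2].
have [S [r hr]] := conic_rep_exists alpha.
have : r (a * b) = 0 by rewrite ab rmorph0.
rewrite rmorphM => /(cr_domain hr) [] /eqP h.
  by have := ha _ _ _ hr h1; rewrite h.
by have := hb _ _ _ hr h2; rewrite h.
Qed.

Lemma zero_cprime : elementwise_cprime [set 0 : U].
Proof.
split; first exact: zero_ideal; first by apply/eqP; rewrite oner_eq0.
by move=> a b; apply: frakU_domain.
Qed.

Lemma Theta_zero P : Theta P = 0 -> forall i, theta P`_i = 0.
Proof.
move=> h i; have [//|/generic_nonzero [R /generic_point [alpha ha] hR]] := eqVneq (theta P`_i) 0.
have [S [r hr]] := conic_rep_exists alpha.
have := hR _ _ _ hr ha; have -> : r (theta P`_i) = 0; last by rewrite eqxx.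
by apply: (cr_Theta hr); rewrite h rmorph0.
Qed.

Lemma v_neq0 : v != 0.
Proof.
have [S [r hr]] := conic_rep_exists 0; apply/eqP => h.
by have := rep_v_neq0 hr; rewrite h rmorph0 eqxx.
Qed.

(** * Descent to the commutative part *)

Lemma ad_y_v : U_y * v - v * U_y = - (s%:A * v).
Proof.
by rewrite -[LHS]/(ad_y v) (theta_deriv_v two_neq0 s2) mulNr rmorphN rmorphM theta_cst.
Qed.

(** Commuting past [v_s] substitutes [y - s] for [y].  So the commutator is
    [v_s] times a difference, whose leading coefficient is [- n s] times that
    of [P], where [n] is the degree of [P] in [y]. *)
Lemma Theta_comm_v P : exists Q, Theta P * v - v * Theta P = v * Theta Q /\
  forall n, (size P <= n.+1)%N -> (size Q <= n)%N /\
    (if n is n'.+1 then Q`_n' = - (n%:R * cst k s * P`_n) else True).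
Proof.
have yv : U_y * v = v * (U_y - s%:A).
  by rewrite mulrBr -(subrK (v * U_y) (U_y * v)) ad_y_v scalar_comm addrC.
elim/poly_ind: P => [|P c [Q [e hQ]]].
  exists 0; rewrite /Theta size_poly0 !big_ord0 mul0r !mulr0 subrr; split=> //.
  by move=> [|n] _; rewrite ?coef0 ?mulr0 ?oppr0.
exists (Q * 'X - cst k s *: (P + Q)); split.
  rewrite ThetaB Theta_scale !ThetaD !ThetaMX ThetaC theta_cst.
  move: e; move: (Theta P) (Theta Q) => A B e.
  have e2 : A * U_y * v = v * (A + B) * (U_y - s%:A).
    by rewrite -mulrA yv mulrA [v * (A + B)]mulrDr -e [v * A + _]addrC subrK.
  rewrite mulrDl mulrDr opprD addrACA (theta_comm lam c (v3 s)) subrr addr0 e2.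
  rewrite -!mulrA -mulrBr; congr (_ * _).
  by rewrite mulrBr mulrDl scalar_comm addrAC [A * _ + _]addrC addrK.
move=> n szP; have {}szP : (size P <= n)%N.
  have [P0|P0] := eqVneq (P : {poly C}) 0.
    by rewrite P0 (size_poly0 C).
  by move: szP; rewrite size_MXaddC (negPf P0).
case: n szP => [|n] szP.
  have [szQ _] := hQ 0%N (leqW szP).
  move: szP szQ; rewrite !size_poly_leq0 => /eqP -> /eqP ->.
  by rewrite mul0r addr0 scaler0 subr0 eqxx.
have [szQ cQ] := hQ n szP; split.
  apply: leq_trans (size_polyD _ _) _; rewrite size_polyN geq_max; apply/andP; split.
    by have [->|Q0] := eqVneq Q 0; rewrite ?mul0r ?size_poly0 // size_mulX.
  apply: leq_trans (size_scale_leq _ _) _.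
  by apply: leq_trans (size_polyD _ _) _; rewrite geq_max szP leqW.
rewrite !coefB coefZ !coefD !coefMX coefC /= addr0 [Q`_n]nth_default // addr0.
case: n {szP szQ} cQ => [_|n ->] /=; first by rewrite sub0r mul1r.
by rewrite -[n.+2%:R]natr1; ring.
Qed.

Lemma Theta_split (P : {poly C}) n : (size P <= n.+1)%N -> exists2 P' : {poly C}, (size P' <= n)%N &
  Theta P = Theta P' + theta P`_n * U_y ^+ n.
Proof.
move=> szP; exists (P - P`_n *: 'X^n).
  apply/leq_sizeP => j; rewrite leq_eqVlt coefB coefZ coefXn => /orP[/eqP->|nj].
    by rewrite eqxx mulr1 subrr.
  by rewrite nth_default ?(leq_trans szP) // gtn_eqF // mulr0 subrr.
have -> : theta P`_n * U_y ^+ n = Theta (P`_n *: 'X^n).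
  rewrite Theta_scale; congr (_ * _).
  elim: n {szP} => [|n IH]; first by rewrite !expr0 ThetaC rmorph1.
  by rewrite exprSr IH exprSr ThetaMX.
by rewrite ThetaB subrK.
Qed.

(** Take an element of [I] outside [p], of least degree in [y].  Its commutator
    with [v_s] has lower degree.  If the commutator is outside [p], it is a
    smaller choice; if it lies in [p], so does the leading coefficient of the
    element, which can be dropped.  Only degree 0 remains. *)
Lemma descent (p I : set U) : elementwise_cprime p ->
  (forall P, p (Theta P) -> forall i, p (theta P`_i)) -> ~ p v ->
  twosided_ideal I -> p `<=` I -> ~ I `<=` p ->
  exists2 c, I (theta c) & ~ p (theta c).
Proof.
move=> [hp p1 pM] pT pv hI pI; have [I0 ID IL IR] := hI; have [p0 pD pL pR] := hp.
move=> /existsNP [u /not_implyP []].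
have [P ->] := Theta_surj u.
have [n] := ubnP (size P); elim: n P => // n IH P; rewrite ltnS => szP IP nP.
case: n IH szP => [|n] IH szP.
  by move: szP nP; rewrite size_poly_leq0 => /eqP ->; rewrite /Theta size_poly0 big_ord0.
have [Q [e hQ]] := Theta_comm_v P; have [szQ cQ] := hQ n szP.
have IQ : I (Theta (v3 s *: Q)).
  by rewrite Theta_scale -e; apply: idealB => //; [apply: (IR) | apply: (IL)].
have szQ' : (size (v3 s *: Q) <= n)%N by apply: leq_trans (size_scale_leq _ _) szQ.
have [pQ|npQ] := pselect (p (Theta Q)); last first.
  apply: (IH (v3 s *: Q)) => //.
  by rewrite Theta_scale => /pM [].
case: n cQ szP IH {szQ szQ' hQ} => [_|n cQ] szP IH.
  move: IP nP; rewrite (size1_polyC szP) ThetaC => IP nP.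
  by exists P`_0.
have pc : p (theta P`_n.+1).
  have := pT _ pQ n; rewrite cQ => /(idealN hp); rewrite -rmorphN opprK -mulrA rmorphM.
  have -> : theta n.+1%:R = (n.+1%:R : k)%:A by rewrite rmorph_nat scaler_nat.
  move=> /(ideal_scalar hp (char0 n)); rewrite rmorphM theta_cst.
  exact: (ideal_scalar hp s0).
have [P' szP' eP] := Theta_split szP.
have pc' : p (theta P`_n.+1 * U_y ^+ n.+1) by apply: pR.
apply: (IH P') => //.
  have -> : Theta P' = Theta P - theta P`_n.+1 * U_y ^+ n.+1 by rewrite eP addrK.
  by apply: idealB => //; apply: pI.
by move=> h; apply: nP; rewrite eP; apply: pD.
Qed.

(** * Ideals and the centre *)

Lemma nonzero_ideal_E0 (I : set U) : twosided_ideal I -> I <> [set 0] ->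
  exists2 R : T, R != 0 & I (theta (E0 R)).
Proof.
move=> hI nI; have [I0 ID IL IR] := hI.
have [||||c Ic nc] := @descent [set 0] I zero_cprime _ _ hI.
- exact: Theta_zero.
- by apply/eqP; exact: v_neq0.
- by move=> _ ->.
- by move=> h; apply: nI; apply/seteqP; split=> // _ ->.
have [M [N [p [e hp]]]] := v_form two_neq0 lam_neq0 s2 c.
have p0 : p != 0 by apply/eqP => /hp.
have Ip : I (theta (Ev s p)) by rewrite -e rmorphM; apply: (IL).
have [||r [n [r0 hr]]] := @euler_monomial _ (fun q => I (theta (Ev s q))) char0_poly _ _ p Ip p0.
- by move=> q q' Iq Iq'; rewrite (rmorphB (Ev s)) rmorphB; apply: idealB.
- by move=> q; apply: ideal_weight.
exists (r * vprod ^+ n); last exact: ideal_monomial.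
by rewrite mulf_neq0 // expf_neq0 // vprod_neq0.
Qed.

(** On the conic [Omega = alpha] with [R] nonzero at [alpha], the image is a
    nonzero scalar. *)
Lemma E0_neq0 (R : T) : R != 0 -> theta (E0 R) != 0.
Proof.
move=> /generic_point [alpha ha]; have [S [r hr]] := conic_rep_exists alpha.
have [hK K1 _] := rep_cprime hr.
apply/eqP => h; have := ideal_E0_spec hK (cr_Omega hr) R; rewrite h sub0r.
move/(idealN hK); rewrite opprK /= => e; apply: K1.
by apply: (ideal_scalar hK ha); rewrite mulr1.
Qed.

Lemma E0_central (R : T) u : GRing.comm (theta (E0 R)) u.
Proof.
elim/poly_ind: R => [|R c IH]; first by rewrite !rmorph0; apply/commr_sym/commr0.
rewrite rmorphD rmorphM /= E0X E0C (rmorphD theta) (rmorphM theta) theta_Om theta_cst.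
apply/commr_sym/commrD; last exact: scalar_comm.
by apply: commrM; apply/commr_sym => //; exact: (Omega_central two_neq0 s2).
Qed.

Lemma ideal_meets_center (I : set U) : twosided_ideal I -> I <> [set 0] ->
  I `&` center U <> [set 0].
Proof.
move=> hI /(nonzero_ideal_E0 hI) [R R0 IR] e.
have : (I `&` center U) (theta (E0 R)) by split=> //; exact: E0_central.
by rewrite e /= => h; have := E0_neq0 R0; rewrite h eqxx.
Qed.

(** The linear factors of a polynomial in [Omega] are central, so a prime
    ideal containing the product contains one of them. *)
Lemma prime_Omega (P : set U) : prime_ideal P -> P <> [set 0] ->
  exists alpha, P (Omega lam - alpha%:A).
Proof.
move=> pP nP; have [[hP nT] _] := pP; have [R R0 PR] := nonzero_ideal_E0 hP nP.
have [rs e] := closed_field_poly_normal R.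
have lc0 : lead_coef R != 0 by rewrite lead_coef_eq0.
have {PR} : P (theta (E0 (\prod_(z <- rs) ('X - z%:P)))).
  move: PR; rewrite {1}e -mul_polyC (rmorphM E0) (rmorphM theta) E0C theta_cst.
  exact: ideal_scalar.
elim: rs {e} => [|z rs IH].
  by rewrite big_nil !rmorph1 => /(proper_ideal1 (conj hP nT)).
rewrite big_cons (rmorphM E0) (rmorphM theta) => /(prime_normal pP) [|h|//].
- by move=> u; exists u; rewrite E0_central.
- by exists z; move: h; rewrite rmorphB /= E0X E0C rmorphB theta_Om theta_cst.
Qed.

(** By [descent] the ideal contains a new element of [C], hence a polynomial in
    [v_s] that is nonzero on the conic, and the Euler operator reduces it to a
    monomial. *)
Lemma above_kernel_v (alpha : k) (S : nzRingType) (r : {rmorphism U -> S}) (I : set U) :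
  conic_rep alpha r -> twosided_ideal I -> [set u | r u = 0] `<=` I ->
  ~ I `<=` [set u | r u = 0] -> exists n, I (v ^+ n).
Proof.
move=> hr hI KI nIK; have [I0 ID IL IR] := hI.
have cK := rep_cprime hr; have [hK K1 KM] := cK.
have nv : ~ [set u | r u = 0] v by move=> /= h; have := rep_v_neq0 hr; rewrite h eqxx.
have [c Ic nc] := descent cK (cr_Theta hr) nv hI KI nIK.
have [M [N [p [e _]]]] := v_form two_neq0 lam_neq0 s2 c.
have sp0 : spec alpha p != 0.
  apply/eqP => /(cr_Ev hr); rewrite -e !rmorphM !rmorphXn /= theta_g' => /(cr_domain hr) [|//].
  move=> /(cr_domain hr) [] h; apply: K1.
    have e1 : U_g ^+ M * U_ginv ^+ M = 1 :> U.
      by rewrite -exprMn_comm ?Ugg' ?expr1n // /GRing.comm Ugg' Ug'g.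
    by rewrite /= -e1 rmorphM !rmorphXn /= h mulr0.
  exfalso; elim: N {e} h => [|N IH]; first by rewrite expr0 => /eqP; rewrite oner_eq0.
  by rewrite exprS => /(cr_domain hr) [].
have Ip : I (theta (Ev s (map_poly polyC (spec alpha p)))).
  apply: (ideal_subr hI (ideal_Ev_spec hI (KI _ (cr_Omega hr)) p)).
  by rewrite -e rmorphM; apply: (IL).
have [||a [n [a0 ha]]] := @euler_monomial _ (fun q => I (theta (Ev s (map_poly polyC q)))) char0 _ _ _ Ip sp0.
- by move=> q q' Iq Iq'; rewrite (rmorphB (map_poly _)) (rmorphB (Ev s)) rmorphB; apply: idealB.
- move=> q /(ideal_weight hI); rewrite (rmorphM (map_poly _)) /= map_polyX.
  by rewrite deriv_map.
exists n; move: ha; rewrite -mul_polyC (rmorphM (map_poly _)) /= map_polyC rmorphXn /= map_polyX.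
rewrite (rmorphM (Ev s)) rmorphXn /= EvX EvC E0C rmorphM theta_cst rmorphXn.
exact: ideal_scalar.
Qed.

Lemma normal_v : normal_element v.
Proof. exact: (normal_theta (theta_deriv_v two_neq0 s2)). Qed.

Lemma Omega_maximal alpha : alpha != 4 * lam -> alpha != - (4 * lam) ->
  maximal_ideal (ideal_gen [set Omega lam - alpha%:A]).
Proof.
move=> a1 a2; have [S [r hr]] := conic_rep_exists alpha.
rewrite -(rep_ker_Omega hr a1 a2); have [hK K1 KM] := rep_cprime hr.
split; first exact: (proper_ideal_of hK K1).
move=> J pJ KJ; apply/seteqP; split=> //; apply: contrapT => nJK.
have [hJ _] := pJ; have [n] := above_kernel_v hr hJ KJ nJK.
rewrite -rmorphXn -[X in theta X]mulr1; move/(ideal_vX hJ (KJ _ (cr_Omega hr))).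
rewrite vprodE mulf_neq0 ?subr_eq0 ?addr_eq0 // => /(_ isT).
by rewrite rmorph1; apply: proper_ideal1.
Qed.

Lemma four_s2_neq0 : 4 * s ^+ 2 != 0.
Proof. by rewrite mulf_neq0 ?expf_neq0 // (natrM _ 2 2) mulf_neq0 ?two_neq0. Qed.

(** Modulo [v_s], [v_(-s)] and [Omega + 4 lam e], the expression of [g^-1] in
    these elements forces [g^-1 = e]. *)
Lemma ginv_conic e : (4 * s ^+ 2)%:A * (U_ginv - e%:A) =
  v + v' - (Omega lam + (4 * lam * e)%:A) - (Omega lam + (4 * lam * e)%:A).
Proof.
rewrite -rmorphD (theta_v_sum s2) rmorphD !(rmorphM theta) theta_Om theta_g'.
rewrite rmorph_nat theta_cst [2 * Omega lam]mulr_natl mulr2n mulrBr.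
have -> : forall a b c : U, a + a + c - (a + b) - (a + b) = c - (b + b).
  by move=> a b c; rewrite -addrA -opprD (addrACA a b) opprD addrACA subrr add0r.
congr (_ - _); rewrite mulr_algl scalerA -scalerDl; congr (_ *: _).
by rewrite s2; ring.
Qed.

(** The line [chi3 s e = 0] has the coordinate [v_s], so an ideal strictly above
    contains a power of [v_s]; by normality a prime contains [v_s] itself, and
    the point [v_s = 0] of the line is [g = e], [x = 0]. *)
Lemma above_chi e (I : set U) : e ^+ 2 = 1 -> prime_ideal I ->
  ideal_gen [set theta (chi3 s e)] `<=` I -> I <> ideal_gen [set theta (chi3 s e)] ->
  I U_x /\ I (U_g - e%:A).
Proof.
move=> e2 pI KI nIK; have [[hI _] _] := pI; have [I0 ID IL IR] := hI.
have [S [r hr]] := conic_rep_exists (- (4 * lam * e)).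
have K := rep_ker_chi e2 hr.
have [n] : exists n, I (v ^+ n).
  apply: (above_kernel_v hr hI); rewrite K // => IK.
  by apply: nIK; apply/seteqP; split.
move=> /(prime_normalX pI normal_v) Iv.
have Ichi : I (theta (chi3 s e)) by apply: KI; apply: mem_ideal_gen.
have Iv' : I v'.
  by rewrite (theta_v_chi lam s e2) !rmorphM; apply: (IL); apply: (IR).
have IO : I (Omega lam + (4 * lam * e)%:A).
  have := cr_Omega hr; rewrite -[_ = 0]/([set u | r u = 0] _) K scaleNr opprK.
  exact: KI.
have Ig' : I (U_ginv - e%:A).
  apply: (ideal_scalar hI four_s2_neq0); rewrite ginv_conic.
  by apply: idealB => //; apply: idealB => //; apply: (ID).
have Ig : I (U_g - e%:A).
  have -> : (U_g : U) - e%:A = - (e%:A * U_g * (U_ginv - e%:A)).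
    rewrite mulrBr -(mulrA e%:A) Ugg' mulr1 -mulrA [U_g * _]scalar_comm mulrA opprB.
    by rewrite [_ * e%:A]mulr_algl scalerA -expr2 e2 scale1r mul1r.
  by apply: idealN => //; apply: (IL).
split=> //.
have -> : (U_x : U) = theta (chi3 s e) + (s * e)%:A * (U_g - e%:A).
  rewrite /chi3 rmorphB (rmorphM theta) (rmorphB theta) (rmorphM theta) rmorph1 !theta_cst.
  rewrite theta_x theta_g !mulr_algl.
  by rewrite !scalerBr !scalerA -mulrA -expr2 e2 mulr1 subrK.
by apply: (ID) => //; apply: (IL).
Qed.

End SquareRoot.
End Ideals.

(** * Classification of the prime ideals *)

Section Classification.
Variables (k : closedFieldType) (lam : k).
Hypotheses (char0 : forall n, n.+1%:R != 0 :> k) (lam_neq0 : lam != 0).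
Local Notation U := (frakU lam).
Local Notation g := (U_g : U).
Local Notation g' := (U_ginv : U).
Local Notation x := (U_x : U).
Local Notation y := (U_y : U).
Local Notation theta := (theta lam).

(** The four elements [phi_(+-)], [psi_(+-)] are treated at once: [t] runs over
    the square roots of [2 lam], and [e] over the signs. *)
Definition chi (t e : k) : U := x - t *: (e *: g - 1).
Definition chi_ideal t e : set U := ideal_gen [set chi t e].
Definition Omega_ideal alpha : set U := ideal_gen [set Omega lam - alpha%:A].
Definition line_ideal e : set U := ideal_gen [set x; g - e%:A].
Definition point_ideal e gamma : set U := ideal_gen [set x; g - e%:A; y - gamma%:A].

Lemma theta_chi t e : theta (chi3 t e) = chi t e.
Proof.
rewrite /chi3 rmorphB (rmorphM theta) (rmorphB theta) (rmorphM theta) rmorph1 !theta_cst.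
by rewrite theta_x theta_g !mulr_algl.
Qed.

(** ** The quotients of the form k[y] *)

Section Line.
Variable e : k.
Hypothesis e2 : e ^+ 2 = 1.

Let polyC_central (c : k) (p : {poly k}) : GRing.comm c%:P p.
Proof. by apply: mulrC. Qed.

Lemma ee : e * e = 1. Proof. by rewrite -expr2. Qed.

Lemma line_character : exists r : {rmorphism U -> {poly k}},
  [/\ r g = e%:P, r g' = e%:P, r x = 0, r y = 'X & forall c, r c%:A = c%:P].
Proof.
have [| | | | |r hr] := @frakU_universal k lam {poly k} (@polyC k) e%:P e%:P 0 'X polyC_central;
  last by exists r.
- by rewrite -polyCM ee.
- by rewrite -polyCM ee.
- by rewrite mulr0 mul0r.
- by rewrite addr0 mulrAC -polyCM ee mul1r.
- by rewrite mulr0 mul0r subrr expr0n mulr0 -polyC_exp e2 subrr mulr0 oppr0 addr0.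
Qed.

Lemma line_x : line_ideal e x. Proof. by apply: mem_ideal_gen; left. Qed.
Lemma line_g : line_ideal e (g - e%:A). Proof. by apply: mem_ideal_gen; right. Qed.

Lemma ginv_sub : g' - e%:A = - (e%:A * g' * (g - e%:A)).
Proof.
rewrite mulrBr -(mulrA e%:A) Ug'g mulr1 -mulrA [g' * _]scalar_comm mulrA opprB.
by rewrite [_ * e%:A]mulr_algl scalerA ee scale1r mul1r.
Qed.

Lemma line_form (I : set U) : twosided_ideal I -> I x -> I (g - e%:A) ->
  forall u, exists f : {poly k}, I (u - horner_alg y f).
Proof.
move=> hI Ix Ig; have [I0 ID IL IR] := hI.
apply: frakU_ind => [c|a b [f hf] [f' hf']|a b [f hf] [f' hf']||||].
- by exists c%:P; rewrite horner_algC subrr.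
- by exists (f + f'); rewrite rmorphD opprD addrACA; apply: (ID).
- exists (f * f'); rewrite rmorphM.
  have -> : a * b - horner_alg y f * horner_alg y f' =
      (a - horner_alg y f) * b + horner_alg y f * (b - horner_alg y f').
    by rewrite mulrBl mulrBr addrA subrK.
  by apply: (ID); [apply: (IR) | apply: (IL)].
- by exists e%:P; rewrite horner_algC.
- exists e%:P; rewrite horner_algC ginv_sub; apply: idealN => //; exact: (IL).
- by exists 0; rewrite rmorph0 subr0.
- by exists 'X; rewrite horner_algX subrr.
Qed.

Lemma horner_y_comm f f' : GRing.comm (horner_alg y f) (horner_alg y f').
Proof. by rewrite /GRing.comm -!rmorphM mulrC. Qed.

Section Character.
Variable r : {rmorphism U -> {poly k}}.
Hypothesis hr : [/\ r g = e%:P, r g' = e%:P, r x = 0, r y = 'X & forall c, r c%:A = c%:P].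

Lemma line_character_horner f : r (horner_alg y f) = f.
Proof.
have [_ _ _ hy hc] := hr.
elim/poly_ind: f => [|f c IH]; first by rewrite !rmorph0.
rewrite (rmorphD (horner_alg y)) (rmorphM (horner_alg y)) /= horner_algX horner_algC.
by rewrite rmorphD (rmorphM r) IH /= hy hc.
Qed.

Lemma line_ker : [set u | r u = 0] = line_ideal e.
Proof.
have [hg hg' hx hy hc] := hr; have hI := ideal_gen_ideal [set x; g - e%:A].
apply/seteqP; split=> [u /= hu|]; last first.
  apply: ideal_gen_min; first exact: ker_ideal.
  by move=> _ [->|->] //=; rewrite rmorphB /= hg hc subrr.
have [f hf] := line_form hI line_x line_g u.
suff f0 : f = 0 by move: hf; rewrite f0 rmorph0 subr0.
have : [set u | r u = 0] (u - horner_alg y f).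
  apply: (@ideal_gen_min _ [set x; g - e%:A] _ (ker_ideal r)) hf.
  by move=> _ [->|->] //=; rewrite rmorphB /= hg hc subrr.
by rewrite /= rmorphB /= hu line_character_horner sub0r => /eqP; rewrite oppr_eq0 => /eqP.
Qed.

End Character.

Lemma line_cprime : elementwise_cprime (line_ideal e).
Proof.
have [r hr] := line_character; rewrite -(line_ker hr); apply: ker_cprime.
by move=> p q /eqP; rewrite mulf_eq0 => /orP[] /eqP; [left | right].
Qed.

Lemma line_ideal_min (I : set U) : twosided_ideal I -> I x -> I (g - e%:A) ->
  line_ideal e `<=` I.
Proof. by move=> hI Ix Ig; apply: ideal_gen_min => // _ [->|->]. Qed.

Section Point.
Variable gamma : k.

Lemma point_x : point_ideal e gamma x. Proof. by apply: mem_ideal_gen; left; left. Qed.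
Lemma point_g : point_ideal e gamma (g - e%:A). Proof. by apply: mem_ideal_gen; left; right. Qed.
Lemma point_y : point_ideal e gamma (y - gamma%:A). Proof. by apply: mem_ideal_gen; right. Qed.

Lemma point_ideal_min (I : set U) : twosided_ideal I -> I x -> I (g - e%:A) ->
  I (y - gamma%:A) -> point_ideal e gamma `<=` I.
Proof. by move=> hI Ix Ig Iy; apply: ideal_gen_min => // _ [[->|->]|->]. Qed.

Lemma point_character : exists r : {rmorphism U -> k},
  [/\ forall c, r c%:A = c & [set u | r u = 0] = point_ideal e gamma].
Proof.
have [r0 hr0] := line_character; have [hg hg' hx hy hc] := hr0.
pose r : {rmorphism U -> k} := horner_eval gamma \o r0.
have hrc c : r c%:A = c by rewrite /r /= hc /horner_eval hornerC.
have hI := ideal_gen_ideal [set x; g - e%:A; y - gamma%:A].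
have [I0 ID IL IR] := hI.
exists r; split=> //; apply/seteqP; split=> [u /= hu|]; last first.
  apply: ideal_gen_min; first exact: ker_ideal.
  move=> _ [[->|->]|->] /=; rewrite /horner_eval.
  - by rewrite hx horner0.
  - by rewrite rmorphB /= hg hc subrr horner0.
  - by rewrite rmorphB /= hy hc !hornerE subrr.
have [f hf] := line_form hI point_x point_g u.
have lf : line_ideal e (u - horner_alg y (r0 u)).
  by rewrite -(line_ker hr0) /= rmorphB /= (line_character_horner hr0) subrr.
have : point_ideal e gamma (u - horner_alg y (r0 u)).
  by apply: (line_ideal_min hI point_x point_g).
move=> h; apply: (ideal_subl hI h).
have /factor_theorem [q ->] : root (r0 u) gamma by apply/eqP.
by rewrite rmorphM /= rmorphB /= horner_algX horner_algC; apply: (IL); exact: point_y.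
Qed.

Lemma point_cprime : elementwise_cprime (point_ideal e gamma).
Proof.
have [r [_ <-]] := point_character; apply: ker_cprime.
by move=> p q /eqP; rewrite mulf_eq0 => /orP[] /eqP; [left | right].
Qed.

Lemma point_maximal : maximal_ideal (point_ideal e gamma).
Proof.
have [hP P1 _] := point_cprime; split; first exact: proper_ideal_of.
move=> J pJ PJ; apply/seteqP; split=> //; apply: contrapT.
move=> /existsNP [u /not_implyP [Ju nPu]]; have [hJ _] := pJ.
have [r [hc K]] := point_character.
have ru : r u != 0 by apply/eqP => ru; apply: nPu; rewrite -K.
have : J (u - (r u)%:A) by apply: PJ; rewrite -K /= rmorphB /= hc subrr.
move=> /(ideal_subr hJ) /(_ Ju); rewrite -(mulr1 (r u)%:A) => /(ideal_scalar hJ ru).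
exact: proper_ideal1.
Qed.

Lemma line_neq_point : line_ideal e <> point_ideal e gamma.
Proof.
have [r hr] := line_character; have [_ _ _ hy hc] := hr.
move=> h; have := point_y; rewrite -h -(line_ker hr) /= rmorphB /= hy hc => /eqP.
by rewrite polyXsubC_eq0.
Qed.

Lemma line_sub_point : line_ideal e `<=` point_ideal e gamma.
Proof. exact: (line_ideal_min (ideal_gen_ideal _) point_x point_g). Qed.

End Point.

(** The quotient by the line is [k[y]] and the field is algebraically closed,
    so a prime that is strictly larger contains some [y - gamma]. *)
Lemma prime_above_line (I : set U) : prime_ideal I -> I x -> I (g - e%:A) ->
  I = line_ideal e \/ exists gamma, I = point_ideal e gamma.
Proof.
move=> pI Ix Ig; have [[hI _] _] := pI; have [I0 ID IL IR] := hI.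
have LI := line_ideal_min hI Ix Ig.
have [IL'|/existsNP [u /not_implyP [Iu nLu]]] := pselect (I `<=` line_ideal e).
  by left; apply/seteqP.
right; have [r hr] := line_character.
have hor : I (horner_alg y (r u)).
  apply: (ideal_subr hI _ Iu); apply: LI.
  by rewrite -(line_ker hr) /= rmorphB /= (line_character_horner hr) subrr.
have ru : r u != 0 by apply/eqP => ru; apply: nLu; rewrite -(line_ker hr).
have mulI f b : I (horner_alg y f * b) -> I (horner_alg y f) \/ I b.
  move=> Ifb; apply: (prime_elementwise pI) => w.
  have [h hw] := line_form hI Ix Ig w.
  have -> : horner_alg y f * w * b =
     horner_alg y f * (w - horner_alg y h) * b + horner_alg y h * (horner_alg y f * b).
    by rewrite [in RHS]mulrA (horner_y_comm h) -mulrDl -mulrDr subrK.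
  by apply: (ID); [apply: (IR); apply: (IL) | apply: (IL)].
have [gamma Ig'] : exists gamma, I (y - gamma%:A).
  have [rs e0] := closed_field_poly_normal (r u).
  have lc0 : lead_coef (r u) != 0 by rewrite lead_coef_eq0.
  move: hor; rewrite e0 -mul_polyC rmorphM /= horner_algC.
  move/(ideal_scalar hI lc0); elim: rs {e0} => [|z rs IH].
    by rewrite big_nil rmorph1 => /proper_ideal1; case: pI.
  rewrite big_cons rmorphM => /mulI [h|//]; exists z.
  by move: h; rewrite rmorphB /= horner_algX horner_algC.
exists gamma; have [pI' _] := pI.
by have [_ mP] := point_maximal gamma; apply: mP => //; apply: point_ideal_min.
Qed.

End Line.

(** ** Primes over a conic *)

Section SquareRoot.
Variable s : k.
Hypothesis s2 : s ^+ 2 = 2 * lam.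

Lemma chi_cprime t e : t ^+ 2 = 2 * lam -> e ^+ 2 = 1 -> elementwise_cprime (chi_ideal t e).
Proof.
move=> t2 e2; have [S [r hr]] := conic_rep_exists char0 lam_neq0 t2 (- (4 * lam * e)).
have := rep_ker_chi char0 lam_neq0 t2 e2 hr; rewrite theta_chi /chi_ideal => <-.
exact: (rep_cprime hr).
Qed.

Lemma Omega_cprime alpha : alpha != 4 * lam -> alpha != - (4 * lam) ->
  elementwise_cprime (Omega_ideal alpha).
Proof.
move=> a1 a2; have [S [r hr]] := conic_rep_exists char0 lam_neq0 s2 alpha.
rewrite /Omega_ideal -(rep_ker_Omega char0 lam_neq0 s2 hr a1 a2).
exact: (rep_cprime hr).
Qed.

Lemma chi_above t e (I : set U) : t ^+ 2 = 2 * lam -> e ^+ 2 = 1 -> prime_ideal I ->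
  chi_ideal t e `<=` I -> I <> chi_ideal t e ->
  I = line_ideal e \/ exists gamma, I = point_ideal e gamma.
Proof.
rewrite /chi_ideal -theta_chi => t2 e2 pI sub neq.
have [Ix Ig] := above_chi char0 lam_neq0 t2 e2 pI sub neq.
exact: prime_above_line.
Qed.

(** A nonzero prime contains some [Omega - alpha], which generates a maximal
    ideal or is, up to the unit [g^-1], the product of two normal elements
    [chi]. *)
Lemma prime_classification (I : set U) : prime_ideal I ->
  [\/ I = [set 0],
      exists t e, [/\ t ^+ 2 = 2 * lam, e ^+ 2 = 1 & I = chi_ideal t e],
      exists alpha, [/\ alpha != 4 * lam, alpha != - (4 * lam) & I = Omega_ideal alpha]
    | exists e, e ^+ 2 = 1 /\ (I = line_ideal e \/ exists gamma, I = point_ideal e gamma)].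
Proof.
move=> pI; have [[hI nI] _] := pI; have [I0 ID IL IR] := hI.
have [->|I0'] := pselect (I = [set 0]); first exact: Or41.
have [alpha Ia] := prime_Omega char0 lam_neq0 s2 pI I0'.
have [/andP[a1 a2]|a12] := boolP ((alpha != 4 * lam) && (alpha != - (4 * lam))).
  apply: Or43; exists alpha; split=> //.
  have [_ mO] := Omega_maximal char0 lam_neq0 s2 a1 a2.
  by apply: mO => //; apply: ideal_gen_min => // _ ->.
have [e e2 ea] : exists2 e, e ^+ 2 = 1 & alpha = - (4 * lam * e).
  move: a12; rewrite negb_and !negbK => /orP[] /eqP ->.
    by exists (-1); rewrite ?sqrrN ?expr1n // mulrN1 opprK.
  by exists 1; rewrite ?expr1n // mulr1.
have [t t2 It] : exists2 t, t ^+ 2 = 2 * lam & I (theta (chi3 t e)).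
  have : I (theta (chi3 s e) * theta (chi3 (- s) e)).
    have h : Omega lam - alpha%:A = g' * (theta (chi3 s e) * theta (chi3 (- s) e)).
      rewrite -theta_g' -!rmorphM -(theta_Om_chi s2 e2) rmorphD theta_Om theta_cst.
      by congr (_ + _); rewrite ea scaleNr opprK s2; congr (_ *: _); ring.
    by have := IL g _ Ia; rewrite h mulrA Ugg' mul1r.
  move/(prime_normal pI (normal_theta (theta_deriv_chi (two_neq0 char0) s2 e2))) => [].
    by exists s.
  by exists (- s) => //; rewrite sqrrN.
have sub : chi_ideal t e `<=` I.
  by apply: ideal_gen_min => // _ ->; rewrite -theta_chi.
have [Ie|nIe] := pselect (I = chi_ideal t e); first by apply: Or42; exists t, e.
by apply: Or44; exists e; split=> //; exact: chi_above sub nIe.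
Qed.

(** ** Separating the primes *)

(** The character with [x = 0] and [g = - e] takes the value [2 t] on
    [chi t e]. *)
Lemma chi_neq0 t e : t ^+ 2 = 2 * lam -> e ^+ 2 = 1 -> chi_ideal t e <> [set 0].
Proof.
move=> t2 e2 h; have Ne2 : (- e) ^+ 2 = 1 by rewrite sqrrN.
have [r [hg _ hx _ hc]] := line_character Ne2.
have : chi_ideal t e (chi t e) by apply: mem_ideal_gen.
have rchi : r (chi t e) = (2 * t)%:P.
  rewrite /chi -(mulr_algl e) -(mulr_algl t) rmorphB (rmorphM r) rmorphB (rmorphM r).
  rewrite rmorph1 /= hg hx !hc.
  have -> : e%:P * (- e)%:P = -1 :> {poly k} by rewrite -polyCM mulrN ee // polyCN.
  by rewrite polyCM; ring.
rewrite h => chi0; move: rchi; rewrite [chi t e]chi0 rmorph0 => /esym /eqP.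
by rewrite polyC_eq0 mulf_eq0 (negPf (two_neq0 char0)) (negPf (s_neq0 (two_neq0 char0) lam_neq0 t2)).
Qed.

(** The character with [x = 0] and [g = 1] takes the value [- 4 lam] on
    [Omega]. *)
Lemma Omega_neq0 alpha : alpha != - (4 * lam) -> Omega_ideal alpha <> [set 0].
Proof.
move=> a2 h; have [r [hg hg' hx _ hc]] := line_character (expr1n k 2).
have : Omega_ideal alpha (Omega lam - alpha%:A) by apply: mem_ideal_gen.
have rO : r (Omega lam - alpha%:A) = (- (4 * lam) - alpha)%:P.
  rewrite /Omega -(mulr_algl (2 * lam)) !rmorphB (rmorphM r (_ ^+ 2)) (rmorphM r (_%:A)).
  rewrite rmorphXn rmorphD /= hg hg' hx !hc polyCN !polyCM; ring.
rewrite h => O0; move: rO; rewrite [Omega lam - _]O0 rmorph0 => /esym /eqP.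
by rewrite polyC_eq0 subr_eq0 eq_sym (negPf a2).
Qed.

Lemma chi_sub_line t e : e ^+ 2 = 1 -> chi_ideal t e `<=` line_ideal e.
Proof.
move=> e2; have hI := ideal_gen_ideal [set x; g - e%:A]; have [I0 ID IL IR] := hI.
apply: ideal_gen_min => // _ ->.
have -> : chi t e = x - (t * e)%:A * (g - e%:A).
  rewrite /chi mulr_algl -scalerA; congr (_ - _ *: _).
  by rewrite scalerBr scalerA (ee e2) scale1r.
apply: (idealB hI); first exact: line_x.
by apply: (IL); exact: line_g.
Qed.

(** Otherwise [v_s] would vanish in the representation with kernel
    [chi_ideal t e], since it is a combination of [g^-1 - e], [v_(-s)] and
    [Omega + 4 lam e]. *)
Lemma chi_neq_line t e : t ^+ 2 = 2 * lam -> e ^+ 2 = 1 -> chi_ideal t e <> line_ideal e.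
Proof.
move=> t2 e2 h; have [S [r hr]] := conic_rep_exists char0 lam_neq0 t2 (- (4 * lam * e)).
have K := rep_ker_chi char0 lam_neq0 t2 e2 hr.
rewrite theta_chi -/(chi_ideal t e) h in K.
have [hK _ _] := rep_cprime hr; have [K0 KD KL KR] := hK.
have : [set u | r u = 0] (g' - e%:A).
  by rewrite (ginv_sub e2); apply: (idealN hK); apply: (KL); rewrite K; exact: line_g.
move=> /(KL (4 * t ^+ 2)%:A); rewrite (ginv_conic t2).
have KO : [set u | r u = 0] (Omega lam + (4 * lam * e)%:A).
  by have := cr_Omega hr; rewrite scaleNr opprK.
move=> /(ideal_subl hK) /(_ KO) /(ideal_subl hK) /(_ KO).
have Kv' : [set u | r u = 0] (theta (v3 (- t))).
  rewrite (theta_v_chi lam t e2) !rmorphM; apply: (KL); apply: (KR).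
  rewrite K -h /chi_ideal -theta_chi; exact: mem_ideal_gen.
rewrite /= rmorphD Kv' addr0 => rv; have := rep_v_neq0 hr; by rewrite rv eqxx.
Qed.

(** ** Inclusions between the primes *)

Lemma phi_plusE : phi_plus lam s = chi (- s) 1.
Proof. by rewrite /chi scale1r scaleNr opprK. Qed.
Lemma phi_minusE : phi_minus lam s = chi s 1.
Proof. by rewrite /chi scale1r. Qed.
Lemma psi_plusE : psi_plus lam s = chi s (-1).
Proof. by rewrite /chi scaleN1r -opprD scalerN opprK. Qed.
Lemma psi_minusE : psi_minus lam s = chi (- s) (-1).
Proof. by rewrite /chi scaleN1r -opprD scalerN scaleNr opprK. Qed.
Lemma line1E : line_ideal 1 = @ideal_gen U [set x; g - 1].
Proof. by rewrite /line_ideal scale1r. Qed.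
Lemma lineN1E : line_ideal (-1) = @ideal_gen U [set x; g + 1].
Proof. by rewrite /line_ideal scaleN1r opprK. Qed.
Lemma point1E gamma : point_ideal 1 gamma = @ideal_gen U [set x; g - 1; y - gamma%:A].
Proof. by rewrite /point_ideal scale1r. Qed.
Lemma pointN1E gamma : point_ideal (-1) gamma = @ideal_gen U [set x; g + 1; y - gamma%:A].
Proof. by rewrite /point_ideal scaleN1r opprK. Qed.

Lemma sign_cases (e : k) : e ^+ 2 = 1 -> e = 1 \/ e = -1.
Proof. by move=> /eqP; rewrite sqrf_eq1 => /orP[] /eqP; [left | right]. Qed.
Lemma sqrt_cases (t : k) : t ^+ 2 = 2 * lam -> t = s \/ t = - s.
Proof. by rewrite -s2 => /eqP; rewrite eqf_sqr => /orP[] /eqP; [left | right]. Qed.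

Lemma zero_idealE : @ideal_gen U [set 0] = [set 0].
Proof. exact/ideal_gen_id/zero_ideal. Qed.

Lemma edge_zero_chi t e : t ^+ 2 = 2 * lam -> e ^+ 2 = 1 ->
  spec_edge s [set 0] (chi_ideal t e).
Proof.
rewrite /chi_ideal -zero_idealE.
move=> /sqrt_cases [] -> /sign_cases [] ->; rewrite -?phi_plusE -?phi_minusE -?psi_plusE -?psi_minusE.
- exact: edge_0_phim.
- exact: edge_0_psip.
- exact: edge_0_phip.
- exact: edge_0_psim.
Qed.

Lemma edge_chi_line t e : t ^+ 2 = 2 * lam -> e ^+ 2 = 1 ->
  spec_edge s (chi_ideal t e) (line_ideal e).
Proof.
rewrite /chi_ideal.
move=> /sqrt_cases [] -> /sign_cases [] ->; rewrite ?line1E ?lineN1E -?phi_plusE -?phi_minusE -?psi_plusE -?psi_minusE.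
- exact: edge_phim.
- exact: edge_psip.
- exact: edge_phip.
- exact: edge_psim.
Qed.

Lemma edge_line_point e gamma : e ^+ 2 = 1 ->
  spec_edge s (line_ideal e) (point_ideal e gamma).
Proof.
by move=> /sign_cases [] ->; rewrite ?line1E ?lineN1E ?point1E ?pointN1E; constructor.
Qed.

Lemma strict_neq (P Q : set U) : P `<=` Q -> P <> Q -> P `<` Q.
Proof. by move=> PQ nPQ; split=> // QP; apply: nPQ; apply/seteqP. Qed.

Lemma zero_strict (I : set U) : twosided_ideal I -> I <> [set 0] -> [set 0] `<` I.
Proof. by move=> [I0 _ _ _] nI; apply: strict_neq => [_ ->|/esym]. Qed.

Lemma edge_strict (P Q : set U) : spec_edge s P Q -> P `<` Q.
Proof.
have e1 : (1 : k) ^+ 2 = 1 by rewrite expr1n.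
have e1' : (-1 : k) ^+ 2 = 1 by rewrite sqrrN expr1n.
have ns2 : (- s) ^+ 2 = 2 * lam by rewrite sqrrN.
case; rewrite ?zero_idealE ?phi_plusE ?phi_minusE ?psi_plusE ?psi_minusE -?line1E -?lineN1E.
- by apply: zero_strict; [exact: ideal_gen_ideal | exact: chi_neq0].
- by apply: zero_strict; [exact: ideal_gen_ideal | exact: chi_neq0].
- by apply: zero_strict; [exact: ideal_gen_ideal | exact: chi_neq0].
- by apply: zero_strict; [exact: ideal_gen_ideal | exact: chi_neq0].
- by move=> alpha a1 a2; apply: zero_strict; [exact: ideal_gen_ideal | exact: Omega_neq0].
- by apply: strict_neq; [exact: chi_sub_line | exact: chi_neq_line].
- by apply: strict_neq; [exact: chi_sub_line | exact: chi_neq_line].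
- by apply: strict_neq; [exact: chi_sub_line | exact: chi_neq_line].
- by apply: strict_neq; [exact: chi_sub_line | exact: chi_neq_line].
- by move=> gamma; rewrite -point1E; apply: strict_neq; [exact: line_sub_point | exact: line_neq_point].
- by move=> gamma; rewrite -pointN1E; apply: strict_neq; [exact: line_sub_point | exact: line_neq_point].
Qed.

Lemma maximal_not_strict (P Q : set U) : maximal_ideal P -> prime_ideal Q -> ~ P `<` Q.
Proof.
by move=> [_ mP] [pQ _] [PQ nQP]; apply: nQP; rewrite (mP Q).
Qed.

Lemma prime_inclusions (P Q : set U) : prime_ideal P -> prime_ideal Q ->
  (P `<` Q <-> clos_trans (set U) (spec_edge s) P Q).
Proof.
move=> pP pQ; split; last first.
  elim=> [A B /edge_strict //|A B D _ [AB nBA] _ [BD nDB]].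
  by split; [exact: subset_trans AB BD | move=> DA; apply: nBA; exact: subset_trans BD DA].
move=> PQ; have [sub nsub] := PQ.
have neq : Q <> P by move=> e; apply: nsub; rewrite e.
have [P0|[t [e [t2 e2 Pe]]]|[alpha [a1 a2 Pe]]|[e [e2 [Pe|[gamma Pe]]]]] := prime_classification pP.
- have [Q0|[t [e [t2 e2 Qe]]]|[alpha [a1 a2 Qe]]|[e [e2 [Qe|[gamma Qe]]]]] := prime_classification pQ.
  + by case: neq; rewrite Q0.
  + by apply: t_step; rewrite P0 Qe; exact: edge_zero_chi.
  + apply: t_step; rewrite P0 Qe -zero_idealE; exact: edge_0_Omega.
  + rewrite P0 Qe; apply: (@t_trans _ _ _ (chi_ideal s e)).
      by apply: t_step; exact: edge_zero_chi.
    by apply: t_step; exact: edge_chi_line.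
  + rewrite P0 Qe; apply: (@t_trans _ _ _ (line_ideal e)); last first.
      by apply: t_step; exact: edge_line_point.
    apply: (@t_trans _ _ _ (chi_ideal s e)).
      by apply: t_step; exact: edge_zero_chi.
    by apply: t_step; exact: edge_chi_line.
- rewrite Pe in sub neq *.
  have [->|[gamma ->]] := chi_above t2 e2 pQ sub neq.
    by apply: t_step; exact: edge_chi_line.
  apply: (@t_trans _ _ _ (line_ideal e)).
    by apply: t_step; exact: edge_chi_line.
  by apply: t_step; exact: edge_line_point.
- rewrite Pe in PQ; exfalso; apply: maximal_not_strict PQ => //.
  exact: (Omega_maximal char0 lam_neq0 s2 a1 a2).
- rewrite Pe in sub neq *.
  have [||Qe|[gamma ->]] := prime_above_line e2 pQ.
  + by apply: sub; exact: line_x.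
  + by apply: sub; exact: line_g.
  + by case: neq.
  + by apply: t_step; exact: edge_line_point.
- rewrite Pe in PQ; exfalso; apply: maximal_not_strict PQ => //.
  exact: point_maximal.
Qed.

End SquareRoot.
End Classification.

(** * Primitive ideals of height at least one *)

Section Primitive.
Variables (k : closedFieldType) (lam : k).
Hypotheses (char0 : forall n, n.+1%:R != 0 :> k) (lam_neq0 : lam != 0).
Local Notation U := (frakU lam).
Local Notation T := {poly k}.
Local Notation theta := (theta lam).
Local Notation Cg' := (Cg' k).
Local Notation Ev := (Ev lam).
Local Notation Theta := (Theta lam).
Local Notation y := (U_y : U).
Local Notation chi_ideal := (@chi_ideal k lam).
Local Notation line_ideal := (@line_ideal k lam).

Lemma scalar_act_eq0 (M : lmodType U) (c : k) (m : M) : c != 0 -> c%:A *: m = 0 -> m = 0.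
Proof.
move=> c0 h; have e : (c^-1%:A : U) * c%:A = 1 by rewrite mulr_algl scalerA mulVf // scale1r.
by rewrite -[m]scale1r -e -scalerA h scaler0.
Qed.

(** The quotient is [k[y]].  A nonzero vector [m] of a simple module either is
    killed by [y] or satisfies [m = h y m] with [h] in [k[y]]; in both cases a
    nonzero polynomial in [y] kills it, and then one of its linear factors kills
    some nonzero vector, hence the whole module. *)
Lemma line_not_primitive (e : k) : e ^+ 2 = 1 -> ~ primitive_ideal (line_ideal e).
Proof.
move=> e2 [M [sM ann]]; have hI := ideal_gen_ideal [set (U_x : U); U_g - e%:A].
have lx := @line_x k lam e; have lg := @line_g k lam e.
have act u : exists f : T, forall m : M, u *: m = horner_alg y f *: m.
  have [f hf] := line_form e2 hI lx lg u; exists f => m.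
  have : annihilator M (u - horner_alg y f) by rewrite -ann.
  by move=> /(_ m); rewrite scalerBl => /eqP; rewrite subr_eq0 => /eqP.
have [[m0 m0N] _] := sM.
have [f f0 fm] : exists2 f : T, f != 0 & horner_alg y f *: m0 = 0.
  have [ym|ym] := eqVneq (y *: m0) 0.
    by exists 'X; rewrite ?polyX_eq0 // horner_algX.
  have [u eu] := simple_module_gen sM ym m0; have [h hh] := act u.
  exists (1 - h * 'X); last first.
    rewrite rmorphB rmorph1 rmorphM /= horner_algX scalerBl scale1r -scalerA -hh -eu.
    by rewrite subrr.
  apply/eqP => /(congr1 (fun q : T => q`_0)).
  by rewrite coefB coefMX coef1 coef0 subr0 => /eqP; rewrite oner_eq0.
have [m [m1 [gamma hg]]] : exists m : M, m != 0 /\ exists gamma, (y - gamma%:A) *: m = 0.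
  have [rs ef] := closed_field_poly_normal f.
  have lc0 : lead_coef f != 0 by rewrite lead_coef_eq0.
  move: fm; rewrite ef -mul_polyC rmorphM /= horner_algC -scalerA.
  move=> /(scalar_act_eq0 lc0) h; elim: rs h {ef} => [|z rs IH].
    by rewrite big_nil rmorph1 scale1r => h; rewrite h eqxx in m0N.
  rewrite big_cons (rmorphM (horner_alg y)) -scalerA /= rmorphB /= horner_algX horner_algC.
  have [/IH //|h] := eqVneq (horner_alg y (\prod_(z <- rs) ('X - z%:P)) *: m0) 0.
  by move=> hz; eexists; split; [exact: h | exists z].
have : line_ideal e (y - gamma%:A).
  rewrite ann => m'; have [u ->] := simple_module_gen sM m1 m'; have [h hh] := act u.
  rewrite hh scalerA; have -> : (y - gamma%:A) * horner_alg y h = horner_alg y h * (y - gamma%:A).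
    have -> : y - gamma%:A = horner_alg y ('X - gamma%:P).
      by rewrite rmorphB /= horner_algX horner_algC.
    exact: horner_y_comm.
  by rewrite -scalerA hg scaler0.
move=> ly; apply: (line_neq_point e2 (gamma := gamma)); apply/seteqP; split.
  exact: line_sub_point.
exact: (point_ideal_min hI lx lg ly).
Qed.

(** A power of [X + c] is not divisible by [X - c]. *)
Lemma spec_power_neq0 (alpha a c : k) M (p : {poly T}) : a * (c + c) != 0 ->
  spec alpha (((a%:P)%:P * ('X + (c%:P)%:P)) ^+ M - p * ('X - (c%:P)%:P)) <> 0.
Proof.
move=> h /(congr1 (fun q : T => q.[c])); rewrite horner0 /spec.
rewrite rmorphB rmorphXn !rmorphM rmorphB rmorphD /= map_polyX !map_polyC /= /horner_eval.
by rewrite !hornerE subrr mulr0 subr0; apply/eqP; rewrite expf_neq0.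
Qed.

Section SquareRoot.
Variable s : k.
Hypothesis s2 : s ^+ 2 = 2 * lam.

(** On the line [chi s e = 0] the function [g^-1] is a multiple of [v_s + c0]
    with [c0 = 4 s^2 e], so the image of [C] is generated by [v_s] and the
    inverse of [v_s + c0], where [v_s - c0] is not a unit.  Hence [v_s - c0]
    generates a proper left ideal modulo [chi_ideal s e].  On a simple quotient
    [v_s] has the eigenvalue [c0], which is not zero, so no power of [v_s] kills
    the module, while ideals strictly above [chi_ideal s e] contain such a
    power. *)
Lemma chi_primitive (e : k) : e ^+ 2 = 1 -> primitive_ideal (chi_ideal s e).
Proof.
move=> e2; have [S [r hr]] := conic_rep_exists char0 lam_neq0 s2 (- (4 * lam * e)).
have K := rep_ker_chi char0 lam_neq0 s2 e2 hr; rewrite theta_chi -/(chi_ideal s e) in K.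
have hI := ideal_gen_ideal [set chi lam s e]; have [I0 ID IL IR] := hI.
pose c0 := 4 * s ^+ 2 * e.
have e0 : e != 0 by apply/eqP => e0; move/eqP: e2; rewrite e0 expr0n /= eq_sym oner_eq0.
have c00 : c0 != 0 by rewrite mulf_neq0 // (four_s2_neq0 char0 lam_neq0 s2).
pose L : set U := [set u | exists a b, chi_ideal s e a /\ u = a + b * theta (v3 s - cst k c0)].
have L0 : L 0 by exists 0, 0; split=> //; rewrite mul0r addr0.
have LD a b : L a -> L b -> L (a + b).
  move=> [a1 [a2 [ha ->]]] [b1 [b2 [hb ->]]]; exists (a1 + b1), (a2 + b2).
  by split; [exact: ID | rewrite mulrDl addrACA].
have LM w a : L a -> L (w * a).
  move=> [a1 [a2 [ha ->]]]; exists (w * a1), (w * a2).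
  by split; [exact: IL | rewrite mulrDr mulrA].
have L1 : ~ L 1.
  move=> [a [b [ha e1]]]; have ra : r a = 0 by rewrite -[_ = 0]/([set u | r u = 0] a) K.
  have [P bP] := Theta_surj b.
  have := cr_inv hr (P := P) (c := v3 s - cst k c0).
  have -> : r (Theta P * theta (v3 s - cst k c0)) = 1.
    by rewrite -bP; have := congr1 r e1; rewrite rmorphD ra add0r rmorph1.
  move=> /(_ erefl); set c := P`_0 => rc.
  have [M [p1 [p2 h]]] := localized_graded_form (two_neq0 char0) lam_neq0 s2 c.
  have rv' : r (theta (v3 (- s))) = 0.
    rewrite -[_ = 0]/([set u | r u = 0] _) K (theta_v_chi lam s e2) !rmorphM.
    by apply: (IL); apply: (IR); rewrite theta_chi; exact: mem_ideal_gen.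
  (* [W] represents [g^-1] on the line. *)
  pose W : {poly T} := (((4 * s ^+ 2)^-1)%:P)%:P * ('X + (c0%:P)%:P).
  have A0 := four_s2_neq0 char0 lam_neq0 s2.
  have KO : r (Omega lam + (4 * lam * e)%:A) = 0 by have := cr_Omega hr; rewrite scaleNr opprK.
  have rW : r (theta (Ev s W)) = r U_ginv.
    have := congr1 r (ginv_conic s2 e); rewrite !rmorphB !(rmorphD r (theta _)) rv' KO addr0 !subr0.
    rewrite mulrBr [_ * e%:A]mulr_algl scalerA -/c0 rmorphB => rv.
    have {}rv : r (theta (v3 s) + c0%:A) = r ((4 * s ^+ 2)%:A * U_ginv).
      by rewrite rmorphD -rv subrK.
    rewrite /W (rmorphM (Ev s)) (rmorphD (Ev s)) /= EvX !EvC !E0C (rmorphM theta) (rmorphD theta).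
    rewrite !theta_cst rmorphM rv -rmorphM mulrA mulr_algl scalerA mulVf //.
    by rewrite scale1r mul1r.
  have : r (theta (Ev s (W ^+ M - p1 * ('X - (c0%:P)%:P)))) = 0.
    rewrite (rmorphB (Ev s)) (rmorphB theta) rmorphB (rmorphXn (Ev s)) (rmorphXn theta).
    rewrite (rmorphXn r) /= rW (rmorphM (Ev s)) (rmorphB (Ev s)) /= EvX !EvC E0C.
    have rp1 : r (theta (Ev s p1)) = r (theta (Cg' ^+ M * c)).
      by rewrite h (rmorphD theta) (rmorphD r) (rmorphM theta) (rmorphM r) rv' mul0r addr0.
    rewrite (rmorphM theta) (rmorphM r) rp1 -(rmorphM r) -(rmorphM theta) -mulrA.
    rewrite (rmorphM theta) (rmorphM r) rc mulr1 (rmorphXn theta) (rmorphXn r) /= theta_g'.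
    by rewrite subrr.
  move/(cr_Ev hr); apply: spec_power_neq0; rewrite mulf_neq0 ?invr_eq0 // -mulr2n -mulr_natl.
  by rewrite mulf_neq0 ?two_neq0.
have [M [sM [m m0 [Lm Mm]]]] := @exists_simple_quotient _ (LeftIdeal L0 LD LM) L1.
exists M; split=> //.
have sub : chi_ideal s e `<=` annihilator M.
  move=> a ha m'; have [u ->] := Mm m'; rewrite scalerA; apply: Lm.
  by exists (a * u), 0; split; [exact: IR | rewrite mul0r addr0].
apply/seteqP; split=> //; apply: contrapT => nsub.
rewrite -K in sub nsub.
have [n] := above_kernel_v char0 lam_neq0 s2 hr (annihilator_ideal M) sub nsub.
move=> /(_ m).
have vm : theta (v3 s) *: m = c0%:A *: m.
  have : theta (v3 s - cst k c0) *: m = 0 by apply: Lm; exists 0, 1; split; rewrite ?mul1r ?add0r.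
  by rewrite rmorphB theta_cst scalerBl => /eqP; rewrite subr_eq0 => /eqP.
have -> : theta (v3 s) ^+ n *: m = (c0 ^+ n)%:A *: m.
  elim: n => [|n IH]; first by rewrite !expr0 !scale1r.
  rewrite exprS -scalerA IH scalerA scalar_comm -scalerA vm scalerA.
  by rewrite mulr_algl scalerA -exprSr.
by move/(scalar_act_eq0 (expf_neq0 n c00))/eqP; rewrite (negPf m0).
Qed.

End SquareRoot.
End Primitive.

(** * The zero ideal is not primitive *)

Lemma size_deriv_char0 (R : idomainType) (p : {poly R}) :
  (forall n, n.+1%:R != 0 :> R) -> size p^`() = (size p).-1.
Proof.
move=> charR; have [->|p0] := eqVneq p 0; first by rewrite deriv0 size_poly0.
have [n sn] : exists n, size p = n.+1.
  by exists (size p).-1; rewrite prednK // lt0n size_poly_eq0.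
rewrite sn /=; case: n sn => [|n] sn.
  by rewrite (size1_polyC (eq_leq sn)) derivC size_poly0.
apply/eqP; rewrite eqn_leq; apply/andP; split.
  apply/leq_sizeP => j nj; rewrite coef_deriv nth_default ?mul0rn //.
  by rewrite sn ltnS.
rewrite ltnNge; apply/negP => /leq_sizeP /(_ n (leqnn n)) /eqP.
rewrite coef_deriv -mulr_natr mulf_eq0 (negPf (charR n)) orbF.
by have := p0; rewrite -lead_coef_eq0 lead_coefE sn => /negPf ->.
Qed.

Section SpecTheory.
Variables (k : fieldType) (alpha : k).
Implicit Types p q : {poly {poly k}}.

Lemma specM p q : spec alpha (p * q) = spec alpha p * spec alpha q.
Proof. exact: rmorphM. Qed.
Lemma specB p q : spec alpha (p - q) = spec alpha p - spec alpha q.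
Proof. exact: rmorphB. Qed.
Lemma specXn p n : spec alpha (p ^+ n) = spec alpha p ^+ n.
Proof. exact: rmorphXn. Qed.
Lemma specC (c : {poly k}) : spec alpha c%:P = (c.[alpha])%:P.
Proof. by rewrite /spec map_polyC. Qed.
Lemma specX : spec alpha 'X = 'X.
Proof. by rewrite /spec map_polyX. Qed.
End SpecTheory.

(** Throughout, [M] is a simple module with zero annihilator; this leads to a
    contradiction.  Normal elements act injectively on [M], and a central
    [Omega - alpha] acts bijectively. *)
Section ZeroNotPrimitive.
Variables (k : closedFieldType) (lam : k).
Hypotheses (char0 : forall n, n.+1%:R != 0 :> k) (lam_neq0 : lam != 0).
Local Notation U := (frakU lam).
Local Notation T := {poly k}.
Local Notation C := {poly {poly {poly k}}}.
Local Notation theta := (theta lam).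
Local Notation Cg' := (Cg' k).
Local Notation E0 := (E0 lam).
Local Notation Ev := (Ev lam).
Local Notation Theta := (Theta lam).
Local Notation y := (U_y : U).
Variable s : k.
Hypothesis s2 : s ^+ 2 = 2 * lam.
Local Notation v := (theta (v3 s)).
Let tw : (2 : k) != 0 := two_neq0 char0.
Let s0 : s != 0 := s_neq0 tw lam_neq0 s2.

Variable M : lmodType U.
Hypotheses (sM : simple_module M) (annM : annihilator M = [set 0]).

Lemma normal_act_inj (z : U) (m : M) : normal_element z -> z != 0 -> z *: m = 0 -> m = 0.
Proof.
move=> nz z0 zm; apply/eqP; apply: contraT => m0.
suff : annihilator M z by rewrite annM => /= h; rewrite h eqxx in z0.
move=> m'; have [u ->] := simple_module_gen sM m0 m'; have [u' e] := nz u.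
by rewrite scalerA e -scalerA zm scaler0.
Qed.

Lemma E0_act_inj (R : T) (m : M) : R != 0 -> theta (E0 R) *: m = 0 -> m = 0.
Proof.
move=> R0; apply: normal_act_inj; last exact: (E0_neq0 char0 lam_neq0 s2).
by move=> u; exists u; exact: (E0_central char0 s2).
Qed.

Lemma v_act_inj (m : M) : v *: m = 0 -> m = 0.
Proof.
apply: normal_act_inj; last exact: (v_neq0 char0 lam_neq0 s2).
exact: (normal_v char0 s2).
Qed.

Lemma g'_act_inj (m : M) : (U_ginv : U) *: m = 0 -> m = 0.
Proof. by move=> h; rewrite -[m]scale1r -(Ugg' lam) -scalerA h scaler0. Qed.

Definition shift alpha : T := 'X - alpha%:P.

Lemma shift_neq0 alpha : shift alpha != 0. Proof. by rewrite polyXsubC_eq0. Qed.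

Lemma Omega_divisible alpha (m : M) : exists u : U, m = theta (E0 (shift alpha)) *: (u *: m).
Proof.
have [->|m0] := eqVneq m 0; first by exists 0; rewrite !scaler0.
have zm : theta (E0 (shift alpha)) *: m != 0.
  by apply/eqP => /(E0_act_inj (shift_neq0 alpha)) h; rewrite h eqxx in m0.
have [u e] := simple_module_gen sM zm m; exists u.
by rewrite scalerA (E0_central char0 s2) -scalerA.
Qed.

(** ** Torsion over the commutative part *)

(** The nonzero vector [m] is killed by a polynomial [p] in [Omega] and [v_s], of
    least degree in [v_s] among all such vectors and polynomials.  Then [M] is
    the direct sum of the subspaces [y^i C m] ([filt_independent]), so that the
    bijectivity of [Omega - alpha] on [M] is inherited by [C m]. *)
Section Torsion.
Variables (m : M) (p : {poly T}).
Hypotheses (m_neq0 : m != 0) (p_neq0 : p != 0) (pm : theta (Ev s p) *: m = 0).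
Hypothesis p_min : forall (m' : M) (q : {poly T}), m' != 0 -> q != 0 -> theta (Ev s q) *: m' = 0 ->
  (size p <= size q)%N.

Definition weight_vec (w : M) := exists c, w = theta c *: m.

Lemma weight_theta c w : weight_vec w -> weight_vec (theta c *: w).
Proof. by move=> [c' ->]; exists (c * c'); rewrite rmorphM scalerA. Qed.
Lemma weightD w w' : weight_vec w -> weight_vec w' -> weight_vec (w + w').
Proof. by move=> [c ->] [c' ->]; exists (c + c'); rewrite rmorphD scalerDl. Qed.
Lemma weight0 : weight_vec 0. Proof. by exists 0; rewrite rmorph0 scale0r. Qed.

Lemma weight_p w : weight_vec w -> theta (Ev s p) *: w = 0.
Proof. by move=> [c ->]; rewrite scalerA theta_comm -scalerA pm scaler0. Qed.

(** The powers of [y] stand on the left, so that the coefficients, elements of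
    [C m], are vectors; [theta_filt] moves elements of [C] past them. *)
Definition filt n (f : M) := exists w : nat -> M,
  (forall i, weight_vec (w i)) /\ f = \sum_(i < n) y ^+ i *: w i.

Lemma filtD n f f' : filt n f -> filt n f' -> filt n (f + f').
Proof.
move=> [w [hw ->]] [w' [hw' ->]]; exists (fun i => w i + w' i); split.
  by move=> i; apply: weightD.
by rewrite -big_split; apply: eq_bigr => i _; rewrite scalerDr.
Qed.

Lemma filt0 n : filt n 0.
Proof.
exists (fun=> 0); split; first by move=> _; exact: weight0.
by rewrite big1 // => i _; rewrite scaler0.
Qed.

Lemma filtN n f : filt n f -> filt n (- f).
Proof.
move=> [w [hw ->]]; exists (fun i => theta (-1) *: w i); split.
  by move=> i; apply: weight_theta.
rewrite -sumrN; apply: eq_bigr => i _.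
by rewrite rmorphN1 scaleN1r scalerN.
Qed.

Lemma filtB n f f' : filt n f -> filt n f' -> filt n (f - f').
Proof. by move=> hf hf'; apply: filtD => //; apply: filtN. Qed.

Lemma filtS n f : filt n f -> filt n.+1 f.
Proof.
move=> [w [hw ->]]; exists (fun i => if i == n then 0 else w i); split.
  by move=> i; case: eqP => // _; exact: weight0.
rewrite big_ord_recr /= eqxx scaler0 addr0; apply: eq_bigr => i _.
by rewrite ltn_eqF.
Qed.

Lemma filt_leq n n' f : (n <= n')%N -> filt n f -> filt n' f.
Proof.
move=> /subnKC <-; elim: (n' - n)%N => [|d IH] h; first by rewrite addn0.
by rewrite addnS; apply: filtS; apply: IH.
Qed.

Lemma filt_y n f : filt n f -> filt n.+1 (y *: f).
Proof.
move=> [w [hw ->]]; exists (fun i => if i is i'.+1 then w i' else 0); split.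
  by case=> // ; exact: weight0.
rewrite big_ord_recl /= scaler0 add0r scaler_sumr; apply: eq_bigr => i _.
by rewrite scalerA -exprS.
Qed.

Lemma filt_top n w : weight_vec w -> filt n.+1 (y ^+ n *: w).
Proof.
move=> hw; exists (fun i => if i == n then w else 0); split.
  by move=> i; case: eqP => // _; exact: weight0.
rewrite big_ord_recr /= eqxx big1 ?add0r // => i _.
by rewrite ltn_eqF // scaler0.
Qed.

Lemma filt_last n f : filt n.+1 f -> exists f' w, [/\ filt n f', weight_vec w & f = f' + y ^+ n *: w].
Proof.
move=> [w [hw ->]]; rewrite big_ord_recr /=.
by exists (\sum_(i < n) y ^+ i *: w i), (w n); split=> //; exists w.
Qed.

Lemma theta_y c c' : theta_deriv lam c c' -> theta c * y = y * theta c - theta c'.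
Proof. by move=> <-; rewrite /ad_y opprB addrC subrK. Qed.

Lemma theta_filt_top c i w : weight_vec w ->
  filt i (theta c *: (y ^+ i *: w) - y ^+ i *: (theta c *: w)).
Proof.
elim: i c w => [|i IH] c w hw; first by rewrite expr0 !scale1r subrr; exact: filt0.
have [c' hc'] := theta_deriv_ex lam c.
have -> : theta c *: (y ^+ i.+1 *: w) - y ^+ i.+1 *: (theta c *: w) =
    y *: (theta c *: (y ^+ i *: w) - y ^+ i *: (theta c *: w)) -
    theta c' *: (y ^+ i *: w).
  rewrite exprS -scalerA [theta c *: (y *: _)]scalerA (theta_y hc') scalerBl -scalerA.
  by rewrite scalerBr -[(y * _) *: _]scalerA addrAC.
apply: filtB; first by apply: filt_y; apply: IH.
rewrite -[X in filt _ X](subrK (y ^+ i *: (theta c' *: w))).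
by apply: filtD; [apply: filtS; apply: IH | apply: filt_top; apply: weight_theta].
Qed.

Lemma theta_filt c n f : filt n f -> filt n (theta c *: f).
Proof.
elim: n f => [|n IH] f.
  by move=> [w [_ ->]]; rewrite big_ord0 scaler0; exact: filt0.
move=> /filt_last [f' [w [hf' hw ->]]]; rewrite scalerDr; apply: filtD.
  by apply: filtS; apply: IH.
rewrite -[X in filt _ X](subrK (y ^+ n *: (theta c *: w))).
apply: filtD; first by apply: filtS; apply: theta_filt_top.
by apply: filt_top; apply: weight_theta.
Qed.

(** From [a y^(i+1) = y^(i+1) a - (i+1) y^i a' + ...]: when [a] kills [C m],
    the second term is the leading one. *)
Lemma kill_filt_top a a' i w : theta_deriv lam a a' ->
  (forall w, weight_vec w -> theta a *: w = 0) -> weight_vec w ->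
  filt i (theta a *: (y ^+ i.+1 *: w) + y ^+ i *: (theta (i.+1%:R * a') *: w)).
Proof.
move=> ha kill hw; elim: i => [|i IH].
  rewrite expr1 !expr0 scale1r mul1r scalerA (theta_y ha) scalerBl -scalerA.
  by rewrite kill // scaler0 sub0r addNr; exact: filt0.
have -> : theta a *: (y ^+ i.+2 *: w) + y ^+ i.+1 *: (theta (i.+2%:R * a') *: w) =
   y *: (theta a *: (y ^+ i.+1 *: w) + y ^+ i *: (theta (i.+1%:R * a') *: w)) -
   (theta a' *: (y ^+ i.+1 *: w) - y ^+ i.+1 *: (theta a' *: w)).
  rewrite [y ^+ i.+2]exprS -[(y * _) *: w]scalerA [theta a *: (y *: _)]scalerA (theta_y ha).
  rewrite scalerBl -scalerA scalerDr -[i.+2%:R]natr1 mulrDl mul1r rmorphD scalerDl scalerDr.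
  rewrite [y *: (y ^+ i *: _)]scalerA -exprS opprB.
  by rewrite addrACA [X in _ + X = _]addrC.
by apply: filtB; [apply: filt_y | apply: theta_filt_top].
Qed.

Lemma size_p_gt1 : (1 < size p)%N.
Proof.
rewrite ltnNge; apply/negP => /size1_polyC e; move: pm p_neq0; rewrite e EvC polyC_eq0.
by move=> h /E0_act_inj /(_ h) /eqP; rewrite (negPf m_neq0).
Qed.

(** [v_s] acts injectively, and the derivative of [p] has smaller degree. *)
Lemma deriv_p_inj w : weight_vec w -> theta (Ev s ('X * p^`())) *: w = 0 -> w = 0.
Proof.
move=> hw; rewrite rmorphM /= EvX rmorphM -scalerA => /v_act_inj h.
apply/eqP; apply: contraT => w0.
have sp := size_p_gt1.
have szd : size p^`() = (size p).-1 by apply: size_deriv_char0; exact: char0_poly.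
have dp0 : p^`() != 0 by rewrite -size_poly_eq0 szd; case: (size p) sp => [|[]].
have := p_min w0 dp0 h; rewrite szd.
by case: (size p) sp => // n _; rewrite ltnn.
Qed.

(** Applying [p], which kills [C m], to a relation lowers its degree by one and
    replaces the top coefficient [w] by a multiple of [p' w], where [p'] is the
    derivative of [p]; this is zero only if [w] is. *)
Lemma filt_independent n f w : filt n f -> weight_vec w -> f + y ^+ n *: w = 0 -> w = 0.
Proof.
elim: n f w => [|n IH] f w.
  by move=> [? [_ ->]] _; rewrite big_ord0 add0r expr0 scale1r.
move=> hf hw e.
have ha := theta_deriv_Ev tw s2 p.
have hkill n' f' : filt n' f' -> filt n'.-1 (theta (Ev s p) *: f').
  elim: n' f' => [|[|n'] IH'] f'.
  - by move=> [? [_ ->]]; rewrite big_ord0 scaler0; exact: filt0.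
  - move=> [w' [hw' ->]]; rewrite big_ord1 expr0 scale1r weight_p //; exact: filt0.
  move=> /filt_last [f1 [w1 [hf1 hw1 ->]]]; rewrite scalerDr; apply: filtD.
    by apply: filtS; apply: IH'.
  rewrite -[X in filt _ X](addrK (y ^+ n' *: (theta (n'.+1%:R * (- cst k s * Ev s ('X * p^`()))) *: w1))).
  apply: filtB; first by apply: filtS; apply: (kill_filt_top _ ha weight_p hw1).
  by apply: filt_top; apply: weight_theta.
have h1 := hkill _ _ hf; rewrite /= in h1.
have h2 := kill_filt_top n ha weight_p hw.
set b := n.+1%:R * _ in h2.
have hb : theta b *: w = 0.
  apply: (IH (- (theta (Ev s p) *: f) - (theta (Ev s p) *: (y ^+ n.+1 *: w) + y ^+ n *: (theta b *: w)))).
  - by apply: filtB => //; apply: filtN.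
  - exact: weight_theta.
  - rewrite opprD addrA subrK -opprD -scalerDr e scaler0 oppr0 //.
move: hb; rewrite /b rmorphM -scalerA rmorphM -scalerA.
have -> : theta n.+1%:R = (n.+1%:R : k)%:A by rewrite rmorph_nat scaler_nat.
rewrite -(rmorphN (cst k)) theta_cst.
move=> /(scalar_act_eq0 (char0 n)) /(scalar_act_eq0 _); rewrite oppr_eq0 => /(_ s0).
exact: deriv_p_inj.
Qed.

Lemma filt_all (m' : M) : exists n, filt n m'.
Proof.
have [u ->] := simple_module_gen sM m_neq0 m'; have [P ->] := Theta_surj u.
exists (size P); rewrite /Theta scaler_suml.
have hm : weight_vec m by exists 1; rewrite rmorph1 scale1r.
apply: (big_ind (filt (size P))) => [|a b ha hb|i _].
- exact: filt0.
- exact: filtD.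
rewrite -scalerA; apply: theta_filt; apply: (@filt_leq i.+1); first exact: ltn_ord.
exact: filt_top.
Qed.

Lemma torsion_divisible alpha : exists c, m = theta (E0 (shift alpha)) *: (theta c *: m).
Proof.
have [u e] := Omega_divisible alpha m.
have hm : weight_vec m by exists 1; rewrite rmorph1 scale1r.
have [n hn] := filt_all (u *: m).
have f1m : filt 1 m by have := filt_top 0 hm; rewrite expr0 scale1r.
suff [w [hw ew]] : filt 1 (u *: m).
  have [c ec] := hw 0%N; exists c.
  by rewrite -ec; move: ew; rewrite big_ord1 expr0 scale1r => <-.
elim: n hn => [|[|n] IH] //; first by move=> [w [_ ->]]; rewrite big_ord0; exact: filt0.
move=> /filt_last [f [w [hf hw ef]]]; apply: IH.
suff -> : u *: m = f by [].
have : theta (E0 (shift alpha)) *: w = 0.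
  apply: (@filt_independent n.+1 (theta (E0 (shift alpha)) *: f - m)).
  - by apply: filtB; [apply: theta_filt | apply: filt_leq f1m].
  - exact: weight_theta.
  rewrite [y ^+ _ *: _]scalerA -(E0_central char0 s2) -scalerA addrAC -scalerDr -ef -e.
  by rewrite subrr.
by move=> /(E0_act_inj (shift_neq0 alpha)) w0; rewrite ef w0 scaler0 addr0.
Qed.

End Torsion.

Lemma act_ginv_poly (m : M) : theta (Ev s (ginv_poly s)) *: m = 0 -> m = 0.
Proof.
rewrite (theta_ginv_poly s2) (rmorphM theta) (rmorphM theta) theta_cst theta_g' -scalerA -scalerA.
move=> /(scalar_act_eq0 (four_s2_neq0 char0 lam_neq0 s2)) /g'_act_inj.
exact: v_act_inj.
Qed.

Lemma spec_ginv_poly alpha : spec alpha (ginv_poly s) =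
  ('X - (alpha + 4 * lam)%:P) * ('X - (alpha - 4 * lam)%:P).
Proof.
rewrite /spec /ginv_poly -lock rmorphB rmorphXn rmorphB /= map_polyX !map_polyC /= /horner_eval.
by rewrite hornerX hornerC s2 !polyCD polyCN !polyCM; ring.
Qed.

Lemma ginv_poly_factor :
  ginv_poly s = ('X - ('X + (4 * lam)%:P)%:P) * ('X - ('X - (4 * lam)%:P)%:P).
Proof.
by rewrite /ginv_poly -lock s2 !polyCD !polyCN !polyCM; ring.
Qed.

(** Write [m = (Omega - alpha) c m] with [c] in [C], and clear denominators:
    with [D] a product of powers of [ginv_poly s] and [v_s], some
    [D - (Omega - alpha) B] kills [m] and so is a multiple of [p], up to the
    leading coefficient of [p].  On the conic [Omega = alpha], [p] divides [D],
    whose roots are [0] and [alpha +- 4 lam].  But [v_s] and [g^-1] act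
    injectively, so none of these is identically a root of [p], and a generic
    [alpha] excludes them all, although [p] has positive degree. *)
Lemma torsion_contradiction (m : M) (p : {poly T}) : m != 0 -> p != 0 ->
  theta (Ev s p) *: m = 0 -> False.
Proof.
move=> m0 p0 pm.
(* Pass to an annihilating polynomial of least degree. *)
pose Q n := `[< exists (m' : M) (q : {poly T}), [/\ m' != 0, q != 0, theta (Ev s q) *: m' = 0 & size q = n] >].
have exQ : exists n, Q n by exists (size p); apply/asboolP; exists m, p.
case: (ex_minnP exQ) => n /asboolP [{m0 pm}m1 [{p0}p1 [m0 p0 pm sp]]] hmin.
move: m1 p1 m0 p0 pm sp => {m p} m p m0 p0 pm sp {exQ}.
have p_min (m' : M) (q : {poly T}) : m' != 0 -> q != 0 -> theta (Ev s q) *: m' = 0 ->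
    (size p <= size q)%N.
  by move=> m'0 q0 h; rewrite sp; apply: hmin; apply/asboolP; exists m', q.
have no_factor (a : T) q : (forall m' : M, theta (Ev s ('X - a%:P)) *: m' = 0 -> m' = 0) ->
    p <> q * ('X - a%:P).
  move=> inj e; have q0 : q != 0 by apply: contraNneq p0 => q0; rewrite e q0 mul0r.
  have : theta (Ev s q) *: m = 0.
    by apply: inj; rewrite scalerA -rmorphM -rmorphM mulrC -e.
  move=> /(p_min _ _ m0 q0); rewrite e size_Mmonic ?monicXsubC // size_XsubC addn2 /=.
  by rewrite ltnn.
have root_neq0 (a : T) : (forall m' : M, theta (Ev s ('X - a%:P)) *: m' = 0 -> m' = 0) -> p.[a] != 0.
  by move=> inj; apply/negP => /factor_theorem [q]; exact: no_factor.
have h0 : p.[0] != 0.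
  by apply: root_neq0 => m'; rewrite subr0 EvX; exact: v_act_inj.
have hplus : p.['X + (4 * lam)%:P] != 0.
  apply: root_neq0 => m' h; apply: act_ginv_poly.
  by rewrite ginv_poly_factor mulrC (rmorphM (Ev s)) (rmorphM theta) -scalerA h scaler0.
have hminus : p.['X - (4 * lam)%:P] != 0.
  apply: root_neq0 => m' h; apply: act_ginv_poly.
  by rewrite ginv_poly_factor (rmorphM (Ev s)) (rmorphM theta) -scalerA h scaler0.
have lc0 : lead_coef p != 0 by rewrite lead_coef_eq0.
have [alpha] := generic_point (mulf_neq0 (mulf_neq0 lc0 h0) (mulf_neq0 hplus hminus)).
rewrite !hornerM !mulf_eq0 !negb_or => /andP[/andP[la a0] /andP[ap am]].
have [c ec] := torsion_divisible m0 p0 pm p_min alpha.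
have [N1 [N [b [e _]]]] := v_form tw lam_neq0 s2 c.
pose A := (4 * s ^+ 2) ^+ N1.
pose D : {poly T} := ginv_poly s ^+ N1 * 'X^N.
pose B : {poly T} := (A%:P)%:P * 'X^N1 * b.
have Dm : theta (Ev s (D - (shift alpha)%:P * B)) *: m = 0.
  rewrite rmorphB rmorphB scalerBl; apply/eqP; rewrite subr_eq0; apply/eqP.
  have e1 : theta (Ev s D) = A%:A * v ^+ N1 * theta (Cg' ^+ N1 * v3 s ^+ N).
    rewrite /D (rmorphM (Ev s)) !(rmorphXn (Ev s)) /= EvX (rmorphM theta) (rmorphXn theta).
    rewrite (theta_ginv_poly s2) -(rmorphXn theta) -(rmorphM theta) -theta_cst -(rmorphXn theta).
    rewrite -(rmorphM theta) -(rmorphM theta); apply: (congr1 (fun p => theta p)).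
    by rewrite /A (rmorphXn (cst k)) !exprMn; ring.
  have eB : theta (Ev s ((shift alpha)%:P * B)) =
      theta (E0 (shift alpha) * cst k A * v3 s ^+ N1) * theta (Ev s b).
    rewrite /B !(rmorphM (Ev s)) !EvC E0C (rmorphXn (Ev s)) /= EvX -(rmorphM theta).
    by apply: (congr1 (fun p => theta p)); ring.
  rewrite e1 eB -e -scalerA {1}ec -theta_cst -(rmorphXn theta) -!(rmorphM theta).
  rewrite !scalerA -!(rmorphM theta).
  by congr (_ *: _); apply: (congr1 (fun p => theta p)); ring.
have specD : spec alpha D =
    (('X - (alpha + 4 * lam)%:P) * ('X - (alpha - 4 * lam)%:P)) ^+ N1 * 'X^N.
  by rewrite /D specM specXn spec_ginv_poly specXn specX.
have eqD := Pdiv.Idomain.divp_eq (D - (shift alpha)%:P * B) p.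
have rem0 : (D - (shift alpha)%:P * B) %% p = 0.
  apply/eqP; apply: contraT => r0; have : theta (Ev s ((D - (shift alpha)%:P * B) %% p)) *: m = 0.
    have := congr1 (fun q => theta (Ev s q) *: m) eqD; rewrite /= -mul_polyC.
    rewrite (rmorphM (Ev s)) (rmorphM theta) -scalerA Dm scaler0.
    rewrite (rmorphD (Ev s)) (rmorphD theta) scalerDl (rmorphM (Ev s)) (rmorphM theta) -scalerA.
    by rewrite pm scaler0 add0r.
  by move=> /(p_min _ _ m0 r0); rewrite leqNgt ltn_modpN0.
have eq_spec : (lead_coef p ^+ scalp (D - (shift alpha)%:P * B) p).[alpha]%:P *
    spec alpha D = spec alpha ((D - (shift alpha)%:P * B) %/ p) * spec alpha p.
  have := congr1 (spec alpha) eqD; rewrite rem0 addr0 -mul_polyC specM specC specB.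
  rewrite [spec _ (_%:P * B)]specM specC /shift hornerXsubC subrr mul0r subr0 => ->.
  by rewrite specM.
have size_spec : size (spec alpha p) != 1%N.
  rewrite /spec size_map_poly_id0 // neq_ltn.
  by rewrite (size_p_gt1 m0 p0 pm) orbT.
have [beta /rootP pb] := closed_rootP _ size_spec.
have spec_at (c1 : T) : (spec alpha p).[c1.[alpha]] = p.[c1].[alpha].
  exact: (horner_map (horner_eval alpha)).
have := congr1 (fun q : T => q.[beta]) eq_spec.
rewrite /= !hornerM pb mulr0 hornerC horner_exp specD => /eqP.
rewrite mulf_eq0 expf_eq0 (negPf la) andbF /= hornerM mulf_eq0 => /orP[].
  rewrite horner_exp expf_eq0 => /andP[_]; rewrite hornerM !hornerXsubC mulf_eq0.
  case/orP; rewrite subr_eq0 => /eqP eb.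
    by move: ap; rewrite -spec_at hornerD hornerX hornerC -eb pb eqxx.
  by move: am; rewrite -spec_at hornerXsubC -eb pb eqxx.
rewrite hornerXn expf_eq0 => /andP[_ /eqP eb].
by move: a0; rewrite -spec_at horner0; rewrite eb in pb; rewrite pb eqxx.
Qed.

(** ** The torsion-free case *)

Section TorsionFree.
Hypothesis torsion_free : forall (m : M) c, theta c *: m = 0 -> m != 0 -> theta c = 0.

Lemma lead_shift (P : {poly C}) j : exists R : {poly C}, [/\ y ^+ j * Theta P = Theta R,
  (size R <= size P + j)%N & (0 < size P)%N -> R`_((size P).-1 + j) = P`_(size P).-1].
Proof.
elim: j => [|j [R [e szR lR]]].
  by exists P; rewrite expr0 mul1r !addn0.
have [Q eQ szQ] := y_Theta lam R.
exists (R * 'X + Q); rewrite exprS -mulrA e eQ; split=> //.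
  apply: leq_trans (size_polyD _ _) _; rewrite geq_max; apply/andP; split.
    have [->|R0] := eqVneq R 0; first by rewrite mul0r size_poly0.
    by rewrite size_mulX // addnS.
  by apply: leq_trans szQ _; apply: leq_trans szR _; rewrite addnS.
move=> P0; rewrite coefD coefMX addnS /= lR // [Q`_ _]nth_default ?addr0 //.
by apply: leq_trans szQ _; apply: leq_trans szR _; rewrite -addSn prednK.
Qed.

(** Let [P] have the least degree [n] in [y] among the nonzero elements killing
    a fixed vector [m], and let [a] be its leading coefficient.  Pseudo-division
    by [P] turns [a^j u m] into [R m] with [R] of degree less than [n].  For
    [m = (Omega - alpha) u m] this shows that [a^j - (Omega - alpha) R] kills
    [m], and so vanishes.  Comparing constant coefficients, [a] vanishes on the
    conic [Omega = alpha], which fails for generic [alpha]. *)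
Lemma torsion_free_contradiction : False.
Proof.
have [[m m0] _] := sM.
pose ann_by n := `[< exists P : {poly C}, [/\ Theta P != 0, Theta P *: m = 0 & size P = n] >].
have ex_ann : exists n, ann_by n.
  have [u e] := Omega_divisible 0 m.
  have [P eP] := Theta_surj (1 - theta (E0 (shift 0)) * u).
  exists (size P); apply/asboolP; exists P; rewrite -eP; split=> //; last first.
    by rewrite scalerBl scale1r -scalerA -e subrr.
  apply/eqP => /eqP; rewrite subr_eq0 => /eqP h.
  have [S [r hr]] := conic_rep_exists char0 lam_neq0 s2 0.
  have := congr1 r h; rewrite rmorph1 rmorphM /shift rmorphB /= E0X E0C rmorphB theta_Om theta_cst.
  by rewrite (cr_Omega hr) mul0r => /eqP; rewrite oner_eq0.
case: (ex_minnP ex_ann) => N /asboolP [P [P0 Pm szP]] hmin.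
have min_ann (Q : {poly C}) : (size Q < N)%N -> Theta Q *: m = 0 -> Theta Q = 0.
  move=> szQ Qm; apply/eqP; apply: contraT => Q0; move: szQ; rewrite ltnNge.
  by rewrite hmin //; apply/asboolP; exists Q.
have N0 : (0 < N)%N.
  rewrite lt0n; apply: contra P0; rewrite -szP size_poly_eq0 => /eqP ->.
  by rewrite /Theta size_poly0 big_ord0.
pose n := N.-1; have en : N = n.+1 by rewrite prednK.
pose a := P`_n.
have a0 : theta a != 0.
  apply: contra P0 => /eqP ta; have [P' szP' eP] := Theta_split lam (eq_leq (etrans szP en)).
  move: Pm; rewrite eP -/a ta mul0r addr0 => /min_ann ->; first by [].
  by rewrite en.
have n0 : (0 < n)%N.
  rewrite lt0n; apply/negP => /eqP n0; move: Pm.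
  have -> : Theta P = theta a.
    by rewrite /a n0 -ThetaC -size1_polyC // szP en n0.
  by move=> /torsion_free /(_ m0) h; rewrite h eqxx in a0.
have clear_lead (Q : {poly C}) : exists j (R : {poly C}), (size R <= n)%N /\
    theta (a ^+ j) *: (Theta Q *: m) = Theta R *: m.
  have [K] := ubnP (size Q); elim: K Q => // K IH Q; rewrite ltnS => szQ.
  have [Qn|nQ] := leqP (size Q) n.
    by exists 0%N, Q; rewrite expr0 rmorph1 scale1r.
  have K0 : (n < K)%N := leq_trans nQ szQ.
  have [R [eR szR lR]] := lead_shift P (K.-1 - n).
  have sK : K.-1.+1 = K by rewrite prednK // (leq_ltn_trans _ K0).
  have nK : (n <= K.-1)%N by rewrite -ltnS sK.
  rewrite szP en /= subnKC // in szR lR.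
  have {}lR := lR isT.
  pose Q2 := a *: Q - Q`_K.-1 *: R.
  have szQ2 : (size Q2 < K)%N.
    rewrite -sK ltnS; apply/leq_sizeP => i; rewrite leq_eqVlt coefB !coefZ => /orP[/eqP <-|hi].
      by rewrite lR -/a mulrC subrr.
    rewrite [Q`_i]nth_default ?(leq_trans szQ) ?mulr0 //; last by rewrite -sK.
    rewrite [R`_i]nth_default ?mulr0 ?subrr // (leq_trans szR) //.
    by rewrite addSn subnKC.
  have [j [R' [szR' e]]] := IH Q2 szQ2.
  have Rm : Theta R *: m = 0 by rewrite -eR -scalerA Pm scaler0.
  exists j.+1, R'; split=> //; rewrite -e ThetaB !Theta_scale scalerBl.
  rewrite -[(theta Q`_K.-1 * _) *: m]scalerA Rm scaler0 subr0.
  by rewrite exprSr (rmorphM theta) -!scalerA.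
have [Ra Ra0 gen_a] := generic_nonzero char0 lam_neq0 s2 a0.
have [alpha ha] := generic_point Ra0.
have [u e] := Omega_divisible alpha m.
have [Q eQ] := Theta_surj u.
have [j [R [szR eR]]] := clear_lead Q.
have : Theta ((a ^+ j)%:P - E0 (shift alpha) *: R) = 0.
  apply: min_ann.
    rewrite en ltnS; apply: leq_trans (size_polyD _ _) _; rewrite size_polyN geq_max.
    apply/andP; split; first by apply: leq_trans (size_polyC_leq1 _) _.
    by apply: leq_trans (size_scale_leq _ _) _.
  rewrite ThetaB ThetaC Theta_scale scalerBl -scalerA -eR -eQ.
  rewrite [_ *: (theta (a ^+ j) *: _)]scalerA (E0_central char0 s2) -scalerA -e.
  by rewrite subrr.
move=> /(Theta_zero char0 lam_neq0 s2) /(_ 0%N).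
rewrite coefB coefC coefZ /= (rmorphB theta) (rmorphM theta) => h.
have [S [r hr]] := conic_rep_exists char0 lam_neq0 s2 alpha.
have := gen_a _ _ _ hr ha; suff -> : r (theta a) = 0 by rewrite eqxx.
have : r (theta (a ^+ j)) = 0.
  move/eqP: h; rewrite subr_eq0 => /eqP ->.
  rewrite /shift (rmorphB E0) /= E0X E0C (rmorphB theta) theta_Om theta_cst rmorphM.
  by rewrite (cr_Omega hr) mul0r.
rewrite (rmorphXn theta) (rmorphXn r) /=; elim: j {eR h} => [|j IH].
  by rewrite expr0 => /eqP; rewrite oner_eq0.
by rewrite exprS => /(cr_domain hr) [].
Qed.

End TorsionFree.

Lemma faithful_simple_absurd : False.
Proof.
apply: torsion_free_contradiction => m c cm m0.
apply: contrapT => c0.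
have [N1 [N [p [e hp]]]] := v_form tw lam_neq0 s2 c.
apply: (torsion_contradiction m0 (p := p)).
  by apply/eqP => /hp.
by rewrite -e (rmorphM theta) -scalerA cm scaler0.
Qed.

End ZeroNotPrimitive.

Lemma zero_not_primitive (k : closedFieldType) (lam : k) (s : k) :
  (forall n, n.+1%:R != 0 :> k) -> lam != 0 -> s ^+ 2 = 2 * lam ->
  ~ primitive_ideal ([set 0] : set (frakU lam)).
Proof.
move=> char0 lam0 s2 [M [sM ann]].
exact: (faithful_simple_absurd char0 lam0 s2 sM (esym ann)).
Qed.

(** * The spectra *)

Section Spectra.
Variables (k : closedFieldType) (lam : k).
Hypotheses (char0 : forall n, n.+1%:R != 0 :> k) (lam_neq0 : lam != 0).
Variable s : k.
Hypothesis s2 : s ^+ 2 = 2 * lam.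
Local Notation U := (frakU lam).
Local Notation chi_ideal := (@chi_ideal k lam).
Local Notation line_ideal := (@line_ideal k lam).
Local Notation point_ideal := (@point_ideal k lam).
Local Notation Omega_ideal := (@Omega_ideal k lam).

Definition Omega_ideals : set (set U) :=
  [set ideal_gen [set Omega lam - alpha%:A]
    | alpha in [set alpha | alpha != 4 * lam /\ alpha != - (4 * lam)]].
Definition chi_ideals : set (set U) :=
  [set ideal_gen [set phi_plus lam s]; ideal_gen [set phi_minus lam s];
       ideal_gen [set psi_plus lam s]; ideal_gen [set psi_minus lam s]].
Definition line_ideals : set (set U) :=
  [set ideal_gen [set U_x; U_g - 1]; ideal_gen [set U_x; U_g + 1]].
Definition plus_points : set (set U) :=
  [set ideal_gen [set U_x; U_g - 1; U_y - gamma%:A] | gamma in [set: k]].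
Definition minus_points : set (set U) :=
  [set ideal_gen [set U_x; U_g + 1; U_y - gamma%:A] | gamma in [set: k]].

Lemma one2 : (1 : k) ^+ 2 = 1. Proof. exact: expr1n. Qed.
Lemma mone2 : (-1 : k) ^+ 2 = 1. Proof. by rewrite sqrrN expr1n. Qed.
Lemma Ns2 : (- s) ^+ 2 = 2 * lam. Proof. by rewrite sqrrN. Qed.

Lemma chi_idealsE I : chi_ideals I <->
  exists t e, [/\ t ^+ 2 = 2 * lam, e ^+ 2 = 1 & I = chi_ideal t e].
Proof.
rewrite /chi_ideals phi_plusE phi_minusE psi_plusE psi_minusE; split.
  by move=> [[[->|->]|->]|->];
    [exists (- s), 1 | exists s, 1 | exists s, (-1) | exists (- s), (-1)];
    split; rewrite ?Ns2 ?one2 ?mone2.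
move=> [t [e [/(sqrt_cases s2) [] -> /sign_cases [] -> ->]]].
- by left; left; right.
- by left; right.
- by left; left; left.
- by right.
Qed.

Lemma line_idealsE I : line_ideals I <-> exists e, e ^+ 2 = 1 /\ I = line_ideal e.
Proof.
rewrite /line_ideals -line1E -lineN1E; split.
  by move=> [->|->]; [exists 1 | exists (-1)]; rewrite ?one2 ?mone2.
by move=> [e [/sign_cases [] -> ->]]; [left | right].
Qed.

Lemma point_idealsE I : (plus_points `|` minus_points) I <->
  exists e, e ^+ 2 = 1 /\ exists gamma, I = point_ideal e gamma.
Proof.
split.
  move=> [[gamma _ <-]|[gamma _ <-]]; [exists 1 | exists (-1)]; rewrite ?one2 ?mone2.
    by split=> //; exists gamma; rewrite point1E.
  by split=> //; exists gamma; rewrite pointN1E.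
move=> [e [/sign_cases [] -> [gamma ->]]]; [left | right]; exists gamma => //.
  by rewrite point1E.
by rewrite pointN1E.
Qed.

Lemma Omega_idealsE I : Omega_ideals I <->
  exists alpha, [/\ alpha != 4 * lam, alpha != - (4 * lam) & I = Omega_ideal alpha].
Proof.
split; first by move=> [alpha [a1 a2] <-]; exists alpha.
by move=> [alpha [a1 a2 ->]]; exists alpha.
Qed.

Lemma prime_cprime (P : set U) : prime_ideal P -> elementwise_cprime P.
Proof.
move=> /(prime_classification char0 lam_neq0 s2) [->|[t [e [t2 e2 ->]]]|[a [a1 a2 ->]]|[e [e2 [->|[gamma ->]]]]].
- exact: (zero_cprime char0 lam_neq0 s2).
- exact: chi_cprime.
- exact: (Omega_cprime char0 lam_neq0 s2).
- exact: line_cprime.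
- exact: point_cprime.
Qed.

Lemma SpecE : Spec U = [set ideal_gen [set 0]] `|` chi_ideals `|` Omega_ideals `|` line_ideals
  `|` plus_points `|` minus_points.
Proof.
apply/seteqP; split=> P.
  move=> /(prime_classification char0 lam_neq0 s2) [->|h|h|[e [e2 [->|[gamma ->]]]]].
  - by do 5! left; rewrite zero_idealE.
  - by do 4! left; right; apply/chi_idealsE.
  - by do 3! left; right; apply/Omega_idealsE.
  - by do 2! left; right; apply/line_idealsE; exists e.
  - rewrite -setUA; right; apply/point_idealsE; exists e; split=> //.
    by exists gamma.
rewrite -[_ `|` plus_points `|` _]setUA.
move=> [[[[->|/chi_idealsE [t [e [t2 e2 ->]]]]|/Omega_idealsE [a [a1 a2 ->]]]|/line_idealsE [e [e2 ->]]]|/point_idealsE [e [e2 [gamma ->]]]]; apply: cprime_prime.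
- by rewrite zero_idealE; exact: (zero_cprime char0 lam_neq0 s2).
- exact: chi_cprime.
- exact: (Omega_cprime char0 lam_neq0 s2).
- exact: line_cprime.
- exact: point_cprime.
Qed.

Lemma not_maximal_strict (P Q : set U) : maximal_ideal P -> elementwise_cprime Q ->
  P `<` Q -> False.
Proof. by move=> mP /cprime_prime pQ; exact: maximal_not_strict. Qed.

Lemma MaxE : Max U = Omega_ideals `|` plus_points `|` minus_points.
Proof.
have a0 : (0 : k) != 4 * lam.
  by rewrite eq_sym mulf_neq0 // (char0 3).
have a0' : (0 : k) != - (4 * lam) by rewrite eq_sym oppr_eq0 eq_sym.
rewrite -setUA; apply/seteqP; split=> P; last first.
  move=> [/Omega_idealsE [a [a1 a2 ->]]|/point_idealsE [e [e2 [gamma ->]]]].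
    exact: (Omega_maximal char0 lam_neq0 s2).
  exact: point_maximal.
move=> mP; have := maximal_prime mP.
move=> /(prime_classification char0 lam_neq0 s2) [P0|[t [e [t2 e2 Pe]]]|h|[e [e2 [Pe|[gamma Pe]]]]].
- exfalso; apply: (not_maximal_strict mP (Omega_cprime char0 lam_neq0 s2 a0 a0')).
  rewrite P0; apply: zero_strict; first exact: ideal_gen_ideal.
  exact: Omega_neq0.
- exfalso; apply: (not_maximal_strict mP (line_cprime lam e2)).
  by rewrite Pe; apply: strict_neq; [exact: chi_sub_line | exact: chi_neq_line].
- by left; apply/Omega_idealsE.
- exfalso; apply: (not_maximal_strict mP (point_cprime lam e2 0)).
  by rewrite Pe; apply: strict_neq; [exact: line_sub_point | exact: line_neq_point].
- by right; apply/point_idealsE; exists e; split=> //; exists gamma.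
Qed.

Lemma PrimE : Prim U = chi_ideals `|` Omega_ideals `|` plus_points `|` minus_points.
Proof.
rewrite -setUA; apply/seteqP; split=> P; last first.
  move=> [[/chi_idealsE [t [e [t2 e2 ->]]]|/Omega_idealsE [a [a1 a2 ->]]]|/point_idealsE [e [e2 [gamma ->]]]].
  - exact: chi_primitive.
  - by apply: maximal_primitive; exact: (Omega_maximal char0 lam_neq0 s2).
  - by apply: maximal_primitive; exact: point_maximal.
move=> pP; have := primitive_prime pP.
move=> /(prime_classification char0 lam_neq0 s2) [P0|h|h|[e [e2 [Pe|[gamma Pe]]]]].
- by exfalso; move: pP; rewrite P0; exact: (zero_not_primitive char0 lam_neq0 s2).
- by left; left; apply/chi_idealsE.
- by left; right; apply/Omega_idealsE.
- by exfalso; move: pP; rewrite Pe /=; exact: line_not_primitive.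
- by right; apply/point_idealsE; exists e; split=> //; exists gamma.
Qed.

End Spectra.

Theorem theorem4p7 (k : closedFieldType) (char0 : [pchar k] =i pred0)
  (lam : k) (lam_neq0 : lam != 0) (s : k) (sqrt_2lam : s ^+ 2 = 2 * lam) :
  [/\ Spec (frakU lam)
      = [set ideal_gen [set 0]]
        `|` [set ideal_gen [set phi_plus lam s]; ideal_gen [set phi_minus lam s];
                 ideal_gen [set psi_plus lam s]; ideal_gen [set psi_minus lam s]]
        `|` [set ideal_gen [set Omega lam - alpha%:A]
              | alpha in [set alpha | alpha != 4 * lam /\ alpha != - (4 * lam)]]
        `|` [set ideal_gen [set U_x; U_g - 1]; ideal_gen [set U_x; U_g + 1]]
        `|` [set ideal_gen [set U_x; U_g - 1; U_y - gamma%:A] | gamma in [set: k]]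
        `|` [set ideal_gen [set U_x; U_g + 1; U_y - gamma%:A] | gamma in [set: k]]
      /\ (forall P Q : set (frakU lam), Spec (frakU lam) P -> Spec (frakU lam) Q ->
            (P `<` Q <-> clos_trans (set (frakU lam)) (spec_edge s) P Q)),
      Max (frakU lam)
      = [set ideal_gen [set Omega lam - alpha%:A]
          | alpha in [set alpha | alpha != 4 * lam /\ alpha != - (4 * lam)]]
        `|` [set ideal_gen [set U_x; U_g - 1; U_y - gamma%:A] | gamma in [set: k]]
        `|` [set ideal_gen [set U_x; U_g + 1; U_y - gamma%:A] | gamma in [set: k]],
      Prim (frakU lam)
      = [set ideal_gen [set phi_plus lam s]; ideal_gen [set phi_minus lam s];
             ideal_gen [set psi_plus lam s]; ideal_gen [set psi_minus lam s]]
        `|` [set ideal_gen [set Omega lam - alpha%:A]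
              | alpha in [set alpha | alpha != 4 * lam /\ alpha != - (4 * lam)]]
        `|` [set ideal_gen [set U_x; U_g - 1; U_y - gamma%:A] | gamma in [set: k]]
        `|` [set ideal_gen [set U_x; U_g + 1; U_y - gamma%:A] | gamma in [set: k]],
      forall P : set (frakU lam), prime_ideal P -> completely_prime_ideal P
    & forall I : set (frakU lam), twosided_ideal I -> I <> [set 0] ->
        I `&` center (frakU lam) <> [set 0]].
Proof.
have natr_neq0 n : n.+1%:R != 0 :> k by have /pcharf0P -> := char0.
split.
- split; first exact: (SpecE natr_neq0 lam_neq0 sqrt_2lam).
  by move=> P Q pP pQ; exact: (prime_inclusions natr_neq0 lam_neq0 sqrt_2lam).
- exact: (MaxE natr_neq0 lam_neq0 sqrt_2lam).
- exact: (PrimE natr_neq0 lam_neq0 sqrt_2lam).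
- move=> P pP; apply: cprime_completely_prime.
  exact: (prime_cprime natr_neq0 lam_neq0 sqrt_2lam).
- by move=> I hI nI; exact: (ideal_meets_center natr_neq0 lam_neq0 sqrt_2lam).
Qed.
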